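(* (Cramér–Rao inequality.) Assume that $\gamma(s,t)=\int_0^{s\wedge t}\sigma_r^2\,dr$, $s,t\in[0,T]$, where $\sigma\in L^2([0,T],dt)$ is an a.e. nonvanishing function, and let $u_t=\int_0^t\dot u_s\,ds$ be an adapted process with $\mathbb{E}\left[\int_0^T\frac{\dot u_s^2}{\sigma_s^2}\,ds\right]<\infty$ and $u\in L^2(\Omega\times[0,T],\mathbb{P}_u\otimes\mu)$. For any unbiased and adapted estimator $\xi$ of $u$ we have $$\mathbb{E}_u\left[\int_0^T|\xi_t-u_t|^2\,\mu(dt)\right]\ \ge\ \mathrm{R}(\sigma,\mu,\hat u),$$ where the Cramér–Rao type bound $$\mathrm{R}(\sigma,\mu,\hat u):=\int_0^T\int_0^t\sigma_s^2\,ds\,\mu(dt)$$ is independent of $u$ and is attained by the efficient estimator $\hat u=X$.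
   Context: Let $T>0$ and let $\mu$ be a finite Borel measure on $[0,T]$. $X=(X_t)_{t\in[0,T]}$ is a real-valued centered Gaussian process (the canonical process) with covariance $\gamma(s,t)=\mathbb{E}[X_sX_t]$ on a probability space $(\Omega,\mathcal{F},\mathbb{P})$, with $\mathcal{F}$ generated by $X$; $\mathbb{E}$ is the expectation under $\mathbb{P}$. For the covariance considered here, $X$ has independent increments. Drifts are adapted processes of the form $u_t=\int_0^t\dot u_s\,ds$, $t\in[0,T]$, with $\dot u\in L^2(\Omega\times[0,T])$. For such $u$, $\mathbb{P}_u$ is the probability obtained by translating $\mathbb{P}$ by $u$, under which $X_t=u_t+X^u_t$ with $X^u=(X_t^u)_{t\in[0,T]}$ a centered Gaussian process with covariance $\gamma$; in the present setting it is given by $d\mathbb{P}_u=\Lambda(u)\,d\mathbb{P}$ with $\Lambda(u)=\exp\left(\int_0^T\frac{\dot u_s}{\sigma_s^2}\,dX_s-\frac12\int_0^T\frac{\dot u_s^2}{\sigma_s^2}\,ds\right)$. $\mathbb{E}_u$ is the expectation under $\mathbb{P}_u$. A drift estimator $\xi=(\xi_t)_{t\in[0,T]}$ is called unbiased if $\mathbb{E}_u[\xi_t]=\mathbb{E}_u[u_t]$, $t\in[0,T]$, for all square-integrable adapted processes $(u_t)_{t\in[0,T]}$ (drifts of the form $u_t=\int_0^t\dot u_s\,ds$, $t\in[0,T]$, with $\dot u\in L^2(\Omega\times[0,T])$). It is called adapted if the process $(\xi_t)_{t\in[0,T]}$ is adapted to the filtration $(\mathcal{F}_t)_{t\in[0,T]}$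 generated by $(X^u_t)_{t\in[0,T]}$. *)

(* Defs.v *)
From HB Require Import structures.
From mathcomp Require Import all_boot all_order all_algebra.
From mathcomp Require Import all_classical all_reals all_analysis.

Set Implicit Arguments.
Unset Strict Implicit.
Unset Printing Implicit Defensive.

Import Order.TTheory GRing.Theory Num.Theory.
Import numFieldNormedType.Exports.

Local Open Scope classical_set_scope.
Local Open Scope ring_scope.

(* A process is a function [X : R -> Om -> R], [X t w] being its value at time
   [t]; only its values at times in [[0, T]] are ever used.                   *)

Section processes.
Context {R : realType} {d : measure_display} {Om : measurableType d}.
Implicit Types (X Y : R -> Om -> R) (T t : R).

Definition measurable_process T Y : Prop :=
  measurable_fun ([set: Om] `*` `[0, T] : set (Om * measurableTypeR R))
    (fun z => Y z.2 z.1).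

Definition natural_filtration X t : set (set Om) :=
  <<s [set A | exists s, exists B : set R,
         [/\ 0 <= s <= t, measurable B & A = X s @^-1` B] ]>>.

Definition measurable_wrt (G : set (set Om)) (f : Om -> R) : Prop :=
  forall B : set R, measurable B -> G (f @^-1` B).

Definition adapted T X Y : Prop :=
  forall t, 0 <= t <= T -> measurable_wrt (natural_filtration X t) (Y t).

Definition square_integrable (P : probability Om R)
    (m : {sigma_finite_measure set (measurableTypeR R) -> \bar R}) T Y : Prop :=
  measurable_process T Y /\
  (\int[P \x m]_(z in [set: Om] `*` `[0%R, T]) ((Y z.2 z.1) ^+ 2)%:E < +oo)%E.

(* [normal_prob m 0] is not the Dirac mass at [m], so degenerate Gaussian
   variables are listed separately.                                           *)
Definition gaussian_rv (P : probability Om R) (Y : Om -> R) : Prop :=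
  measurable_fun [set: Om] Y /\
  exists m s : R, forall B : set R, measurable B ->
    P (Y @^-1` B) = if s == 0 then \d_m B else normal_prob m s B.

Definition gaussian_process (P : probability Om R) T X : Prop :=
  forall (n : nat) (t a : 'I_n -> R), (forall i, 0 <= t i <= T) ->
    gaussian_rv P (fun w => \sum_(i < n) a i * X (t i) w).

End processes.

Section stochastic_integral.
Context {R : realType} {d : measure_display} {Om : measurableType d}.
Implicit Types (X h : R -> Om -> R) (sigma : R -> R) (T : R).

(* The process sum_(i < n) c_i 1_(]t_i, t_(i+1)]).                            *)
Record simple_process := SimpleProcess {
  sp_size : nat;
  sp_time : nat -> R;
  sp_coef : nat -> Om -> R }.
Implicit Type H : simple_process.

Definition simple_adapted T X H : Prop :=
  [/\ forall i, (i <= sp_size H)%N -> 0 <= sp_time H i <= T,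
      forall i, (i < sp_size H)%N -> sp_time H i <= sp_time H i.+1,
      forall i, (i < sp_size H)%N ->
        measurable_wrt (natural_filtration X (sp_time H i)) (sp_coef H i) &
      forall i, (i < sp_size H)%N ->
        exists M : R, forall w, `|sp_coef H i w| <= M].

Definition simple_value H (s : R) (w : Om) : R :=
  \sum_(i < sp_size H)
    sp_coef H i w * \1_(`]sp_time H i, sp_time H i.+1] : set R) s.

Definition simple_integral X H (w : Om) : R :=
  \sum_(i < sp_size H)
    sp_coef H i w * (X (sp_time H i.+1) w - X (sp_time H i) w).

(* [I] is a version of the Ito integral of [h] against [X] over [[0, T]], for
   [X] with covariance [fun s t => \int_0^(min s t) sigma^2], hence with
   quadratic variation [sigma_s^2 ds]: the L^2(P)-limit of the integrals of
   simple processes tending to [h] in L^2(P (x) sigma_s^2 ds).  It is unique up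
   to a P-null set.                                                           *)
Definition is_ito_integral (P : probability Om R) T sigma X h (I : Om -> R)
    : Prop :=
  measurable_fun [set: Om] I /\
  exists H : nat -> simple_process,
  [/\ forall n, simple_adapted T X (H n),
      (fun n => \int[P]_w \int[lebesgue_measure]_(s in `[0%R, T])
          ((simple_value (H n) s w - h s w) ^+ 2 * sigma s ^+ 2)%:E)%E
        @ \oo --> 0%E &
      (fun n => \int[P]_w ((simple_integral X (H n) w - I w) ^+ 2)%:E)%E
        @ \oo --> 0%E].

End stochastic_integral.

Section estimation.
Context {R : realType} {d : measure_display} {Om : measurableType d}.
Variables (P : probability Om R) (T : R) (sigma : R -> R) (X : R -> Om -> R).
Implicit Types (u udot xi : R -> Om -> R) (Q : probability Om R).

Definition is_drift u udot : Prop :=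
  [/\ measurable_process T u, adapted T X u,
      square_integrable P lebesgue_measure T udot &
      {ae P, forall w, forall t, 0 <= t <= T ->
         u t w = \int[lebesgue_measure]_(s in `[0, t]) udot s w}].

Definition finite_energy udot : Prop :=
  (\int[P]_w \int[lebesgue_measure]_(s in `[0%R, T])
     (udot s w ^+ 2 / sigma s ^+ 2)%:E < +oo)%E.

(* [Lambda(u)], [I] being a version of the integral of [udot / sigma^2]
   against [X].                                                               *)
Definition girsanov_density udot (I : Om -> R) (w : Om) : R :=
  expR (I w - 2^-1 * \int[lebesgue_measure]_(s in `[0%R, T])
                       (udot s w ^+ 2 / sigma s ^+ 2)).

(* [Q] is the law [P_u], i.e. [dQ = Lambda(u) dP].  As [Q] is a probability,
   this includes that [Lambda(u)] has P-expectation 1.                        *)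
Definition translated udot Q : Prop :=
  exists2 I : Om -> R,
    is_ito_integral P T sigma X (fun s w => udot s w / sigma s ^+ 2) I &
    forall A : set Om, measurable A ->
      Q A = (\int[P]_(w in A) (girsanov_density udot I w)%:E)%E.

(* The identity of means is required whenever its right-hand side exists. *)
Definition unbiased xi : Prop :=
  forall v vdot Pv, is_drift v vdot -> finite_energy vdot ->
    translated vdot Pv ->
    forall t, 0 <= t <= T -> Pv.-integrable [set: Om] (EFin \o v t) ->
      Pv.-integrable [set: Om] (EFin \o xi t) /\
      ('E_Pv[xi t] = 'E_Pv[v t])%E.

Definition adapted_estimator u xi : Prop :=
  adapted T (fun t w => X t w - u t w) xi.

End estimation.

Section risk.
Context {R : realType} {d : measure_display} {Om : measurableType d}.
Variables (T : R) (mu : {finite_measure set (measurableTypeR R) -> \bar R}).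
Local Open Scope ereal_scope.

Definition quadratic_risk (Q : probability Om R) (xi u : R -> Om -> R)
    : \bar R :=
  \int[Q]_w \int[mu]_(t in `[0%R, T]) ((`|xi t w - u t w| ^+ 2)%R)%:E.

Definition cramer_rao_bound (sigma : R -> R) : \bar R :=
  \int[mu]_(t in `[0%R, T]) \int[lebesgue_measure]_(s in `[0%R, t])
    (sigma s ^+ 2)%:E.

End risk.

(* Main.v *)
Require Import Defs.
From HB Require Import structures.
From mathcomp Require Import all_boot all_order all_algebra.
From mathcomp Require Import all_classical all_reals all_analysis.
From mathcomp Require Import measurable_realfun.
From mathcomp Require Import ring lra.

Set Implicit Arguments.
Unset Strict Implicit.
Unset Printing Implicit Defensive.

Import Order.TTheory GRing.Theory Num.Theory.
Import numFieldNormedType.Exports.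

Local Open Scope classical_set_scope.
Local Open Scope ring_scope.

(** Write $M_t = X_t - u_t$ and let the clock be $\int_0^t \sigma_s^2 ds$.  Under
    the translated law the noise $M_t$ is a centered Gaussian variable whose
    variance is the clock at $t$, so that the observation itself is unbiased and
    its quadratic risk is the bound ([translated_noise],
    [observation_unbiased]).

    For the inequality, fix $t$ and perturb the drift $u$ by
    $\epsilon \int_0^\cdot h_s \sigma_s^2 ds$, where $h$ is deterministic and
    $0 \leq h \leq 1_{[0,t]}$.  The likelihood ratio $L_\epsilon$ between the two
    translated laws satisfies
    $E_u[L_\epsilon^2] = \exp(\epsilon^2 \int h^2 \sigma^2)$
    ([likelihood_ratio_second_moment]).  If $\xi$ is unbiased at both drifts, the
    mean of $\xi_t - u_t$ moves from $0$ to
    $\epsilon \int_0^t h \sigma^2$, and the Cauchy-Schwarz inequality applied to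
    $(\xi_t - u_t)(L_\epsilon - 1)$, which is the Chapman-Robbins inequality
    ([chapman_robbins_inequality]), gives
    $\epsilon^2 (\int_0^t h \sigma^2)^2 \leq
     E_u[(\xi_t - u_t)^2] (\exp(\epsilon^2 \int h^2 \sigma^2) - 1)$.
    Dividing by $\epsilon^2$ and letting $\epsilon$ tend to $0$ gives the
    Cramer-Rao inequality in the direction $h$
    ([directional_information_bound]).  Taking for $h$ the
    indicators of $\{s \leq t, \sigma_s \neq 0, |\sigma_s| \leq n\}$ and letting
    $n$ grow makes the clock appear ([information_bound]); integrating in $t$
    against $\mu$ ends the proof.

    Both halves rest on one fact about exponential densities: if the Girsanov
    density of a random integrand $a$ has expectation one, then so has that of
    $a + \lambda h$ for every bounded deterministic $h$ ([girsanov_shift]).  It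
    makes the perturbed laws probabilities, and, for $h = 1_{(0,t]}$, it computes
    all exponential moments of $M_t$, hence its mean and its variance
    ([mgf_mean], [mgf_second_moment]).  For
    simple processes the expectation is always one ([simple_exponential]),
    because $X$ has independent increments: zero covariances make characteristic
    functions factor ([increment_independent]), and each Gaussian increment can
    be integrated out given the past ([expR_increment_step]).  Fatou's lemma
    alone only gives expectation at most one in the limit; a convexity argument
    that compares the densities of $a$, $a + \lambda h$ and $a + 2 \lambda h$
    excludes the loss of mass ([exponential_tilt]). *)

(** * Change of measure by a density *)

Section density.
Context d (T : measurableType d) (R : realType).
Variables (mu nu : {measure set T -> \bar R}) (L : T -> R).
Hypothesis mL : measurable_fun [set: T] L.
Hypothesis L0 : forall x, 0 <= L x.
Hypothesis nuE : forall A, measurable A ->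
  nu A = (\int[mu]_(x in A) (L x)%:E)%E.

Import HBNNSimple.
Local Open Scope ereal_scope.

Let nnsfun_density (h : {nnsfun T >-> R}) :
  \int[nu]_x (h x)%:E = \int[mu]_x ((h x)%:E * (L x)%:E).
Proof.
under [LHS]eq_integral do rewrite fimfunE -fsumEFin//.
rewrite [LHS]ge0_integral_fsum//; last 2 first.
  - by move=> r; exact/measurable_EFinP/measurableT_comp.
  - by move=> n x _; rewrite EFinM nnfun_muleindic_ge0.
transitivity (\int[mu]_x
    (\sum_(r \in range h) ((r * \1_(h @^-1` [set r]) x)%:E * (L x)%:E))); last first.
  apply: eq_integral => x _; rewrite fimfunE -fsumEFin// ge0_mule_fsuml// => r.
  by rewrite EFinM nnfun_muleindic_ge0.
rewrite [RHS]ge0_integral_fsum//; last 2 first.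
  - move=> r; apply: emeasurable_funM; first exact/measurable_EFinP/measurableT_comp.
    exact/measurable_EFinP.
  - by move=> r x _; rewrite mule_ge0 ?lee_fin// -lee_fin EFinM nnfun_muleindic_ge0.
apply: eq_fsbigr => r; rewrite inE => -[x0 _ hr].
rewrite integralZl_indic_nnsfun// integral_indic// setIT.
have r0 : (0 <= r%:E) by rewrite -hr lee_fin.
under [RHS]eq_integral do rewrite EFinM -muleA.
rewrite ge0_integralZl//; last 2 first.
  - by apply: emeasurable_funM; exact/measurable_EFinP.
  - by move=> x _; rewrite mule_ge0 ?lee_fin.
congr (_ * _); rewrite nuE// integral_mkcond; apply: eq_integral => x _.
rewrite patchE indicE; case: ifPn => _; by rewrite ?mul1e ?mul0e.
Qed.

(** Both sides are monotone continuous in [f], so simple functions suffice. *)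
Lemma ge0_integral_density (f : T -> \bar R) :
  measurable_fun [set: T] f -> (forall x, 0 <= f x) ->
  \int[nu]_x f x = \int[mu]_x (f x * (L x)%:E).
Proof.
move=> mf f0.
pose h := nnsfun_approx measurableT mf.
transitivity (lim (\int[nu]_x (h n x)%:E @[n --> \oo])).
  rewrite -monotone_convergence//=.
  - apply: eq_integral => x _; apply/esym/cvg_lim => //=.
    exact: cvg_nnsfun_approx.
  - by move=> n; exact/measurable_EFinP/measurable_funTS.
  - by move=> n x _; rewrite lee_fin.
  - by move=> x _ m n mn; rewrite lee_fin; exact/lefP/nd_nnsfun_approx.
under eq_fun do rewrite nnsfun_density.
rewrite -monotone_convergence//=.
- apply: eq_integral => x _; apply/cvg_lim => //=.
  apply: cvgeZr => //; exact: cvg_nnsfun_approx.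
- move=> n; apply: emeasurable_funM; exact/measurable_EFinP/measurable_funTS.
- by move=> n x _; rewrite mule_ge0 ?lee_fin.
- move=> x _ m n mn; rewrite lee_wpmul2r ?lee_fin//.
  exact/lefP/nd_nnsfun_approx.
Qed.

Lemma integrable_density (f : T -> R) : measurable_fun [set: T] f ->
  nu.-integrable [set: T] (EFin \o f) <->
  mu.-integrable [set: T] (fun x => (f x * L x)%:E).
Proof.
move=> mf.
have E : \int[nu]_x `|(f x)%:E| = \int[mu]_x `|(f x * L x)%:E|.
  rewrite ge0_integral_density//; last first.
    by apply: measurableT_comp => //; exact/measurable_EFinP.
  by apply: eq_integral => x _; rewrite /= normrM EFinM (ger0_norm (L0 _)).
split=> /integrableP[_ H]; apply/integrableP; split.
- by apply/measurable_EFinP; exact: measurable_funM.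
- by rewrite -E.
- exact/measurable_EFinP.
- by rewrite /= E.
Qed.

Lemma integral_density (f : T -> R) : measurable_fun [set: T] f ->
  \int[nu]_x (f x)%:E = \int[mu]_x (f x * L x)%:E.
Proof.
move=> mf.
rewrite integralE [RHS]integralE; congr (_ - _).
  rewrite ge0_integral_density//; last first.
    by apply: measurable_funepos; exact/measurable_EFinP.
  apply: eq_integral => x _.
  by rewrite !funeposE /= EFinM maxe_pMl ?lee_fin// mul0e.
rewrite ge0_integral_density//; last first.
  by apply: measurable_funeneg; exact/measurable_EFinP.
apply: eq_integral => x _.
by rewrite !funenegE -!EFinN -mulNr EFinM maxe_pMl ?lee_fin// mul0e.
Qed.

End density.

(** * Integrable real functions *)

Section real_integrable.
Context d (T : measurableType d) (R : realType) (mu : {measure set T -> \bar R}).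
Implicit Types f g : T -> R.
Local Notation L1 f := (mu.-integrable [set: T] (EFin \o f)).

Lemma L1D f g : L1 f -> L1 g -> L1 (fun x => f x + g x).
Proof.
move=> If Ig; have := integrableD measurableT If Ig.
by apply: eq_integrable => // x _.
Qed.

Lemma L1B f g : L1 f -> L1 g -> L1 (fun x => f x - g x).
Proof.
move=> If Ig; have := integrableB measurableT If Ig.
by apply: eq_integrable => // x _.
Qed.

Lemma L1Z a f : L1 f -> L1 (fun x => a * f x).
Proof.
move=> If; have := integrableZl measurableT a If.
by apply: eq_integrable => // x _.
Qed.

Lemma L1_measurable f : L1 f -> measurable_fun [set: T] f.
Proof. by move=> /integrableP[/measurable_EFinP]. Qed.

Lemma L1_le f g : measurable_fun [set: T] f -> (forall x, `|f x| <= `|g x|) ->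
  L1 g -> L1 f.
Proof.
move=> mf fg; apply: le_integrable => //; first exact/measurable_EFinP.
by move=> x _ /=; rewrite lee_fin.
Qed.

Lemma ge0_L1 f : measurable_fun [set: T] f -> (forall x, 0 <= f x) ->
  (\int[mu]_x (f x)%:E < +oo)%E -> L1 f.
Proof.
move=> mf f0 lty; apply/integrableP; split; first exact/measurable_EFinP.
by under eq_integral do rewrite /= ger0_norm//.
Qed.

Lemma L1_EFin f : L1 f -> (\int[mu]_x (f x)%:E)%E = (\int[mu]_x f x)%:E.
Proof. by move=> If; rewrite fineK//; exact: integrable_fin_num. Qed.

Lemma Rintegral_EFin f r : (\int[mu]_x (f x)%:E)%E = r%:E -> \int[mu]_x f x = r.
Proof. by rewrite /Rintegral => ->. Qed.

Lemma RintD f g : L1 f -> L1 g ->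
  \int[mu]_x (f x + g x) = \int[mu]_x f x + \int[mu]_x g x.
Proof. exact: RintegralD. Qed.

Lemma RintB f g : L1 f -> L1 g ->
  \int[mu]_x (f x - g x) = \int[mu]_x f x - \int[mu]_x g x.
Proof. exact: RintegralB. Qed.

Lemma RintZ a f : L1 f -> \int[mu]_x (a * f x) = a * \int[mu]_x f x.
Proof. by move=> If; exact: RintegralZl. Qed.

Lemma le_Rint f g : L1 f -> L1 g -> (forall x, f x <= g x) ->
  \int[mu]_x f x <= \int[mu]_x g x.
Proof. by move=> If Ig fg; apply: le_Rintegral. Qed.

Lemma dominated_Rintegral (f_ : nat -> T -> R) f g :
  (forall n, measurable_fun [set: T] (f_ n)) -> measurable_fun [set: T] f ->
  L1 g -> (forall n x, `|f_ n x| <= g x) ->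
  (forall x, f_ n x @[n --> \oo] --> f x) ->
  L1 f /\ \int[mu]_x f_ n x @[n --> \oo] --> \int[mu]_x f x.
Proof.
move=> mf_ mf Ig le_g cvg_f.
have cvg_fE x : [set: T] x -> (f_ n x)%:E @[n --> \oo] --> (f x)%:E.
  by move=> _; apply/fine_cvgP; split; [exact: nearW|exact: cvg_f].
have [If _ Ic] := @dominated_convergence _ _ _ mu setT measurableT
  (fun n x => (f_ n x)%:E) (EFin \o f) (EFin \o g)
  (fun n => (measurable_EFinP _ _).2 (mf_ n)) ((measurable_EFinP _ _).2 mf)
  (aeW _ cvg_fE) Ig
  (aeW _ (fun x n _ => le_g n x)).
split => //; apply: fine_cvg; rewrite (L1_EFin If) in Ic; exact: Ic.
Qed.

End real_integrable.

Section finite_measure_integrable.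
Context d (T : measurableType d) (R : realType)
  (mu : {finite_measure set T -> \bar R}).
Implicit Types f g : T -> R.
Local Notation L1 f := (mu.-integrable [set: T] (EFin \o f)).

Lemma L1_cst a : L1 (fun=> a).
Proof. exact: finite_measure_integrable_cst. Qed.

Lemma L1_bounded f M : measurable_fun [set: T] f -> (forall x, `|f x| <= M) -> L1 f.
Proof.
move=> mf fM; apply: (@L1_le _ _ _ _ _ (fun=> M)) => //; last exact: L1_cst.
by move=> x; rewrite (le_trans (fM x))// ler_norm.
Qed.

Lemma L1_sqr f : measurable_fun [set: T] f -> L1 (fun x => f x ^+ 2) -> L1 f.
Proof.
move=> mf f2; apply: (@L1_le _ _ _ _ _ (fun x => 1 + f x ^+ 2)) => //.
  move=> x; rewrite [leRHS]ger0_norm ?addr_ge0 ?sqr_ge0// -(real_normK (num_real (f x))).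
  by have := sqr_ge0 (`|f x| - 1); have := normr_ge0 (f x); nra.
by apply: L1D => //; exact: L1_cst.
Qed.

End finite_measure_integrable.

Lemma Rint_cst d (T : measurableType d) (R : realType) (P : probability T R)
  (a : R) : \int[P]_x a = a.
Proof. by rewrite /Rintegral integral_cst// (_ : measure_function.Measure.sort _ _ = 1%E) ?mule1//; exact: probability_setT. Qed.

Section exponential_limits.
Variable R : realType.
Implicit Types (x y : R) (a : nat -> R).

(** A difference quotient of the exponential at 0. *)
Lemma cvg_mul_expRB1 a x : (forall n, 0 < a n) -> a n @[n --> \oo] --> +oo ->
  a n * (expR (x / a n) - 1) @[n --> \oo] --> x.
Proof.
move=> a0 ay.
have Va : (a n)^-1 @[n --> \oo] --> (0 : R).
  by apply/gtr0_cvgV0 => //; exact: nearW.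
apply: (@squeeze_cvgr _ _ _ _ (fun=> x) (fun n => x * (1 - x * (a n)^-1)^-1)).
- near=> n; have an0 := a0 n.
  have lt1 : x * (a n)^-1 < 1.
    rewrite ltr_pdivrMr// mul1r; near: n.
    exact: (cvgryPgt _).1.
  apply/andP; split.
    by rewrite -ler_pdivrMl// mulrC lerBrDl expR_ge1Dx.
  have e : expR (x / a n) <= (1 - x / a n)^-1.
    rewrite -[leLHS]invrK -expRN lef_pV2 ?posrE ?expR_gt0 ?subr_gt0//.
    exact: expR_ge1Dx.
  rewrite -ler_pdivlMl//; apply: le_trans (lerB e (lexx 1)) _.
  rewrite le_eqVlt; apply/orP; left; apply/eqP.
  have d0 : a n - x != 0.
    by rewrite subr_eq0 gt_eqF// -[ltRHS]mul1r -ltr_pdivrMr.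
  by field; rewrite d0 gt_eqF.
- exact: cvg_cst.
- rewrite -[X in _ --> X]mulr1; apply: cvgM; first exact: cvg_cst.
  rewrite -[X in _ --> X]invr1; apply: cvgV; first by rewrite oner_neq0.
  rewrite -[X in _ --> X]subr0; apply: cvgB; first exact: cvg_cst.
  by rewrite -[X in _ --> X](mulr0 x); apply: cvgM => //; exact: cvg_cst.
Unshelve. all: by end_near. Qed.

Lemma cvg_exprny (c : R) : 1 < c -> c ^+ n @[n --> \oo] --> +oo.
Proof.
move=> c1; have c0 : 0 < c by rewrite (lt_trans _ c1).
apply/gtr0_cvgV0; first by apply: nearW => n; rewrite exprn_gt0.
rewrite [X in X @ _ --> _](_ : _ = fun n => c^-1 ^+ n); last first.
  by apply/funext => n; rewrite exprVn.
apply: cvg_expr.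
by rewrite ger0_norm ?invr_ge0 ?ltW// invf_lt1.
Qed.

End exponential_limits.

(** * Moments from the moment generating function *)

Section moments_from_mgf.
Context d (T : measurableType d) (R : realType) (Q : probability T R).
Variables (Y : T -> R) (g : R).
Hypothesis mY : measurable_fun [set: T] Y.
Hypothesis mgfY : forall a,
  (\int[Q]_x (expR (a * Y x))%:E = (expR (a ^+ 2 * g / 2))%:E)%E.
Local Notation L1 f := (Q.-integrable [set: T] (EFin \o f)).

Let mexp a : measurable_fun [set: T] (fun x => expR (a * Y x)).
Proof. by apply: measurableT_comp => //; exact: measurable_funM. Qed.

Let L1_exp a : L1 (fun x => expR (a * Y x)).
Proof.
apply: ge0_L1 => //.
by rewrite mgfY ltry.
Qed.

(** The even function $k(x) = e^x + e^{-x} - 2$ has integrals known from the moment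
    generating function and behaves like $x^2$ at 0.  Since $4 k(x) \leq k(2x)$,
    the rescaled functions [q] decrease to $x^2$, so that dominated convergence,
    with [k] as dominating function, computes the second moment. *)
Let k (x : R) := expR x + expR (- x) - 2.

Let k_ge0 x : 0 <= k x.
Proof.
have -> : k x = (expR (x / 2) - expR (- (x / 2))) ^+ 2.
  rewrite /k; have -> : expR x = expR (x / 2) ^+ 2.
    by rewrite expr2 -expRD; congr expR; field.
  have -> : expR (- x) = expR (- (x / 2)) ^+ 2.
    by rewrite expr2 -expRD; congr expR; field.
  have : expR (x / 2) * expR (- (x / 2)) = 1 by rewrite -expRD subrr expR0.
  by nra.
exact: sqr_ge0.
Qed.

Let kD x : 4 * k x <= k (x * 2).
Proof.
suff -> : k (x * 2) = k x ^+ 2 + 4 * k x by rewrite lerDr sqr_ge0.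
rewrite /k; have -> : expR (x * 2) = expR x ^+ 2.
  by rewrite expr2 -expRD; congr expR; ring.
have -> : expR (- (x * 2)) = expR (- x) ^+ 2.
  by rewrite expr2 -expRD; congr expR; ring.
have : expR x * expR (- x) = 1 by rewrite -expRD subrr expR0.
by nra.
Qed.

Let pow4 n : (4 : R) ^+ n = (2 ^+ n) ^+ 2.
Proof. by rewrite -exprM mulnC exprM; congr (_ ^+ n); rewrite -natrX. Qed.

Let q n x : R := 4 ^+ n * k (x / 2 ^+ n).

Let q_ge0 n x : 0 <= q n x.
Proof. by rewrite mulr_ge0 ?exprn_ge0. Qed.

Let q_le n x : q n x <= k x.
Proof.
elim: n => [|n IH]; first by rewrite /q !expr0 divr1 mul1r.
apply: le_trans IH; rewrite /q [4 ^+ n.+1]exprSr -mulrA ler_wpM2l ?exprn_ge0//.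
by apply: le_trans (kD _) _; rewrite exprSr invfM mulrA mulfVK.
Qed.

Let normq_le n x : `|q n x| <= k x. Proof. by rewrite ger0_norm. Qed.

Let cvg_pow2 : (2 ^+ n : R) @[n --> \oo] --> +oo.
Proof. by apply: cvg_exprny; rewrite ltr1n. Qed.

Let pow2_gt0 n : 0 < (2 : R) ^+ n. Proof. by rewrite exprn_gt0. Qed.

Let q_cvg x : q n x @[n --> \oo] --> x ^+ 2.
Proof.
have qE n : q n x =
    (2 ^+ n * (expR (x / 2 ^+ n) - 1)) ^+ 2 * expR (- (x / 2 ^+ n)).
  rewrite /q /k pow4 exprMn -[RHS]mulrA; congr (_ * _).
  have : expR (x / 2 ^+ n) * expR (- (x / 2 ^+ n)) = 1 by rewrite -expRD subrr expR0.
  set A := expR _; set B := expR _ => AB1.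
  have -> : (A - 1) ^+ 2 * B = A * (A * B) - 2 * (A * B) + B by ring.
  by rewrite AB1; ring.
under eq_fun do rewrite qE expr2.
have -> : x ^+ 2 = x * x * expR 0 by rewrite expR0 mulr1.
apply: cvgM; first by apply: cvgM; exact: cvg_mul_expRB1.
apply: continuous_cvg; first exact: continuous_expR.
rewrite -oppr0; apply: cvgN; rewrite -[X in _ --> X](mulr0 x).
apply: cvgM; first exact: cvg_cst.
by apply/gtr0_cvgV0; [exact: nearW|exact: cvg_pow2].
Qed.

Let L1_k a : L1 (fun x => k (a * Y x)).
Proof.
apply: L1B; last exact: L1_cst.
apply: L1D; first exact: L1_exp.
by under eq_fun do rewrite -mulNr; exact: L1_exp.
Qed.

Let int_k a : \int[Q]_x k (a * Y x) = 2 * (expR (a ^+ 2 * g / 2) - 1).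
Proof.
have e a' : \int[Q]_x expR (a' * Y x) = expR (a' ^+ 2 * g / 2).
  exact: Rintegral_EFin.
have Ie : L1 (fun x => expR (- (a * Y x))).
  by under eq_fun do rewrite -mulNr; exact: L1_exp.
rewrite RintB; [|by apply: L1D|exact: L1_cst].
rewrite RintD//.
under [X in _ + X - _]eq_Rintegral do rewrite -mulNr.
rewrite !e Rint_cst.
by rewrite sqrrN; ring.
Qed.

Lemma mgf_second_moment :
  L1 (fun x => Y x ^+ 2) /\ \int[Q]_x Y x ^+ 2 = g.
Proof.
have mq n : measurable_fun [set: T] (fun x => q n (Y x)).
  apply: measurable_funM => //; apply: measurable_funB => //.
  apply: measurable_funD; apply: measurableT_comp => //; last first.
    by apply: measurableT_comp => //; exact: measurable_funM.
  exact: measurable_funM.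
have IkY : L1 (fun x => k (Y x)).
  by have := L1_k 1; under eq_fun do rewrite mul1r.
have [IY2 cvgY] := dominated_Rintegral mq (measurable_funX 2 mY) IkY
  (fun n x => normq_le n (Y x))
  (fun x => @q_cvg (Y x)).
split => //.
have intq n : \int[Q]_x q n (Y x) =
    4 ^+ n * (expR (g / 2 / 4 ^+ n) - 1) * 2.
  rewrite /q; have Ik : L1 (fun x => k (Y x / 2 ^+ n)).
    by under eq_fun do rewrite mulrC; exact: L1_k.
  rewrite RintZ//; under eq_Rintegral do rewrite mulrC.
  rewrite int_k; have -> : ((2 : R) ^- n) ^+ 2 * g / 2 = g / 2 / 4 ^+ n.
    by rewrite pow4; field; rewrite expf_neq0.
  by ring.
suff cvg_g : \int[Q]_x q n (Y x) @[n --> \oo] --> g by exact: (cvg_unique _ cvgY cvg_g).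
under eq_fun do rewrite intq.
rewrite (_ : nbhs g = nbhs (g / 2 * 2)); last by rewrite divfK.
apply: cvgM; last exact: cvg_cst.
apply: cvg_mul_expRB1 => [n|]; first by rewrite exprn_gt0.
by apply: cvg_exprny; rewrite ltr1n.
Qed.

(** The inequality $1 + aY \leq e^{aY}$ bounds $a E[Y]$ by
    $e^{a^2 g/2} - 1 = O(a^2)$ for both signs of $a$. *)
Lemma mgf_mean : L1 Y /\ \int[Q]_x Y x = 0.
Proof.
have IY : L1 Y by apply: L1_sqr => //; have [] := mgf_second_moment.
split => //; set m := \int[Q]_x Y x.
have le_m a : a * m <= expR (a ^+ 2 * g / 2) - 1.
  rewrite -RintZ// -(Rintegral_EFin (mgfY a)).
  have -> : \int[Q]_x expR (a * Y x) - 1 = \int[Q]_x (expR (a * Y x) - 1).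
    by rewrite RintB ?Rint_cst//; exact: L1_cst.
  apply: le_Rint; first exact: L1Z.
    by apply: L1B => //; exact: L1_cst.
  by move=> x; rewrite lerBrDl expR_ge1Dx.
pose c n : R := 2 ^- n * (4 ^+ n * (expR (g / 2 / 4 ^+ n) - 1)).
have c0 : c n @[n --> \oo] --> 0.
  rewrite -[X in _ --> X](mul0r (g / 2)); apply: cvgM.
    by apply/gtr0_cvgV0; [exact: nearW|exact: cvg_pow2].
  apply: cvg_mul_expRB1 => [n|]; first by rewrite exprn_gt0.
  by apply: cvg_exprny; rewrite ltr1n.
have le_c (b : bool) n : (-1) ^+ b * m <= c n.
  have := le_m ((-1) ^+ b * 2 ^- n); rewrite exprMn sqrr_sign mul1r.
  have -> : ((2 : R) ^- n) ^+ 2 * g / 2 = g / 2 / 4 ^+ n.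
    by rewrite pow4; field; rewrite expf_neq0.
  rewrite mulrAC -ler_pdivlMr ?invr_gt0// invrK => h.
  apply: le_trans h _; rewrite /c mulrA [2 ^- n * _]mulrC.
  by rewrite pow4 expr2 mulfK ?expf_neq0// mulrC.
have le0 (b : bool) : (-1) ^+ b * m <= 0.
  by apply: (cvgr_to_ge c0); apply: nearW => n; exact: le_c.
apply/eqP; rewrite eq_le; apply/andP; split.
  by have := le0 false; rewrite expr0 mul1r.
by have := le0 true; rewrite expr1 mulN1r oppr_le0.
Qed.

End moments_from_mgf.

(** * Exponential moments and characteristic function of a normal law *)

Section line_integral_of_derivative.
Variable R : realType.
Local Notation leb := (@lebesgue_measure R).

(** The fundamental theorem of calculus on $[-n, n]$, with $n$ tending to infinity. *)
Lemma Rintegral_derive_line (F f : R -> R) :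
  (forall x : R, is_derive x 1 F (f x)) -> continuous f ->
  leb.-integrable [set: R] (EFin \o f) ->
  F n%:R @[n --> \oo] --> 0 -> F (- n%:R) @[n --> \oo] --> 0 ->
  \int[leb]_x f x = 0.
Proof.
move=> dF cf If Fy FNy.
have mf : measurable_fun [set: R] f by exact: continuous_measurable_fun.
have ftc n : \int[leb]_x (f x * \1_(`[- n.+1%:R, n.+1%:R]) x) =
    F n.+1%:R - F (- n.+1%:R).
  apply: Rintegral_EFin; rewrite EFinB -(@continuous_FTC2 _ f F)//.
  - rewrite [RHS]integral_mkcond; apply: eq_integral => x _.
    by rewrite patchE indicE; case: ifPn => _; rewrite ?mulr1 ?mulr0.
  - by rewrite (lt_trans (y := 0))// oppr_lt0.
  - exact: continuous_subspaceT.
  - have cF : continuous F.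
      move=> x; apply: differentiable_continuous; apply/derivable1_diffP.
      by have [] := dF x.
    split => [x _||]; first by have [] := dF x.
      by apply: cvg_at_right_filter; exact: cF.
    by apply: cvg_at_left_filter; exact: cF.
  - by move=> x _; rewrite derive1E; have [] := dF x.
have [||||_ cvgf] := @dominated_Rintegral _ _ _ leb
  (fun n x => f x * \1_(`[- n.+1%:R, n.+1%:R]) x) f (fun x => `|f x|) _ mf.
- by move=> n; apply: measurable_funM => //; exact: measurable_indic.
- have := integrable_abse If; by apply: eq_integrable => // x _.
- move=> n x; rewrite normrM -[leRHS]mulr1 ler_wpM2l// indicE.
  by case: (_ \in _); rewrite ?normr1 ?normr0.
- move=> x; apply: cvg_near_cst; near=> n.
  rewrite indicE mem_set ?mulr1//= in_itv/= -ler_norml.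
  by rewrite (@le_trans _ _ n%:R) ?ler_nat//; near: n; exact: nbhs_infty_ger.
suff F0 : F n.+1%:R - F (- n.+1%:R) @[n --> \oo] --> 0.
  move: cvgf; under eq_fun do rewrite ftc.
  by move=> cvgf; exact: (cvg_unique _ cvgf F0).
have -> : (0 : R) = 0 - 0 by rewrite subr0.
apply: cvgB.
  by rewrite (cvg_shiftS (fun n => F n%:R)).
by rewrite (cvg_shiftS (fun n => F (- n%:R))).
Unshelve. all: by end_near. Qed.

End line_integral_of_derivative.

Section derivatives.
Variables (R : realType) (m s b c : R).
Lemma is_derive_center (x : R) : is_derive x 1 (fun y : R => y - m) 1.
Proof.
have := @is_deriveB R R^o R^o id (cst m) x 1 1 0 _ _.
rewrite subr0; apply.
Qed.
Lemma is_derive_affine (x : R) : is_derive x 1 (fun y : R => b * (y - m) + c) b.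
Proof.
have := @is_deriveD R R^o R^o (b \*: (fun y : R => y - m)) (cst c) x 1 (b *: 1) 0 (@is_deriveZ _ _ _ _ b x 1 _ (is_derive_center x)) _.
by rewrite addr0 [_ *: _]mulr1; apply.
Qed.
Lemma is_derive_sin_affine (x : R) : is_derive x 1 (fun y => sin (b * (y - m) + c))
    (b * cos (b * (x - m) + c)).
Proof.
rewrite mulrC; exact: (@is_derive1_comp _ (@sin R) _ x _ _ _ (is_derive_affine x)).
Qed.
Hypothesis s0 : s != 0.
Lemma is_derive_normal_pdf (x : R) : is_derive x 1 (normal_pdf m s)
    (- s ^- 2 * (x - m) * normal_pdf m s x).
Proof.
have e y : normal_pdf m s y = normal_peak s * expR (- (2 * s ^+ 2)^-1 * (y - m) ^+ 2).
  by rewrite normal_pdfE//= /normal_fun -[_ *+ 2]mulr_natl; congr (_ * expR _); field.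
rewrite e (_ : normal_pdf m s =
      normal_peak s \*: (expR \o (- (2 * s ^+ 2)^-1 \*: ((fun y : R => y - m) ^+ 2)))); last first.
    by apply/funext => y; rewrite e.
have d1 := @is_deriveX _ _ _ 2 x 1 _ (is_derive_center x).
have d2 := @is_deriveZ _ _ _ _ (- (2 * s ^+ 2)^-1) x 1 _ d1.
have d3 := is_derive1_comp (is_derive_expR _) d2.
have d4 := @is_deriveZ _ _ _ _ (normal_peak s) x 1 _ d3.
apply: (is_derive_eq d4).
rewrite /GRing.scale/=; set E := expR _; field.
  by [].
Qed.
End derivatives.

Lemma cvg_normal_pdf_pinfty (R : realType) (m s : R) : s != 0 ->
  normal_pdf m s x @[x --> +oo] --> 0.
Proof.
move=> s0; have -> : normal_pdf m s =
    fun x => normal_peak s * expR (- ((x - m) ^+ 2 * (2 * s ^+ 2)^-1)).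
  apply/funext => x; rewrite normal_pdfE//= /normal_fun -[_ *+ 2]mulr_natl.
  by rewrite mulNr.
rewrite -[X in _ --> X](mulr0 (normal_peak s)); apply: cvgM; first exact: cvg_cst.
apply: (cvg_comp (fun x => (x - m) ^+ 2 * (2 * s ^+ 2)^-1) (fun y => expR (- y))).
  apply: gt0_cvgMly; first by rewrite invr_gt0 mulr_gt0// exprn_even_gt0.
  apply: (cvg_comp (fun x => x - m) (fun y => y ^+ 2)); first exact: cvg_addrr.
  exact: cvgr_expr2.
exact: cvgr_expR.
Qed.

Section normal_transforms.
Variables (R : realType) (m s : R).
Hypothesis s0 : s != 0.
Local Notation leb := (@lebesgue_measure R).
Local Notation N := (@normal_prob R m s : probability _ R).
Local Notation L1 f := (N.-integrable [set: measurableTypeR R] (EFin \o f)).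

Lemma normal_pdf_exp m' x :
  normal_pdf m' s x = normal_peak s * expR (- (x - m') ^+ 2 / (2 * s ^+ 2)).
Proof. by rewrite normal_pdfE//= /normal_fun -[_ *+ 2]mulr_natl. Qed.

(** Completing the square: the exponential weight turns the density of mean [m] into
    that of mean $m + a s^2$. *)
Lemma normal_mgf a :
  (\int[N]_x (expR (a * (x - m)))%:E = (expR (a ^+ 2 * s ^+ 2 / 2))%:E)%E.
Proof.
have mpdf m' := @measurable_normal_pdf R m' s.
have mexp : measurable_fun [set: measurableTypeR R] (fun x : R => expR (a * (x - m))).
  apply: measurableT_comp => //; apply: measurable_funM => //.
  exact: measurable_funB.
rewrite (@ge0_integral_density _ _ _ leb N _ (mpdf m) (@normal_pdf_ge0 _ m s)
  (fun _ _ => erefl)); last 2 first.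
- exact/measurable_EFinP.
- by move=> x; rewrite lee_fin expR_ge0.
transitivity (\int[leb]_x
    ((expR (a ^+ 2 * s ^+ 2 / 2))%:E * (normal_pdf (m + a * s ^+ 2) s x)%:E))%E.
  apply: eq_integral => x _; rewrite -!EFinM; congr (_%:E).
  rewrite !normal_pdf_exp mulrCA [RHS]mulrCA; congr (_ * _); rewrite -!expRD.
  by congr expR; field.
rewrite ge0_integralZl//.
- by rewrite integral_normal_pdf mule1.
- by apply/measurable_EFinP; exact: mpdf.
- by move=> x _; rewrite lee_fin normal_pdf_ge0.
Qed.

Let mc : measurable_fun [set: measurableTypeR R] (fun x : R => x - m).
Proof. exact: measurable_funB. Qed.

Let L1_center : L1 (fun x : R => x - m).
Proof. by have [] := mgf_mean mc normal_mgf. Qed.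

(** Stein's integration by parts: the derivative of
    $\sin(b (x - m) + c)$ times the density integrates to 0. *)
Lemma normal_stein b c :
  \int[N]_x ((x - m) * sin (b * (x - m) + c)) =
  s ^+ 2 * b * \int[N]_x cos (b * (x - m) + c).
Proof.
have mpdf := @measurable_normal_pdf R m s.
have mlin : measurable_fun [set: measurableTypeR R] (fun x : R => b * (x - m) + c).
  by apply: measurable_funD => //; exact: measurable_funM.
have mcos : measurable_fun [set: measurableTypeR R] (fun x : R => cos (b * (x - m) + c)).
  apply: measurableT_comp mlin; apply: continuous_measurable_fun; exact: continuous_cos.
have msin : measurable_fun [set: measurableTypeR R] (fun x : R => sin (b * (x - m) + c)).
  apply: measurableT_comp mlin; apply: continuous_measurable_fun; exact: continuous_sin.
have Icos : L1 (fun x : R => cos (b * (x - m) + c)).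
  apply: (@L1_bounded _ _ _ _ _ 1) => // x; rewrite ler_norml cos_geN1 cos_le1//.
have Isin : L1 (fun x : R => (x - m) * sin (b * (x - m) + c)).
  apply: L1_le L1_center; first exact: measurable_funM.
  move=> x; rewrite normrM -[leRHS]mulr1 ler_wpM2l// ler_norml.
  by rewrite sin_geN1 sin_le1.
pose e (x : R) := b * cos (b * (x - m) + c) - s ^- 2 * ((x - m) * sin (b * (x - m) + c)).
have me : measurable_fun [set: measurableTypeR R] e.
  by apply: measurable_funB; apply: measurable_funM => //; exact: measurable_funM.
have Ie : L1 e by apply: L1B; exact: L1Z.
suff : \int[N]_x e x = 0.
  rewrite RintB; [|exact: L1Z|exact: L1Z]; rewrite !RintZ// => /subr0_eq h.
  by rewrite -mulrA h mulVKf// expf_neq0.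
have Iep := (@integrable_density _ _ _ leb N _ mpdf (@normal_pdf_ge0 _ m s)
  (fun _ _ => erefl) _ me).1 Ie.
rewrite /Rintegral (@integral_density _ _ _ leb N _ mpdf (@normal_pdf_ge0 _ m s)
  (fun _ _ => erefl) _ me).
pose h (x : R) := sin (b * (x - m) + c) * normal_pdf m s x.
have hE : h = (fun x => sin (b * (x - m) + c) * normal_pdf m s x) by [].
have dh (x : R) : is_derive x 1 h (e x * normal_pdf m s x).
  apply: (is_derive_eq (is_deriveM (is_derive_sin_affine m b c x) (is_derive_normal_pdf m s0 x))).
  by rewrite /e /GRing.scale /=; field.
have h_le x : `|h x| <= normal_pdf m s x.
  rewrite normrM (ger0_norm (normal_pdf_ge0 _ _ _)) ler_piMl ?normal_pdf_ge0//.
  by rewrite ler_norml sin_geN1 sin_le1.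
have ccen : continuous (fun x : R => x - m).
  by move=> x; apply: cvgB; [exact: cvg_id|exact: cvg_cst].
have clin : continuous (fun x : R => b * (x - m) + c).
  move=> x; apply: cvgD; last exact: cvg_cst.
  by apply: cvgM; [exact: cvg_cst|exact: ccen].
apply: (@Rintegral_derive_line _ h (fun x : R => e x * normal_pdf m s x)).
- move=> x; apply: cvgM; last exact: continuous_normal_pdf.
  apply: cvgB; apply: cvgM; [exact: cvg_cst| |exact: cvg_cst|].
    exact: (cvg_comp _ _ (clin x) (@continuous_cos R _)).
  apply: cvgM; first exact: ccen.
  exact: (cvg_comp _ _ (clin x) (@continuous_sin R _)).
- exact: Iep.
- apply: (@squeeze_cvgr _ _ _ _ (fun n => - normal_pdf m s n%:R)
    (fun n => normal_pdf m s n%:R)).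
  + by apply: nearW => n; rewrite -ler_norml.
  + have -> : (0 : R) = - 0 by rewrite oppr0.
    apply: cvgN.
    exact: cvg_comp cvgr_idn (cvg_normal_pdf_pinfty m s0).
  + exact: cvg_comp cvgr_idn (cvg_normal_pdf_pinfty m s0).
- have pdfN x : normal_pdf m s (- x) = normal_pdf (- m) s x.
    by rewrite !normal_pdf_exp; congr (_ * expR _); field.
  apply: (@squeeze_cvgr _ _ _ _ (fun n => - normal_pdf (- m) s n%:R)
    (fun n => normal_pdf (- m) s n%:R)).
  + by apply: nearW => n; rewrite -ler_norml -pdfN.
  + have -> : (0 : R) = - 0 by rewrite oppr0.
    apply: cvgN.
    exact: cvg_comp cvgr_idn (cvg_normal_pdf_pinfty (- m) s0).
  + exact: cvg_comp cvgr_idn (cvg_normal_pdf_pinfty (- m) s0).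
Qed.

(** As a function of $b$ the left-hand side satisfies $F' = - s^2 b F$, by
    differentiation under the integral and Stein's identity. *)
Lemma normal_charfun b c :
  \int[N]_x cos (b * (x - m) + c) = expR (- (b ^+ 2 * s ^+ 2 / 2)) * cos c.
Proof.
pose F b := \int[N]_x cos (b * (x - m) + c).
have mlin b' : measurable_fun [set: measurableTypeR R] (fun x : R => b' * (x - m) + c).
  by apply: measurable_funD => //; exact: measurable_funM.
have mcos b' : measurable_fun [set: measurableTypeR R] (fun x : R => cos (b' * (x - m) + c)).
  apply: measurableT_comp (mlin b'); apply: continuous_measurable_fun; exact: continuous_cos.
have Icos b' : L1 (fun x : R => cos (b' * (x - m) + c)).
  by apply: (@L1_bounded _ _ _ _ _ 1) => // x; rewrite ler_norml cos_geN1 cos_le1.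
have dcos (x a : R) : is_derive a 1 (fun a : R => cos (a * (x - m) + c))
    (- (x - m) * sin (a * (x - m) + c)).
  have d1 := @is_deriveD R R^o R^o ((x - m) \*: id) (cst c) a 1 _ 0
    (@is_deriveZ _ _ _ _ (x - m) a 1 _ (is_derive_id _ _)) (is_derive_cst _ _ _).
  have d2 := @is_derive1_comp _ (@cos R) _ a _ _ (is_derive_cos _) d1.
  rewrite (_ : (fun a => _) = @cos R \o ((x - m) \*: id + cst c)); last first.
    by apply/funext => y /=; rewrite mulrC.
  apply: (is_derive_eq d2).
  by rewrite /GRing.scale /= addr0 mulr1 mulrC (mulrC a) mulNr mulrN.
have dF (a : R) : is_derive a 1 F (- s ^+ 2 * a * F a).
  have Ia : `]a - 1, a + 1[%classic a by rewrite /= in_itv/= ltrBlDr ltrDl ltr01.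
  have p1 (x y : R) : partial1of2 (fun a x : R => cos (a * (x - m) + c)) x y =
      - (y - m) * sin (x * (y - m) + c).
    by rewrite partial1of2E; case: (dcos y x).
  have G_ub (x y : R) : `]a - 1, a + 1[%classic x -> setT y ->
      `|partial1of2 (fun a x : R => cos (a * (x - m) + c)) x y| <= `|y - m|.
    move=> _ _; rewrite p1 normrM normrN -[leRHS]mulr1 ler_wpM2l// ler_norml.
    by rewrite sin_geN1 sin_le1.
  have IG : L1 (fun x : R => `|x - m|).
    by have := integrable_abse L1_center; apply: eq_integrable => // x _.
  have dd (x y : R) : `]a - 1, a + 1[%classic x -> setT y ->
      derivable (fun a : R => cos (a * (y - m) + c)) x 1.
    by move=> _ _; case: (dcos y x).
  apply: DeriveDef.
    exact: (@derivable_under_integral _ _ _ N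
      (fun a x : R => cos (a * (x - m) + c)) setT measurableT a _ _ Ia
      (fun x _ => Icos x) dd _ (fun x => normr_ge0 _) IG G_ub).
  rewrite -derive1E (@differentiation_under_integral _ _ _ N
      (fun a x : R => cos (a * (x - m) + c)) setT measurableT a _ _ Ia
      (fun x _ => Icos x) dd _ (fun x => normr_ge0 _) IG G_ub).
  under eq_Rintegral do rewrite p1 mulNr -mulN1r.
  rewrite RintZ; first by rewrite normal_stein /F; ring.
  apply: L1_le L1_center.
    apply: measurable_funM => //; apply: measurableT_comp (mlin a).
    by apply: continuous_measurable_fun; exact: continuous_sin.
  move=> x; rewrite normrM -[leRHS]mulr1 ler_wpM2l// ler_norml.
  by rewrite sin_geN1 sin_le1.
pose E (a : R) := expR (s ^+ 2 / 2 * a ^+ 2).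
have dE (a : R) : is_derive a 1 E (s ^+ 2 * a * E a).
  have d1 := @is_deriveZ _ _ _ _ (s ^+ 2 / 2) a 1 _
    (@is_deriveX _ _ _ 2 a 1 _ (is_derive_id a 1)).
  have d2 := is_derive1_comp (is_derive_expR _) d1.
  apply: (is_derive_eq d2); 
  change (expR (s ^+ 2 / 2 * a ^+ 2) * (s ^+ 2 / 2 * (2 * a ^+ 1 * 1)) =
    s ^+ 2 * a * E a).
  by rewrite /E; field.
have dFE (a : R) : is_derive a 1 (F * E) 0.
  apply: (is_derive_eq (is_deriveM (dF a) (dE a))).
  by rewrite /GRing.scale /=; ring.
have : F b * E b = F 0 * E 0 by exact: is_derive_0_is_cst b 0 dFE.
have -> : F 0 = cos c.
  by rewrite /F; under eq_Rintegral do rewrite mul0r add0r; exact: Rint_cst.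
have -> : E 0 = 1 by rewrite /E expr0n mulr0 expR0.
rewrite mulr1 => <-; rewrite [RHS]mulrC -[RHS]mulrA -expRD.
by rewrite (_ : _ + _ = 0) ?expR0 ?mulr1//; field.
Qed.

End normal_transforms.

(** * Centered Gaussian variables *)

Section integral_by_law.
Context d1 d2 (T : measurableType d1) (U : measurableType d2) (R : realType).
Variables (mu : {measure set T -> \bar R}) (nu : {measure set U -> \bar R}).
Variables (Y : T -> U).
Hypothesis mY : measurable_fun [set: T] Y.
Hypothesis lawY : forall B, measurable B -> mu (Y @^-1` B) = nu B.
Local Open Scope ereal_scope.

Lemma ge0_integral_law (f : U -> \bar R) : measurable_fun [set: U] f ->
  (forall y, 0 <= f y) -> \int[mu]_x f (Y x) = \int[nu]_y f y.
Proof.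
move=> mf f0.
have := @ge0_integral_pushforward _ _ _ _ _ _ mY mu setT f measurableT mf
  (fun y _ => f0 y).
rewrite preimage_setT => <-; apply: eq_measure_integral => B mB _.
exact: lawY.
Qed.

Lemma integral_law (f : U -> \bar R) : measurable_fun [set: U] f ->
  \int[mu]_x f (Y x) = \int[nu]_y f y.
Proof.
move=> mf; rewrite [LHS]integralE [RHS]integralE; congr (_ - _).
  rewrite -ge0_integral_law//; last exact: measurable_funepos.
  by apply: eq_integral => x _; rewrite !funeposE.
rewrite -ge0_integral_law//; last exact: measurable_funeneg.
by apply: eq_integral => x _; rewrite !funenegE.
Qed.

End integral_by_law.

Section centered_gaussian.
Context {R : realType} {d : measure_display} {Om : measurableType d}.
Variables (P : probability Om R) (Y : Om -> R).
Hypotheses (gY : gaussian_rv P Y) (cY : ('E_P[Y] = 0)%E).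
Local Notation L1 f := (P.-integrable [set: Om] (EFin \o f)).

Let v := \int[P]_w Y w ^+ 2.

(** A degenerate Gaussian variable is almost surely constant, hence 0; otherwise the
    law is normal and its mean must be 0. *)
Lemma centered_gaussianP :
  [/\ L1 (fun w => Y w ^+ 2),
      forall a, (\int[P]_w (expR (a * Y w))%:E = (expR (a ^+ 2 * v / 2))%:E)%E &
      forall c, \int[P]_w cos (Y w + c) = expR (- (v / 2)) * cos c].
Proof.
case: gY => mY [m [s lawY]].
pose D : {measure set (measurableTypeR R) -> \bar R} :=
  if s == 0 then (@dirac _ (measurableTypeR R) m R : {measure set (measurableTypeR R) -> \bar R})
  else (@normal_prob R m s : {measure set (measurableTypeR R) -> \bar R}).
have lawD (B : set (measurableTypeR R)) : measurable B -> P (Y @^-1` B) = D B.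
  by move=> mB; rewrite lawY// /D; case: ifP.
have ElawD := @integral_law _ _ Om (measurableTypeR R) R P D Y mY lawD.
have mexp a : measurable_fun [set: measurableTypeR R] (fun x : R => expR (a * (x - m))).
  apply: measurableT_comp => //; apply: measurable_funM => //.
  exact: measurable_funB.
have mcos c : measurable_fun [set: measurableTypeR R] (fun x : R => cos (x - m + c)).
  apply: (measurableT_comp (f := @cos R)).
    by apply: continuous_measurable_fun; exact: continuous_cos.
  by apply: measurable_funD => //; exact: measurable_funB.
have mgfD a : (\int[D]_x (expR (a * (x - m)))%:E = (expR (a ^+ 2 * s ^+ 2 / 2))%:E)%E.
  rewrite /D; case: ifPn => [/eqP s0|s0]; last exact: normal_mgf.
  rewrite integral_dirac//; last exact/measurable_EFinP.
  by rewrite diracT mul1e s0 subrr expr0n /= !mulr0 mul0r.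
have cosD c : \int[D]_x cos (x - m + c) = expR (- (s ^+ 2 / 2)) * cos c.
  rewrite /D; case: ifPn => [/eqP s0|s0].
    rewrite /Rintegral integral_dirac//; last exact/measurable_EFinP.
    by rewrite diracT mul1e s0 subrr expr0n /= mul0r oppr0 expR0 mul1r add0r.
  have := normal_charfun m s0 1 c; under eq_Rintegral do rewrite mul1r.
  by rewrite expr1n mul1r.
have mgfP a : (\int[P]_w (expR (a * (Y w - m)))%:E = (expR (a ^+ 2 * s ^+ 2 / 2))%:E)%E.
  by rewrite -mgfD -ElawD//; exact/measurable_EFinP.
have mYm : measurable_fun [set: Om] (fun w => Y w - m) by exact: measurable_funB.
have m0 : m = 0.
  have [IYm] := mgf_mean mYm mgfP.
  have IY : L1 Y.
    have := L1D IYm (L1_cst P m); by under eq_fun do rewrite subrK.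
  rewrite RintB//; last exact: L1_cst.
  rewrite Rint_cst; move: cY; rewrite unlock => /Rintegral_EFin ->.
  by rewrite sub0r => /eqP; rewrite oppr_eq0 => /eqP.
rewrite {}m0 in mgfD cosD mgfP mYm mexp mcos *.
have mgfY a : (\int[P]_w (expR (a * Y w))%:E = (expR (a ^+ 2 * s ^+ 2 / 2))%:E)%E.
  by rewrite -mgfP; apply: eq_integral => w _; rewrite subr0.
have [IY2 EY2] := mgf_second_moment mY mgfY.
rewrite /v EY2; split => // c.
rewrite -cosD /Rintegral -ElawD; last exact/measurable_EFinP.
by congr fine; apply: eq_integral => w _; rewrite subr0.
Qed.

End centered_gaussian.

(** * Uniqueness for weighted characteristic functions *)

Section weighted_dynkin.
Context d1 d2 (T : measurableType d1) (U : measurableType d2) (R : realType).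
Variables (mu : {measure set T -> \bar R}) (W : T -> R) (Y : T -> U).
Hypotheses (iW : mu.-integrable [set: T] (EFin \o W))
  (mY : measurable_fun [set: T] Y).
Local Open Scope ereal_scope.

Let mpre B : measurable B -> measurable (Y @^-1` B).
Proof. by move=> mB; rewrite -[X in measurable X]setTI; exact: mY. Qed.

Let iWA A : measurable A -> mu.-integrable A (EFin \o W).
Proof. by move=> mA; apply: integrableS iW. Qed.

(** The sets on which the signed measure with density [W] vanishes form a Dynkin
    system. *)
Lemma weighted_dynkin (G : set (set U)) :
  setI_closed G -> G `<=` measurable ->
  (\int[mu]_x (W x)%:E = 0) ->
  (forall B, G B -> \int[mu]_(x in Y @^-1` B) (W x)%:E = 0) ->
  forall B, <<s G >> B -> \int[mu]_(x in Y @^-1` B) (W x)%:E = 0.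
Proof.
move=> GI Gm W0 GW B; rewrite -setI_closed_g_dynkin_g_sigma_algebra// => dB.
suff [] : [set B | measurable B /\ \int[mu]_(x in Y @^-1` B) (W x)%:E = 0] B by [].
move: B dB; apply: smallest_sub; last by move=> B GB; split; [exact: Gm|exact: GW].
split => [|B [mB WB]|F tF FH] /=.
- by split => //; rewrite preimage_setT.
- split; first exact: measurableC.
  have := @integral_setU _ _ _ mu (Y @^-1` B) (Y @^-1` (~` B)) (EFin \o W).
  rewrite preimage_setC setUv WB add0e W0 => <- //.
  + exact: mpre.
  + by apply: measurableC; exact: mpre.
  + by have /integrableP[] := iW.
  + by apply/disj_setPS; rewrite setICr.
- split; first by apply: bigcup_measurable => k _; have [] := FH k.
  rewrite preimage_bigcup integral_bigcup//.
  + by rewrite eseries0// => i _ _; have [] := FH i.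
  + move=> i j _ _ [x [Fi Fj]]; apply: tF => //; by exists (Y x).
  + by move=> i; apply: mpre; have [] := FH i.
  + by apply: iWA; apply: bigcup_measurable => k _; apply: mpre; have [] := FH k.
Qed.

End weighted_dynkin.

Section bounded_fubini.
Context d1 d2 (T1 : measurableType d1) (T2 : measurableType d2) (R : realType).
Variables (P1 : probability T1 R) (P2 : probability T2 R) (f : T1 * T2 -> R) (M : R).
Hypotheses (mf : measurable_fun [set: T1 * T2] f) (fM : forall z, `|f z| <= M).

Lemma bounded_Fubini :
  \int[P1]_x \int[P2]_y f (x, y) = \int[P2]_y \int[P1]_x f (x, y).
Proof.
have If : (P1 \x P2)%E.-integrable [set: T1 * T2] (EFin \o f).
  have E : (P1 \x P2)%E [set: T1 * T2] = 1%E.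
    rewrite -setXTT product_measure1E// -[RHS]mule1; congr (_ * _)%E.
      exact: probability_setT.
    exact: probability_setT.
  apply: measurable_bounded_integrable => //; first by rewrite [X in (X < _)%E]E ltry.
  by exists M; split; [exact: num_real|move=> r Mr z _; exact: le_trans (fM z) (ltW Mr)].
have := Fubini If; rewrite /fubini_F /fubini_G => e.
have I2 x : P2.-integrable [set: T2] (EFin \o (fun y => f (x, y))).
  by apply: (@L1_bounded _ _ _ _ _ M) => //; exact: measurableT_comp mf _.
have I1 y : P1.-integrable [set: T1] (EFin \o (fun x => f (x, y))).
  by apply: (@L1_bounded _ _ _ _ _ M) => //; exact: measurableT_comp mf _.
rewrite /Rintegral; congr fine.
under eq_integral do rewrite -[X in X%:E]/(\int[P2]_y f (_, y)) -L1_EFin//.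
by under [RHS]eq_integral do rewrite -[X in X%:E]/(\int[P1]_x f (x, _)) -L1_EFin//.
Qed.

End bounded_fubini.

Section normal_concentration.
Variables (R : realType) (y s : R).
Hypothesis s0 : s != 0.
Local Notation N := (@normal_prob R y s : probability _ R).

Lemma fin_num_normal_prob B : measurable B -> N B = (fine (N B))%:E.
Proof. by move=> mB; rewrite fineK//; exact: fin_num_measure. Qed.

Lemma normal_prob_chebyshev (B : set (measurableTypeR R)) del :
  measurable B -> 0 < del -> (forall x, B x -> del <= `|x - y|) ->
  fine (N B) <= s ^+ 2 / del ^+ 2.
Proof.
move=> mB d0 far.
have mc : measurable_fun [set: measurableTypeR R] (fun x : R => x - y).
  exact: measurable_funB.
have [I2 E2] := mgf_second_moment mc (normal_mgf y s0).
have IB : N.-integrable setT (EFin \o (\1_B : R -> R)).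
  apply: (@L1_bounded _ _ _ N _ 1); first exact: measurable_indic.
  by move=> x; rewrite indicE; case: (_ \in _); rewrite ?normr1 ?normr0.
have -> : fine (N B) = \int[N]_x (\1_B x).
  by rewrite /Rintegral integral_indic// setIT.
rewrite mulrC -E2 -RintZ//; apply: le_Rint => //; first exact: L1Z.
move=> x; rewrite indicE; case: (boolP (x \in B)) => [|_]; last first.
  by rewrite mulr_ge0 ?invr_ge0 ?sqr_ge0.
rewrite inE => /far h; rewrite mulrC ler_pdivlMr ?exprn_gt0// mul1r.
by rewrite -(real_normK (num_real (x - y))) lerXn2r// nnegrE ltW.
Qed.

End normal_concentration.

Lemma normal_pdfC (R : realType) (x y s : R) : s != 0 ->
  normal_pdf x s y = normal_pdf y s x.
Proof.
by move=> s0; rewrite !normal_pdf_exp//; congr (_ * expR _); field.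
Qed.

Section normal_limit.
Variables (R : realType) (y c : R).

(** The endpoint is moved by $1/n$, much more than the standard deviation $1/n^2$, so
    that the mass of the open ray tends to 0 also when [y] is the endpoint [c]. *)
Lemma normal_prob_ray_cvg :
  fine (normal_prob y (n.+1%:R^-1 ^+ 2) `]-oo, (c - n.+1%:R^-1)[) @[n --> \oo]
  --> (\1_(`]-oo, c[) y : R).
Proof.
pose a n : R := n.+1%:R^-1.
have a0 n : 0 < a n by rewrite invr_gt0.
have a1 n : a n <= 1 by rewrite invf_le1// ler1n.
have acvg : a n @[n --> \oo] --> 0 by exact: cvg_harmonic.
have s0 n : a n ^+ 2 != 0 by rewrite expf_neq0// gt_eqF.
have [yc|cy] := ltP y c.
  rewrite indicE mem_set; last by rewrite /= in_itv/=.
  pose del := (c - y) / 2; have d0 : 0 < del by rewrite divr_gt0 ?subr_gt0.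
  have far n x : a n < del -> (~` `]-oo, (c - a n)[%classic) x -> del <= `|x - y|.
    move=> an; rewrite /= in_itv/= => /negP; rewrite -leNgt => h.
    rewrite ger0_norm; first by rewrite /del in an *; lra.
    by rewrite /del in an *; lra.
  have le1 n : fine (normal_prob y (a n ^+ 2) `]-oo, (c - a n)[) <= 1.
    by rewrite -lee_fin -fin_num_normal_prob//; exact: probability_le1.
  apply: (@squeeze_cvgr _ _ _ _ (fun n => 1 - a n / del ^+ 2) (fun=> 1)).
  - near=> n; rewrite le1 andbT lerBlDr -lerBlDl.
    have -> : 1 - fine (normal_prob y (a n ^+ 2) `]-oo, (c - a n)[) =
        fine (normal_prob y (a n ^+ 2) (~` `]-oo, (c - a n)[%classic)).
      rewrite [in RHS]probability_setC// [in RHS]fin_num_normal_prob//.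
    apply: le_trans (@normal_prob_chebyshev _ _ _ (s0 n) _ _ _ d0 (fun x => far n x _)) _ => //.
    + exact: measurableC.
    + near: n; move/cvgr0_norm_lt: acvg => /(_ _ d0).
      by apply: filterS => n; rewrite gtr0_norm.
    + rewrite ler_pM2r ?invr_gt0 ?exprn_gt0// -exprM.
      by rewrite -[leRHS]expr1 ler_wiXn2l// ltW.
  - suff : 1 - a n / del ^+ 2 @[n --> \oo] --> 1 - 0 / del ^+ 2.
      by rewrite mul0r subr0.
    apply: cvgB; first exact: cvg_cst.
    by apply: cvgM; [exact: acvg|exact: cvg_cst].
  - exact: cvg_cst.
rewrite indicE memNset; last by rewrite /= in_itv/= ltNge cy.
apply: (@squeeze_cvgr _ _ _ _ (fun=> 0) a) => //; last exact: cvg_cst.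
near=> n; rewrite fine_ge0//=.
apply: le_trans (@normal_prob_chebyshev _ _ _ (s0 n) _ (a n) _ _ _) _ => //.
- move=> x; rewrite /= in_itv/= => h.
  by rewrite -/(a n) in h; have := a0 n => an; rewrite ler0_norm; lra.
- rewrite -exprM (_ : (2 * 2 = 2 + 2)%N)// exprD mulfK//.
  by rewrite -[leRHS]expr1 ler_wiXn2l// ltW.
Unshelve. all: by end_near. Qed.

End normal_limit.

Section weighted_charfun.
Context d (Om : measurableType d) (R : realType) (P : probability Om R).
Variables (W Y : Om -> R) (M : R).
Hypotheses (mW : measurable_fun [set: Om] W) (WM : forall w, `|W w| <= M)
  (mY : measurable_fun [set: Om] Y).
Hypothesis WY0 : forall b c, \int[P]_w (W w * cos (b * Y w + c)) = 0.
Local Notation leb := (@lebesgue_measure R).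
Local Notation N01 := (@normal_prob R 0 1 : probability _ R).

Let mcos : measurable_fun [set: R] (@cos R).
Proof. by apply: continuous_measurable_fun; exact: continuous_cos. Qed.

Let M0 : 0 <= M.
Proof. by apply: le_trans (normr_ge0 _) (WM point). Qed.

(** A normal density is, up to a constant, the average of $\cos(z (x - Y)/s)$ over a
    standard normal $z$. *)
Let pdf0 s x : s != 0 -> \int[P]_w (W w * normal_pdf (Y w) s x) = 0.
Proof.
move=> s0.
pose f (z : Om * measurableTypeR R) : R := W z.1 * cos (((x - Y z.1) / s) * z.2).
have mf : measurable_fun [set: Om * measurableTypeR R] f.
  apply: measurable_funM; first exact: measurableT_comp.
  apply: measurableT_comp => //; apply: measurable_funM => //.
  apply: measurable_funM => //; apply: measurable_funB => //.
  exact: measurableT_comp.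
have fM z : `|f z| <= M.
  rewrite normrM -[leRHS]mulr1 ler_pM// ler_norml.
  by rewrite cos_geN1 cos_le1.
have := @bounded_Fubini _ _ Om (measurableTypeR R) _ P N01 f M mf fM.
rewrite [X in _ = X -> _](_ : _ = 0); last first.
  transitivity (\int[N01]_z (0 : R)); last exact: Rint_cst.
  apply: eq_Rintegral => z _; rewrite -(WY0 (- (z / s)) (x * z / s)).
  by apply: eq_Rintegral => w _; rewrite /f/=; congr (_ * cos _); field.
have step w : \int[N01]_z f (w, z) = W w * (normal_peak s)^-1 * normal_pdf (Y w) s x.
  rewrite /f /= RintZ; last first.
    apply: (@L1_bounded _ _ _ _ _ 1) => [|z]; last by rewrite ler_norml cos_geN1 cos_le1.
    by apply: measurableT_comp => //; exact: measurable_funM.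
  have := normal_charfun (0 : R) (oner_neq0 R) ((x - Y w) / s) 0.
  under eq_Rintegral do rewrite subr0 addr0.
  move=> ->; rewrite cos0 mulr1 normal_pdf_exp//.
  rewrite -[RHS]mulrA mulKf ?gt_eqF ?normal_peak_gt0//; congr (_ * expR _).
  by field.
under eq_Rintegral do rewrite step.
move=> /(congr1 (fun t => normal_peak s * t)); rewrite mulr0 -RintZ.
  move=> <-; apply: eq_Rintegral => w _.
  by rewrite [RHS]mulrCA !mulrA mulfVK// gt_eqF// normal_peak_gt0.
under eq_fun do rewrite -mulrA normal_pdfC//.
apply: (@L1_bounded _ _ _ _ _ M).
  apply: measurable_funM => //; apply: measurable_funM => //.
  by apply: measurableT_comp => //; exact: measurable_normal_pdf.
move=> w; rewrite normrM -[leRHS]mulr1 ler_pM// ger0_norm; last first.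
  by rewrite mulr_ge0 ?normal_pdf_ge0// invr_ge0 normal_peak_ge0.
by rewrite ler_pdivrMl ?normal_peak_gt0// mulr1 normal_pdf_ub.
Qed.

Let mpdf s x : s != 0 -> measurable_fun [set: Om] (fun w => normal_pdf (Y w) s x).
Proof.
move=> s0; under eq_fun do rewrite normal_pdfC//.
by apply: measurableT_comp => //; exact: measurable_normal_pdf.
Qed.

Let mpdf2 s : s != 0 -> measurable_fun [set: Om * measurableTypeR R]
  (fun z => normal_pdf (Y z.1) s z.2).
Proof.
move=> s0; under eq_fun do rewrite normal_pdf_exp//.
apply: measurable_funM => //; apply: measurableT_comp => //.
apply: measurable_funM => //; apply: measurableT_comp => //.
apply: measurable_funX; apply: measurable_funB => //; exact: measurableT_comp.
Qed.

Let tonelli s c (V : Om -> R) : s != 0 -> measurable_fun [set: Om] V ->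
  (forall w, 0 <= V w) ->
  (\int[P]_w (V w * fine (normal_prob (Y w) s `]-oo, c[))%:E =
   \int[leb]_x \int[P]_w (V w * normal_pdf (Y w) s x * \1_(`]-oo, c[) x)%:E)%E.
Proof.
move=> s0 mV V0.
pose g (z : Om * measurableTypeR R) : \bar R :=
  (V z.1 * normal_pdf (Y z.1) s z.2 * \1_(`]-oo, c[) z.2)%:E.
have mg : measurable_fun [set: Om * measurableTypeR R] g.
  apply/measurable_EFinP; apply: measurable_funM.
    by apply: measurable_funM; [exact: measurableT_comp|exact: mpdf2].
  by apply: measurableT_comp => //; exact: measurable_indic.
have g0 z : (0 <= g z)%E by rewrite lee_fin !mulr_ge0// normal_pdf_ge0.
rewrite -(@fubini_tonelli _ _ _ _ _ P leb g mg g0).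
apply: eq_integral => w _; rewrite /g /=.
under [RHS]eq_integral do rewrite -mulrA EFinM.
rewrite ge0_integralZl//=; last 3 first.
- apply/measurable_EFinP; apply: measurable_funM; last exact: measurable_indic.
  exact: measurable_normal_pdf.
- by move=> x _; rewrite lee_fin mulr_ge0// normal_pdf_ge0.
- by rewrite lee_fin.
rewrite EFinM; congr (_ * _)%E.
rewrite -(fin_num_normal_prob (Y w) s)// /normal_prob [LHS]integral_mkcond.
apply: eq_integral => x _; rewrite patchE indicE.
by case: ifPn => _; rewrite ?mulr1 ?mulr0.
Qed.

Let mN s c : s != 0 ->
  measurable_fun [set: Om] (fun w => fine (normal_prob (Y w) s `]-oo, c[)).
Proof.
move=> s0; apply/measurable_EFinP.
rewrite (_ : _ \o _ = fun w => \int[leb]_x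
    (normal_pdf (Y w) s x * \1_(`]-oo, c[) x)%:E)%E; last first.
  apply/funext => w /=; rewrite -(fin_num_normal_prob (Y w) s)// /normal_prob.
  rewrite [LHS]integral_mkcond; apply: eq_integral => x _; rewrite patchE indicE.
  by case: ifPn => _; rewrite ?mulr1 ?mulr0.
apply: (@measurable_fun_fubini_tonelli_F _ _ _ _ _ leb
  (fun z : Om * measurableTypeR R => (normal_pdf (Y z.1) s z.2 * \1_(`]-oo, c[) z.2)%:E)).
  apply/measurable_EFinP; apply: measurable_funM; first exact: mpdf2.
  by apply: measurableT_comp => //; exact: measurable_indic.
by move=> z; rewrite lee_fin mulr_ge0// normal_pdf_ge0.
Qed.

Let N01P s c w : 0 <= fine (normal_prob (Y w) s `]-oo, c[) <= 1.
Proof.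
rewrite fine_ge0//= -lee_fin -(fin_num_normal_prob (Y w) s)//.
exact: probability_le1.
Qed.

Let ray0 s c : s != 0 ->
  \int[P]_w (W w * fine (normal_prob (Y w) s `]-oo, c[)) = 0.
Proof.
move=> s0; set N := fun w => fine (normal_prob (Y w) s `]-oo, c[).
have IWN : P.-integrable [set: Om] (EFin \o (fun w => W w * N w)).
  apply: (@L1_bounded _ _ _ _ _ M); first by apply: measurable_funM => //; exact: mN.
  move=> w; have /andP[N0 N1] := N01P s c w.
  by rewrite normrM -[leRHS]mulr1 ler_pM// ger0_norm.
have IMN : P.-integrable [set: Om] (EFin \o (fun w => M * N w)).
  apply: L1Z; apply: (@L1_bounded _ _ _ _ _ 1); first exact: mN.
  by move=> w; have /andP[N0 N1] := N01P s c w; rewrite ger0_norm.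
have WM0 w : 0 <= W w + M.
  by have := WM w; rewrite ler_norml => /andP[h _]; rewrite -lerBlDr sub0r.
have mWM : measurable_fun [set: Om] (fun w => W w + M) by exact: measurable_funD.
have : (\int[P]_w ((W w + M) * N w)%:E = \int[P]_w (M * N w)%:E)%E.
  rewrite tonelli// tonelli//; apply: eq_integral => x _.
  have Ip : P.-integrable [set: Om] (EFin \o (fun w => normal_pdf (Y w) s x)).
    apply: (@L1_bounded _ _ _ _ _ (normal_peak s)); first exact: mpdf.
    by move=> w; rewrite ger0_norm ?normal_pdf_ge0// normal_pdf_ub.
  have IWp : P.-integrable [set: Om] (EFin \o (fun w => W w * normal_pdf (Y w) s x)).
    apply: (@L1_bounded _ _ _ _ _ (M * normal_peak s)).
      by apply: measurable_funM => //; exact: mpdf.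
    move=> w; rewrite normrM ler_pM//.
    by rewrite ger0_norm ?normal_pdf_ge0// normal_pdf_ub.
  set i := \1_(`]-oo, c[) x.
  have I1 : P.-integrable [set: Om] (EFin \o (fun w => i * (M * normal_pdf (Y w) s x))).
    by do 2 apply: L1Z.
  have I2 : P.-integrable [set: Om] (EFin \o (fun w => i * (W w * normal_pdf (Y w) s x))).
    exact: L1Z.
  transitivity (\int[P]_w (i * (W w * normal_pdf (Y w) s x) + i * (M * normal_pdf (Y w) s x))%:E)%E.
    by apply: eq_integral => w _; congr EFin; ring.
  transitivity (\int[P]_w (i * (M * normal_pdf (Y w) s x))%:E)%E; last first.
    by apply: eq_integral => w _; congr EFin; ring.
  rewrite (L1_EFin (L1D I2 I1)) RintD// [X in X + _]RintZ// pdf0// mulr0 add0r.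
  by rewrite L1_EFin.
under eq_integral do rewrite mulrDl.
rewrite (L1_EFin (L1D IWN IMN)) RintD// (L1_EFin IMN) => -[].
by move=> /eqP; rewrite -subr_eq0 addrK => /eqP.
Qed.

(** Gaussian smoothing: the hypothesis passes to normal densities centered at [Y]
    ([pdf0]), then to normal probabilities of rays ([ray0]), then, as the variance
    tends to 0, to indicators of rays, which generate the Borel sets. *)
Lemma weighted_charfun_eq0 (B : set R) : measurable B ->
  (\int[P]_(w in Y @^-1` B) (W w)%:E = 0)%E.
Proof.
have IW : P.-integrable [set: Om] (EFin \o W) by exact: L1_bounded WM.
move=> mB; apply: (@weighted_dynkin _ _ Om (measurableTypeR R) _ P W Y IW mY
  (@RGenInftyO.G R)).
- move=> _ _ [a ->] [b ->]; exists (Num.min a b).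
  apply/seteqP; split => x; rewrite /= !in_itv/= lt_min; first by case=> -> ->.
  by move=> /andP[].
- by move=> _ [c ->]; exact: measurable_itv.
- rewrite L1_EFin//; congr EFin; rewrite -[RHS](WY0 0 0).
  by apply: eq_Rintegral => w _; rewrite mul0r add0r cos0 mulr1.
- move=> _ [c ->].
  have mI : measurable_fun [set: Om] (fun w => \1_(`]-oo, c[) (Y w) : R).
    by apply: measurableT_comp => //; exact: measurable_indic.
  pose f n w := W w * fine (normal_prob (Y w) (n.+1%:R^-1 ^+ 2) `]-oo, (c - n.+1%:R^-1)[).
  have nz n : (n.+1%:R^-1 : R) ^+ 2 != 0 by rewrite expf_neq0// invr_eq0.
  have [|||||IW1 cvgf] := @dominated_Rintegral _ _ _ P f
    (fun w => W w * \1_(`]-oo, c[) (Y w)) (fun=> M).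
  + by move=> n; apply: measurable_funM => //; exact: mN.
  + exact: measurable_funM.
  + exact: L1_cst.
  + move=> n w; have /andP[N0 N1] := N01P (n.+1%:R^-1 ^+ 2) (c - n.+1%:R^-1) w.
    by rewrite normrM -[leRHS]mulr1 ler_pM// ger0_norm.
  + by move=> w; apply: cvgM; [exact: cvg_cst|exact: normal_prob_ray_cvg].
  transitivity (\int[P]_w (W w * \1_(`]-oo, c[) (Y w))%:E)%E.
    rewrite integral_mkcond; apply: eq_integral => w _; rewrite patchE indicE.
    rewrite (_ : (w \in _) = (Y w \in `]-oo, c[%classic)); last by apply/idP/idP => /[!inE].
    by case: ifPn => _; rewrite ?mulr1 ?mulr0.
  have f0 n : \int[P]_w f n w = 0 by exact: ray0.
  rewrite L1_EFin//; congr EFin.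
  have cvg0 : \int[P]_w f n w @[n --> \oo] --> 0.
    by under eq_fun do rewrite f0; exact: cvg_cst.
  exact: (cvg_unique _ cvgf cvg0).
- exact: (eq_ind _ (fun S : set (set R) => S B) mB _ (RGenInftyO.measurableE R)).
Qed.

End weighted_charfun.

(** * Joint characteristic functions *)

Section linear_combinations.
Context {R : realType} {I Om : Type}.
Implicit Types (X : I -> Om -> R).

Definition linear_comb X (l : seq (R * I)) (w : Om) : R :=
  \sum_(p <- l) p.1 * X p.2 w.

Definition cylinder X (l : seq (I * set R)) : set Om :=
  foldr (fun p A => X p.1 @^-1` p.2 `&` A) setT l.

Lemma linear_comb_cons X a i l w :
  linear_comb X ((a, i) :: l) w = a * X i w + linear_comb X l w.
Proof. by rewrite /linear_comb big_cons. Qed.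

Lemma cylinder_cat X l1 l2 :
  cylinder X (l1 ++ l2) = cylinder X l1 `&` cylinder X l2.
Proof. by elim: l1 => [|p l IH] /=; rewrite ?setTI// IH setIA. Qed.

End linear_combinations.

Lemma cosM_sum (R : realType) (a b : R) :
  cos a * cos b = 2^-1 * (cos (a + b) + cos (a - b)).
Proof. by rewrite cosD cosB; field. Qed.

Section joint_charfun.
Context d (Om : measurableType d) (R : realType) (P : probability Om R).
Variables (I : Type) (X : I -> Om -> R) (D : set I).
Hypothesis mX : forall i, D i -> measurable_fun [set: Om] (X i).

Lemma measurable_linear_comb l : List.Forall (fun p => D p.2) l ->
  measurable_fun [set: Om] (linear_comb X l).
Proof.
elim: l => [_|[a i] l IH /List.Forall_cons_iff[Di Dl]].
  rewrite (_ : linear_comb X [::] = cst 0)//.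
  by apply/funext => w; rewrite /linear_comb big_nil.
rewrite (_ : linear_comb X _ = fun w => a * X i w + linear_comb X l w); last first.
  by apply/funext => w; rewrite linear_comb_cons.
by apply: measurable_funD; [apply: measurable_funM => //; exact: mX|exact: IH].
Qed.

Let mcos : measurable_fun [set: R] (@cos R).
Proof. by apply: continuous_measurable_fun; exact: continuous_cos. Qed.

Let cos_le (x : R) : `|cos x| <= 1.
Proof. by rewrite ler_norml cos_geN1 cos_le1. Qed.

(** All frequencies and phases at once: the signed measure with density [W] has
    vanishing characteristic function along every finite family of the variables. *)
Definition charfun_vanishes (W : Om -> R) :=
  forall l, List.Forall (fun p => D p.2) l -> forall c,
    \int[P]_w (W w * cos (linear_comb X l w + c)) = 0.

(** One coordinate at a time: the product formula for cosines turns the hypothesis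
    into the vanishing of the one-variable characteristic function of
    $W \cos(\sum a_j X_j + c)$, to which uniqueness applies. *)
Lemma charfun_vanishes_restrict (W : Om -> R) M i (B : set R) :
  measurable_fun [set: Om] W -> (forall w, `|W w| <= M) -> D i -> measurable B ->
  charfun_vanishes W -> charfun_vanishes (fun w => W w * \1_B (X i w)).
Proof.
move=> mW WM Di mB W0 l Dl c.
have ml := measurable_linear_comb Dl.
pose V w := W w * cos (linear_comb X l w + c).
have mV : measurable_fun [set: Om] V.
  apply: measurable_funM => //; apply: measurableT_comp => //.
  exact: measurable_funD.
have VM w : `|V w| <= M by rewrite normrM -[leRHS]mulr1 ler_pM.
have IW l' c' : List.Forall (fun p => D p.2) l' ->
    P.-integrable [set: Om] (EFin \o (fun w => W w * cos (linear_comb X l' w + c'))).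
  move=> Dl'; apply: (@L1_bounded _ _ _ _ _ M); last first.
    by move=> w; rewrite normrM -[leRHS]mulr1 ler_pM.
  apply: measurable_funM => //; apply: measurableT_comp => //.
  by apply: measurable_funD => //; exact: measurable_linear_comb.
have V0 b c' : \int[P]_w (V w * cos (b * X i w + c')) = 0.
  have Dp : List.Forall (fun p => D p.2) ((b, i) :: l) by exact: List.Forall_cons.
  have Dm : List.Forall (fun p => D p.2) ((- b, i) :: l) by exact: List.Forall_cons.
  transitivity (\int[P]_w (2^-1 * (W w * cos (linear_comb X ((b, i) :: l) w + (c + c')) +
      W w * cos (linear_comb X ((- b, i) :: l) w + (c - c'))))).
    apply: eq_Rintegral => w _; rewrite /V -mulrA cosM_sum !linear_comb_cons.
    rewrite -mulrDr mulrCA; congr (_ * (_ * (cos _ + cos _))); ring.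
  rewrite RintZ; last by apply: L1D; exact: IW.
  by rewrite RintD ?W0 ?addr0 ?mulr0//; exact: IW.
have := weighted_charfun_eq0 mV VM (mX Di) V0 mB.
move=> e; apply: Rintegral_EFin; rewrite -[RHS]e [RHS]integral_mkcond.
apply: eq_integral => w _; rewrite patchE indicE /V /=.
rewrite (_ : (w \in _) = (X i w \in B)); last by apply/idP/idP => /[!inE].
by case: ifPn => _; rewrite ?mulr1 ?mulr0 ?mul0r.
Qed.

Lemma charfun_vanishes_cylinder (W : Om -> R) M l :
  measurable_fun [set: Om] W -> (forall w, `|W w| <= M) ->
  List.Forall (fun p => D p.1 /\ measurable p.2) l ->
  charfun_vanishes W -> (\int[P]_(w in cylinder X l) (W w)%:E = 0)%E.
Proof.
move=> mW WM + W0; elim: l W mW WM W0 => [|[i B] l IH] W mW WM W0 Dl.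
  have := W0 [::] (List.Forall_nil _) 0.
  rewrite /= => e; rewrite L1_EFin; last exact: L1_bounded WM.
  congr EFin; rewrite -[RHS]e; apply: eq_Rintegral => w _.
  by rewrite /linear_comb big_nil addr0 cos0 mulr1.
have /List.Forall_cons_iff[[/= Di mB] Dl'] := Dl.
have mIB : measurable_fun [set: Om] (fun w => \1_B (X i w) : R).
  by apply: measurableT_comp (mX Di) => //; exact: measurable_indic.
have mWB : measurable_fun [set: Om] (fun w => W w * \1_B (X i w)).
  exact: measurable_funM.
have WBM w : `|W w * \1_B (X i w)| <= M.
  rewrite normrM -[leRHS]mulr1 ler_pM// indicE.
  by case: (_ \in _); rewrite ?normr1 ?normr0.
rewrite -[RHS](IH _ mWB WBM (charfun_vanishes_restrict mW WM Di mB W0) Dl').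
rewrite /= setIC integral_mkcondr; apply: eq_integral => w _.
rewrite patchE indicE (_ : (w \in _) = (X i w \in B)); last by apply/idP/idP => /[!inE].
by case: ifPn => _; rewrite ?mulr1 ?mulr0.
Qed.

Lemma measurable_cylinder l : List.Forall (fun p => D p.1 /\ measurable p.2) l ->
  measurable (cylinder X l).
Proof.
elim: l => [_|[i B] l IH /List.Forall_cons_iff[[/= Di mB] Dl]].
  exact: measurableT.
rewrite /=; apply: measurableI; last exact: IH.
by rewrite -[X in measurable X]setTI; exact: mX.
Qed.

Lemma charfun_vanishes_sigma (W : Om -> R) M :
  measurable_fun [set: Om] W -> (forall w, `|W w| <= M) -> charfun_vanishes W ->
  forall A, <<s [set A | exists i, exists B : set R,
                  [/\ D i, measurable B & A = X i @^-1` B] ]>> A ->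
  (\int[P]_(w in A) (W w)%:E = 0)%E.
Proof.
move=> mW WM W0 A sA.
pose G := [set A | exists2 l, List.Forall (fun p => D p.1 /\ measurable p.2) l &
  A = cylinder X l].
have IW : P.-integrable [set: Om] (EFin \o W) by exact: L1_bounded WM.
have := @weighted_dynkin _ _ Om Om _ P W id IW (@measurable_id _ _ _) G.
apply.
- move=> _ _ [l1 D1 ->] [l2 D2 ->]; exists (l1 ++ l2); last by rewrite cylinder_cat.
  exact/List.Forall_app.
- by move=> _ [l Dl ->]; exact: measurable_cylinder.
- by have := charfun_vanishes_cylinder mW WM (List.Forall_nil _) W0.
- by move=> _ [l Dl ->]; exact: charfun_vanishes_cylinder Dl W0.
- move: A sA; apply: smallest_sub; first exact: smallest_sigma_algebra.
  move=> _ [i [B [Di mB ->]]]; apply: sub_gen_smallest; exists [:: (i, B)].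
    by repeat constructor.
  by rewrite /= setIT.
Qed.

End joint_charfun.

(** * Independence of the increments *)

Lemma L1_mul d (T : measurableType d) (R : realType) (mu : {measure set T -> \bar R})
    (f g : T -> R) : measurable_fun [set: T] f -> measurable_fun [set: T] g ->
  mu.-integrable [set: T] (EFin \o (fun x => f x ^+ 2)) ->
  mu.-integrable [set: T] (EFin \o (fun x => g x ^+ 2)) ->
  mu.-integrable [set: T] (EFin \o (fun x => f x * g x)).
Proof.
move=> mf mg If Ig; apply: L1_le (L1D If Ig); first exact: measurable_funM.
move=> x; rewrite [leRHS]ger0_norm ?addr_ge0 ?sqr_ge0// ler_norml.
by apply/andP; split; have := sqr_ge0 (f x + g x); have := sqr_ge0 (f x - g x); nra.
Qed.

(** The quadratic variation of $X$ up to time $t$. *)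
Definition clock {R : realType} (sigma : R -> R) (t : R) : R :=
  \int[lebesgue_measure]_(r in `[0, t]) (sigma r ^+ 2).

Record gaussian_with_clock {R : realType} {d : measure_display}
    {Om : measurableType d} (P : probability Om R) (T : R) (sigma : R -> R)
    (X : R -> Om -> R) : Prop := GaussianWithClock {
  gwc_sigma_meas : measurable_fun `[0, T] sigma;
  gwc_sigma_L2 : (\int[lebesgue_measure]_(s in `[0%R, T])
                   (sigma s ^+ 2)%:E < +oo)%E;
  gwc_gaussian : gaussian_process P T X;
  gwc_centered : forall t, 0 <= t <= T -> ('E_P[X t] = 0)%E;
  gwc_cov : forall s t, 0 <= s <= T -> 0 <= t <= T ->
       ('E_P[(fun w => X s w * X t w)%R] =
        \int[lebesgue_measure]_(r in `[0%R, Num.min s t])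
          (sigma r ^+ 2)%:E)%E }.

Section increments.
Context {R : realType} {d : measure_display} {Om : measurableType d}.
Variables (P : probability Om R) (T : R) (sigma : R -> R) (X : R -> Om -> R).
Hypothesis hX : gaussian_with_clock P T sigma X.
Local Notation L1 f := (P.-integrable [set: Om] (EFin \o f)).
Local Notation ok l := (List.Forall (fun p : R * R => 0 <= p.2 <= T) l).

Lemma gwc_linear_comb l : ok l -> gaussian_rv P (linear_comb X l).
Proof.
move=> okl.
have := gwc_gaussian hX.
move=> /(_ (size l) (fun i => (tnth (in_tuple l) i).2)
  (fun i => (tnth (in_tuple l) i).1)).
have -> : (fun w => \sum_(i < size l) (tnth (in_tuple l) i).1 *
    X (tnth (in_tuple l) i).2 w) = linear_comb X l.
  by apply/funext => w; rewrite /linear_comb [RHS]big_tnth.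
apply => i; have : tnth (in_tuple l) i \in l by exact: mem_tnth.
elim: {i}l okl (tnth _ _) => [//|q l IH /List.Forall_cons_iff[q_ok okl]] p.
by rewrite inE => /orP[/eqP ->//|]; exact: IH.
Qed.

Lemma gwc_rv t : 0 <= t <= T -> gaussian_rv P (X t).
Proof.
move=> tT; have := @gwc_linear_comb [:: (1, t)].
rewrite (_ : linear_comb X _ = X t); last first.
  by apply/funext => w; rewrite /linear_comb big_seq1 mul1r.
by apply; repeat constructor.
Qed.

Lemma gwc_measurable t : 0 <= t <= T -> measurable_fun [set: Om] (X t).
Proof. by move=> /gwc_rv[]. Qed.

Lemma natural_filtration_measurable t : t <= T ->
  natural_filtration X t `<=` @measurable _ Om.
Proof.
move=> tT; apply: smallest_sub; first exact: sigma_algebra_measurable.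
move=> _ [r [B [/andP[r0 rt] mB ->]]]; rewrite -[X in measurable X]setTI.
by apply: gwc_measurable => //; rewrite r0 (le_trans rt).
Qed.

Lemma gwc_L2 t : 0 <= t <= T -> L1 (fun w => X t w ^+ 2).
Proof.
move=> tT.
by have [] := centered_gaussianP (gwc_rv tT) (gwc_centered hX tT).
Qed.

Lemma gwc_L1 t : 0 <= t <= T -> L1 (X t).
Proof.
by move=> tT; apply: L1_sqr; [exact: gwc_measurable|exact: gwc_L2].
Qed.

Lemma gwc_mean t : 0 <= t <= T -> \int[P]_w X t w = 0.
Proof.
by move=> tT; have := gwc_centered hX tT; rewrite unlock => /Rintegral_EFin.
Qed.

Lemma gwc_covE s t : 0 <= s <= T -> 0 <= t <= T -> s <= t ->
  \int[P]_w (X s w * X t w) = clock sigma s.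
Proof.
move=> sT tT st; have := gwc_cov hX sT tT; rewrite unlock min_l// => e.
by rewrite /Rintegral /clock e.
Qed.

Lemma linear_comb_centered l : ok l ->
  L1 (linear_comb X l) /\ \int[P]_w linear_comb X l w = 0.
Proof.
elim: l => [_|[a t] l IH /List.Forall_cons_iff[/= tT Dl]].
  rewrite (_ : linear_comb X [::] = cst 0).
    by split; [exact: L1_cst|exact: Rint_cst].
  by apply/funext => w; rewrite /linear_comb big_nil.
have [Il El] := IH Dl.
rewrite (_ : linear_comb X _ = fun w => a * X t w + linear_comb X l w); last first.
  by apply/funext => w; rewrite linear_comb_cons.
have It := gwc_L1 tT; split; first by apply: L1D => //; exact: L1Z.
by rewrite RintD//; [rewrite RintZ// gwc_mean// El mulr0 addr0|exact: L1Z].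
Qed.

(** A linear combination of the $X_t$ is Gaussian and centered, so that its variance
    determines all its exponential and trigonometric moments. *)
Lemma linear_combP l : ok l -> let v := \int[P]_w linear_comb X l w ^+ 2 in
  [/\ L1 (fun w => linear_comb X l w ^+ 2),
      forall a, (\int[P]_w (expR (a * linear_comb X l w))%:E =
                 (expR (a ^+ 2 * v / 2))%:E)%E &
      forall c, \int[P]_w cos (linear_comb X l w + c) = expR (- (v / 2)) * cos c].
Proof.
move=> okl; have [Il El] := linear_comb_centered okl.
apply: centered_gaussianP; first exact: gwc_linear_comb.
by rewrite unlock L1_EFin// El.
Qed.

Section increment.
Variables (s t : R).
Hypotheses (s0 : 0 <= s) (st : s <= t) (tT : t <= T).

Let s_ok : 0 <= s <= T. Proof. by rewrite s0 (le_trans st). Qed.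
Let t_ok : 0 <= t <= T. Proof. by rewrite tT (le_trans s0). Qed.

Let D w := X t w - X s w.

Let DE a : linear_comb X [:: (a, t); (- a, s)] = fun w => a * D w.
Proof.
apply/funext => w; rewrite !linear_comb_cons /linear_comb big_nil /D; ring.
Qed.

Let D_ok a : ok [:: (a, t); (- a, s)]. Proof. by repeat constructor. Qed.

Lemma measurable_increment : measurable_fun [set: Om] (fun w => X t w - X s w).
Proof. by apply: measurable_funB; exact: gwc_measurable. Qed.

Lemma increment_L2 : L1 (fun w => (X t w - X s w) ^+ 2).
Proof.
have [+ _ _] := linear_combP (D_ok 1); rewrite DE.
by under eq_fun do rewrite mul1r.
Qed.

Lemma increment_variance :
  \int[P]_w (X t w - X s w) ^+ 2 = clock sigma t - clock sigma s.
Proof.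
have Ist : L1 (fun w => X s w * X t w).
  by apply: L1_mul; do ?[exact: gwc_measurable]; exact: gwc_L2.
have Is : L1 (fun w => X s w * X s w) by exact: gwc_L2.
have It : L1 (fun w => X t w * X t w) by exact: gwc_L2.
transitivity (\int[P]_w (X t w * X t w - 2 * (X s w * X t w) + X s w * X s w)).
  by apply: eq_Rintegral => w _; ring.
have I2 : L1 (fun w => 2 * (X s w * X t w)) by exact: L1Z.
rewrite RintD//; last exact: L1B.
rewrite RintB// RintZ// !gwc_covE//; ring.
Qed.

Lemma increment_mgf a :
  (\int[P]_w (expR (a * (X t w - X s w)))%:E =
   (expR (a ^+ 2 * (clock sigma t - clock sigma s) / 2))%:E)%E.
Proof.
have [_ /(_ a) + _] := linear_combP (D_ok 1); rewrite DE.
under eq_integral do rewrite mul1r.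
by under eq_Rintegral do rewrite mul1r; rewrite increment_variance.
Qed.

Let orth l : List.Forall (fun p : R * R => 0 <= p.2 <= s) l ->
  L1 (fun w => linear_comb X l w * D w) /\
  \int[P]_w (linear_comb X l w * D w) = 0.
Proof.
elim: l => [_|[a r] l IH /List.Forall_cons_iff[/= /andP[r0 rs] Dl]].
  rewrite (_ : (fun w => linear_comb X [::] w * D w) = cst 0).
    by split; [exact: L1_cst|exact: Rint_cst].
  by apply/funext => w; rewrite /linear_comb big_nil mul0r.
have [Il El] := IH Dl.
have r_ok : 0 <= r <= T by rewrite r0 (le_trans rs)// (le_trans st).
have Irt : L1 (fun w => X r w * X t w).
  by apply: L1_mul; do ?[exact: gwc_measurable]; exact: gwc_L2.
have Irs : L1 (fun w => X r w * X s w).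
  by apply: L1_mul; do ?[exact: gwc_measurable]; exact: gwc_L2.
have Ir : L1 (fun w => X r w * X t w - X r w * X s w) by exact: L1B.
rewrite (_ : (fun w => _ * _) =
    fun w => a * (X r w * X t w - X r w * X s w) + linear_comb X l w * D w); last first.
  by apply/funext => w; rewrite linear_comb_cons /D; ring.
split; first by apply: L1D => //; exact: L1Z.
rewrite RintD//; last exact: L1Z.
rewrite RintZ// RintB// El !gwc_covE//; last by rewrite (le_trans rs).
by rewrite subrr mulr0 addr0.
Qed.

Let past_time r : 0 <= r <= s -> 0 <= r <= T.
Proof. by move=> /andP[r0 rs]; rewrite r0 (le_trans rs)// (le_trans st). Qed.

Let past_ok l : List.Forall (fun p : R * R => 0 <= p.2 <= s) l -> ok l.
Proof.
apply: List.Forall_impl => p /andP[p0 ps]; rewrite p0/= (le_trans ps)//.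
by rewrite (le_trans st).
Qed.

Let kappa th c := \int[P]_w cos (th * D w + c).

(** The past and the increment are uncorrelated ([orth]), so the variances add up and
    the characteristic function factors. *)
Let joint_cos l th c : List.Forall (fun p : R * R => 0 <= p.2 <= s) l ->
  \int[P]_w cos (linear_comb X l w + th * D w + c) =
  expR (- ((\int[P]_w linear_comb X l w ^+ 2 +
            th ^+ 2 * (clock sigma t - clock sigma s)) / 2)) * cos c.
Proof.
move=> past_l; have okl := past_ok past_l.
have ok2 : ok ([:: (th, t); (- th, s)] ++ l).
  by do 2 apply: List.Forall_cons => //.
have E w : linear_comb X ([:: (th, t); (- th, s)] ++ l) w =
    linear_comb X l w + th * D w.
  by rewrite /= !linear_comb_cons /D; ring.
have [_ _ /(_ c)] := linear_combP ok2.
under eq_Rintegral do rewrite E.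
move=> ->; congr (expR (- (_ / 2)) * _).
have [I2 _ _] := linear_combP okl; have [Io Eo] := orth past_l.
transitivity (\int[P]_w (linear_comb X l w ^+ 2 + (2 * th) * (linear_comb X l w * D w) +
   th ^+ 2 * (D w ^+ 2))).
  by apply: eq_Rintegral => w _; rewrite E; ring.
have I3 : L1 (fun w => D w ^+ 2) by exact: increment_L2.
have I4 : L1 (fun w => (2 * th) * (linear_comb X l w * D w)) by exact: L1Z.
rewrite RintD; [|exact: L1D|exact: L1Z].
by rewrite RintD// !RintZ// Eo mulr0 addr0 increment_variance.
Qed.

Let mcos : measurable_fun [set: R] (@cos R).
Proof. by apply: continuous_measurable_fun; exact: continuous_cos. Qed.

Let cos_le (x : R) : `|cos x| <= 1.
Proof. by rewrite ler_norml cos_geN1 cos_le1. Qed.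

Let kappaE th c : kappa th c =
  expR (- (th ^+ 2 * (clock sigma t - clock sigma s) / 2)) * cos c.
Proof.
have := @joint_cos [::] th c (List.Forall_nil _).
have E w : linear_comb X [::] w = 0 by rewrite /linear_comb big_nil.
under eq_Rintegral do rewrite E add0r.
rewrite -/(kappa th c) => ->; congr (expR (- (_ / 2)) * _).
under eq_Rintegral do rewrite E expr0n.
by rewrite Rint_cst add0r.
Qed.

Let ILcos (f : Om -> R) : measurable_fun [set: Om] f -> L1 (fun w => cos (f w)).
Proof.
move=> mf; apply: (@L1_bounded _ _ _ _ _ 1) => //; exact: measurableT_comp.
Qed.

Let mD : measurable_fun [set: Om] D. Proof. exact: measurable_increment. Qed.

Let mDc th c : measurable_fun [set: Om] (fun w => th * D w + c).
Proof. by apply: measurable_funD => //; exact: measurable_funM. Qed.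

Let vanish th c0 : charfun_vanishes P X (fun r => 0 <= r <= s)
  (fun w => cos (th * D w + c0) - kappa th c0).
Proof.
move=> l past_l c.
have ml : measurable_fun [set: Om] (linear_comb X l).
  by have [] := gwc_linear_comb (past_ok past_l).
have [_ _ El] := linear_combP (past_ok past_l).
have m1 th' c' : measurable_fun [set: Om] (fun w => linear_comb X l w + th' * D w + c').
  apply: measurable_funD => //; apply: measurable_funD => //.
  exact: measurable_funM.
have m2 : measurable_fun [set: Om] (fun w => linear_comb X l w + c).
  exact: measurable_funD.
transitivity (\int[P]_w (2^-1 * (cos (linear_comb X l w + th * D w + (c + c0)) +
    cos (linear_comb X l w + - th * D w + (c - c0))) -
    kappa th c0 * cos (linear_comb X l w + c))).
  apply: eq_Rintegral => w _; rewrite mulrBl; congr (_ - _).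
  rewrite [LHS]mulrC cosM_sum; congr (_ * (cos _ + cos _)); ring.
have I1 : L1 (fun w => cos (linear_comb X l w + th * D w + (c + c0)) +
    cos (linear_comb X l w + - th * D w + (c - c0))).
  by apply: L1D; exact: ILcos.
rewrite RintB; [|exact: L1Z|by apply: L1Z; exact: ILcos].
rewrite !RintZ//; last exact: ILcos.
rewrite RintD; [|exact: ILcos|exact: ILcos].
rewrite !joint_cos// sqrrN El kappaE cosD cosB.
set a := \int[P]_w _; set b := th ^+ 2 * _.
rewrite (_ : - ((a + b) / 2) = - (b / 2) + - (a / 2)); last by field.
by rewrite expRD; field.
Qed.

(** Uniqueness is used twice: on the past, with the centered cosine of the increment
    as weight ([vanish]), and then on the increment, with the centered indicator of
    [A] as weight. *)
Lemma increment_independent A B : natural_filtration X s A -> measurable B ->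
  P (A `&` (fun w => X t w - X s w) @^-1` B) =
  (P A * P ((fun w => (X t w - X s w)%R) @^-1` B))%E.
Proof.
move=> sA mB; have mA := natural_filtration_measurable (le_trans st tT) sA.
have mDB : measurable (D @^-1` B) by rewrite -[X in measurable X]setTI; exact: mD.
have PAE := fineK (fin_num_measure P _ mA); set p := fine (P A) in PAE.
have m1A : measurable_fun [set: Om] (\1_A : Om -> R) by exact: measurable_indic.
have I1A : L1 (\1_A : Om -> R).
  apply: (@L1_bounded _ _ _ _ _ 1) => // w; rewrite indicE.
  by case: (_ \in _); rewrite ?normr1 ?normr0.
have E1A : \int[P]_w \1_A w = p by rewrite /Rintegral integral_indic// setIT.
have mC th c : measurable_fun [set: Om] (fun w => cos (th * D w + c) - kappa th c).
  by apply: measurable_funB => //; exact: measurableT_comp.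
have I1Ac th c : L1 (fun w => \1_A w * cos (th * D w + c)).
  apply: (@L1_bounded _ _ _ _ _ 1).
    by apply: measurable_funM => //; exact: measurableT_comp.
  move=> w; rewrite normrM -[leRHS]mulr1 ler_pM// indicE.
  by case: (_ \in _); rewrite ?normr1 ?normr0.
have A0 th c : \int[P]_w (\1_A w * cos (th * D w + c)) = p * kappa th c.
  have CM w : `|cos (th * D w + c) - kappa th c| <= 1 + `|kappa th c|.
    by rewrite (le_trans (ler_normB _ _))// lerD2r.
  have := charfun_vanishes_sigma (D := fun r => 0 <= r <= s)
    (fun r rs => gwc_measurable (past_time rs)) (mC th c) CM (@vanish th c) sA.
  move=> /(congr1 fine); rewrite -[LHS]/(\int[P]_(w in A) _) Rintegral_mkcond => e.
  apply/eqP; rewrite -subr_eq0 -[X in _ == X]e -E1A mulrC -RintZ// -RintB//.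
    apply/eqP/eq_Rintegral => w _; rewrite patchE indicE.
    by case: (w \in A); rewrite /= ?mul1r ?mulr1// mul0r mulr0 subrr.
  exact: L1Z.
pose W w := \1_A w - p : R.
have mW : measurable_fun [set: Om] W by exact: measurable_funB.
have WM w : `|W w| <= 1 + `|p|.
  rewrite (le_trans (ler_normB _ _))// lerD2r indicE.
  by case: (_ \in _); rewrite ?normr1 ?normr0.
have W0 th c : \int[P]_w (W w * cos (th * D w + c)) = 0.
  under eq_Rintegral do rewrite /W mulrBl.
  rewrite RintB//; last by apply: L1Z; exact: ILcos.
  by rewrite RintZ; [rewrite A0 subrr|exact: ILcos].
have := weighted_charfun_eq0 mW WM mD W0 mB.
have I1D : L1 (fun w => \1_(D @^-1` B) w : R).
  apply: (@L1_bounded _ _ _ _ _ 1); first exact: measurable_indic.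
  by move=> w; rewrite indicE; case: (_ \in _); rewrite ?normr1 ?normr0.
have I1AD : L1 (fun w => \1_(A `&` D @^-1` B) w : R).
  apply: (@L1_bounded _ _ _ _ _ 1).
    by apply: measurable_indic; exact: measurableI.
  by move=> w; rewrite indicE; case: (_ \in _); rewrite ?normr1 ?normr0.
rewrite integral_mkcond.
move=> e.
have : \int[P]_w (\1_(A `&` D @^-1` B) w - p * \1_(D @^-1` B) w) = 0.
  rewrite /Rintegral -[RHS]/(fine 0%E) -e; congr fine; apply: eq_integral => w _.
  rewrite patchE /W indicI /= !indicE.
  by case: ifPn => _; rewrite ?mulr1 ?mulr0 ?subrr.
rewrite RintB//; last exact: L1Z.
rewrite RintZ// /Rintegral !integral_indic//; last exact: measurableI.
rewrite !setIT => /subr0_eq h.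
rewrite -(fineK (fin_num_measure P _ (measurableI _ _ mA mDB))) h EFinM.
by rewrite PAE fineK//; exact: fin_num_measure.
Qed.

End increment.

End increments.

(** * Integrating out an increment given the past *)

Section independent_pair.
Context d1 d2 d3 (T : measurableType d1) (U : measurableType d2)
  (V : measurableType d3) (R : realType) (P : probability T R).
Variables (f : T -> U) (g : T -> V).
Hypotheses (mf : measurable_fun [set: T] f) (mg : measurable_fun [set: T] g).
Hypothesis fg_indep : forall A B, measurable A -> measurable B ->
  P (f @^-1` A `&` g @^-1` B) = (P (f @^-1` A) * P (g @^-1` B))%E.
Local Open Scope ereal_scope.

(** The joint law of independent variables is the product of their laws. *)
Lemma ge0_integral_independent (F : U * V -> \bar R) :
  measurable_fun [set: U * V] F -> (forall z, 0 <= F z) ->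
  \int[P]_x F (f x, g x) = \int[P]_x \int[P]_y F (f x, g y).
Proof.
move=> mF F0.
pose f' : {mfun T >-> U} := HB.pack f (isMeasurableFun.Build _ _ _ _ _ mf).
pose g' : {mfun T >-> V} := HB.pack g (isMeasurableFun.Build _ _ _ _ _ mg).
pose Pf := distribution P f'; pose Pg := distribution P g'.
have mfg : measurable_fun [set: T] (fun x => (f x, g x)).
  exact/measurable_fun_pair.
pose h : {mfun T >-> (U * V)%type} := HB.pack (fun x => (f x, g x))
  (isMeasurableFun.Build _ _ _ _ _ mfg).
have law B : measurable B -> P ((fun x => (f x, g x)) @^-1` B) = (Pf \x Pg) B.
  move=> mB; apply/esym.
  apply: (@product_measure_unique _ _ _ _ _ Pf Pg (distribution P h)) => //.
rewrite (ge0_integral_law mfg law)// fubini_tonelli1// /fubini_F.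
rewrite (@ge0_integral_distribution _ _ _ _ _ P f')//.
- apply: eq_integral => x _; apply: (@ge0_integral_distribution _ _ _ _ _ P g'
    (fun y => F (f x, y))) => //.
  exact: measurableT_comp mF _.
- exact: measurable_fun_fubini_tonelli_F.
- by move=> x; exact: integral_ge0.
Qed.

End independent_pair.

Section filtration.
Context {R : realType} {d : measure_display} {Om : measurableType d}.
Variable X : R -> Om -> R.

Definition past_generators s : set (set Om) :=
  [set A | exists r, exists B : set R,
     [/\ 0 <= r <= s, measurable B & A = X r @^-1` B] ].

(** The sample space with the past as its sigma-algebra, so that measurability with
    respect to the past becomes plain measurability and products can be formed. *)
Definition past_type s := g_sigma_algebraType (past_generators s).

Lemma measurable_wrtP s (f : Om -> R) :
  measurable_wrt (natural_filtration X s) f <->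
  measurable_fun [set: past_type s] (f : past_type s -> R).
Proof.
split=> mf; first by move=> _ B mB; rewrite setTI; exact: mf.
by move=> B mB; have := mf measurableT B mB; rewrite setTI.
Qed.

Lemma natural_filtrationS s t : s <= t ->
  natural_filtration X s `<=` natural_filtration X t.
Proof.
move=> st; apply: smallest_sub; first exact: smallest_sigma_algebra.
move=> _ [r [B [/andP[r0 rs] mB ->]]]; apply: sub_gen_smallest.
exists r, B; split => //.
by rewrite r0 (le_trans rs).
Qed.

Lemma measurable_wrtS s t (f : Om -> R) : s <= t ->
  measurable_wrt (natural_filtration X s) f ->
  measurable_wrt (natural_filtration X t) f.
Proof. by move=> st mf B mB; apply: (natural_filtrationS st); exact: mf. Qed.

Lemma measurable_wrt_process s t : 0 <= s <= t ->
  measurable_wrt (natural_filtration X t) (X s).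
Proof. by move=> st B mB; apply: sub_gen_smallest; exists s, B. Qed.

End filtration.

Section exponential_step.
Context {R : realType} {d : measure_display} {Om : measurableType d}.
Variables (P : probability Om R) (T : R) (sigma : R -> R) (X : R -> Om -> R).
Hypothesis hX : gaussian_with_clock P T sigma X.

Lemma measurable_wrt_measurable s (f : Om -> R) : s <= T ->
  measurable_wrt (natural_filtration X s) f -> measurable_fun [set: Om] f.
Proof.
move=> sT mf _ B mB; rewrite setTI.
by apply: (natural_filtration_measurable hX sT); exact: mf.
Qed.

(** Given the past, the increment has its unconditional Gaussian law, whose
    exponential moment at [c] is exactly the compensating factor. *)
Lemma expR_increment_step s t (z c : Om -> R) : 0 <= s -> s <= t -> t <= T ->
  measurable_wrt (natural_filtration X s) z ->
  measurable_wrt (natural_filtration X s) c ->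
  (\int[P]_w (expR (z w + c w * (X t w - X s w) -
      c w ^+ 2 * (clock sigma t - clock sigma s) / 2))%:E =
   \int[P]_w (expR (z w))%:E)%E.
Proof.
move=> s0 st tT zs cs.
set v := clock sigma t - clock sigma s.
have mid : measurable_fun [set: Om] (id : Om -> past_type X s).
  by move=> _ A sA; rewrite setTI; exact: (natural_filtration_measurable hX (le_trans st tT) sA).
have mD := measurable_increment hX s0 st tT.
have indep (A : set (past_type X s)) (B : set R) : measurable A -> measurable B ->
    P (id @^-1` A `&` (fun w => X t w - X s w) @^-1` B) =
    (P (id @^-1` A) * P ((fun w => (X t w - X s w)%R) @^-1` B))%E.
  by move=> sA mB; exact: (increment_independent hX s0 st tT sA mB).
pose F (q : past_type X s * R) : \bar R :=
  (expR (z q.1 + c q.1 * q.2 - c q.1 ^+ 2 * v / 2))%:E.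
have mz := (measurable_wrtP X s z).1 zs.
have mc := (measurable_wrtP X s c).1 cs.
have mz1 : measurable_fun [set: past_type X s * R] (fun q => z q.1).
  exact: (measurableT_comp mz measurable_fst).
have mc1 : measurable_fun [set: past_type X s * R] (fun q => c q.1).
  exact: (measurableT_comp mc measurable_fst).
have mF : measurable_fun [set: past_type X s * R] F.
  apply/measurable_EFinP; apply: measurableT_comp => //.
  apply: measurable_funB.
    by apply: measurable_funD => //; apply: measurable_funM.
  by apply: measurable_funM => //; apply: measurable_funM => //; exact: measurable_funX.
have := ge0_integral_independent mid mD indep mF (fun q => expR_ge0 _).
rewrite /F /= => ->; apply: eq_integral => w _.
transitivity (\int[P]_y ((expR (z w - c w ^+ 2 * v / 2))%:E *
    (expR (c w * (X t y - X s y)))%:E))%E.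
  by apply: eq_integral => y _; rewrite -EFinM -expRD; congr (expR _)%:E; ring.
rewrite ge0_integralZl//.
- rewrite (increment_mgf hX s0 st tT) -EFinM -expRD; congr (expR _)%:E.
  by rewrite -/v; ring.
- by apply/measurable_EFinP; apply: measurableT_comp => //; exact: measurable_funM.
Qed.

End exponential_step.

(** * Linear combinations of simple processes *)

Section grids.
Variable R : realType.
Implicit Types (r : nat -> R) (a b : R) (m : nat).

Definition grid r m := forall i, (i < m)%N -> r i <= r i.+1.

Definition on_grid r m a := exists2 p, (p <= m)%N & a = r p.

Lemma grid_le r m i j : grid r m -> (i <= j)%N -> (j <= m)%N -> r i <= r j.
Proof.
move=> gr; elim: j => [|j IH]; first by rewrite leqn0 => /eqP ->.
rewrite leq_eqVlt => /orP[/eqP -> //|]; rewrite ltnS => ij jm.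
by apply: le_trans (IH ij (ltnW jm)) (gr _ jm).
Qed.

Lemma on_grid_cell r m a j : grid r m -> on_grid r m a -> (j < m)%N ->
  a <= r j \/ r j.+1 <= a.
Proof.
move=> gr [p pm ->] jm; have [pj|jp] := leqP p j.
  by left; apply: grid_le gr pj (ltnW jm).
by right; apply: grid_le gr jp pm.
Qed.

Lemma grid_telescope (r : nat -> R) m (f : R -> R) a b :
  grid r m -> on_grid r m a -> on_grid r m b -> a <= b ->
  \sum_(j < m) \1_(`]a, b] : set R) (r j.+1) * (f (r j.+1) - f (r j)) = f b - f a.
Proof.
move=> gr ga gb ab.
pose cl x := Num.max a (Num.min x b).
have cell j : (j < m)%N -> \1_(`]a, b] : set R) (r j.+1) * (f (r j.+1) - f (r j)) =
    f (cl (r j.+1)) - f (cl (r j)).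
  move=> jm; have rj := gr _ jm; rewrite indicE /cl.
  have [aj|ja] := on_grid_cell gr ga jm; last first.
    rewrite memNset ?mul0r; last by rewrite /= in_itv/= ltNge ja.
    rewrite !min_l ?(le_trans ja)// ?(le_trans rj)// ?(le_trans ja)//.
    by rewrite !max_l ?subrr// (le_trans rj).
  have [bj|jb] := on_grid_cell gr gb jm.
    rewrite !min_r ?subrr ?(le_trans bj)//.
    have [e|ne] := eqVneq (r j.+1) (r j); first by rewrite e subrr mulr0.
    rewrite memNset ?mul0r//= in_itv/= => /andP[_ jb].
    by move/eqP: ne; apply; apply/eqP; rewrite eq_le rj (le_trans jb).
  rewrite !min_l// ?(le_trans rj)// !max_r ?(le_trans aj)//.
  have [e|ne] := eqVneq (r j.+1) (r j); first by rewrite e subrr mulr0.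
  rewrite mem_set ?mul1r//= in_itv/= jb andbT (le_lt_trans aj)//.
  by rewrite lt_neqAle eq_sym ne.
under eq_bigr => j _ do rewrite cell ?ltn_ord//.
rewrite -(big_mkord predT (fun j => f (cl (r j.+1)) - f (cl (r j)))).
rewrite telescope_sumr// /cl.
have [p pm ep] := ga; have [q qm eq] := gb.
have r0a : r 0%N <= a by rewrite ep; exact: grid_le gr _ pm.
have brm : b <= r m by rewrite eq; exact: grid_le gr qm _.
by rewrite (min_r brm) (max_r ab) (min_l (le_trans r0a ab)) (max_l r0a).
Qed.

Lemma grid_indic (r : nat -> R) m a b (s : R) :
  grid r m -> on_grid r m a -> on_grid r m b -> a <= b ->
  \1_(`]a, b] : set R) s =
  \sum_(j < m) \1_(`]a, b] : set R) (r j.+1) * \1_(`]r j, r j.+1] : set R) s :> R.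
Proof.
have indB x y : x <= y -> \1_(`]x, y] : set R) s = (s <= y)%R%:R - (s <= x)%R%:R :> R.
  move=> xy; rewrite indicE; have [sx|xs] := leP s x.
    by rewrite memNset ?(le_trans sx)// ?subrr//= in_itv/= ltNge sx.
  have [sy|ys] := leP s y; rewrite subr0; first by rewrite mem_set//= in_itv/= xs.
  by rewrite memNset//= in_itv/= xs leNgt ys.
move=> gr ga gb ab; rewrite (indB _ _ ab).
rewrite -(grid_telescope (fun x => (s <= x)%R%:R) gr ga gb ab).
by apply: eq_bigr => j _; rewrite -indB//; exact: gr.
Qed.

End grids.

Section merging_simple_processes.
Context {R : realType} {d : measure_display} {Om : measurableType d}.
Variables (T : R) (X : R -> Om -> R).
Implicit Types H K : @simple_process R d Om.

Definition merged_times H K : seq R :=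
  sort <=%O ([seq sp_time H i | i <- iota 0 (sp_size H).+1] ++
             [seq sp_time K i | i <- iota 0 (sp_size K).+1]).

(** The coefficient on a cell of the common refinement is read off at the right
    endpoint, which belongs to the cell. *)
Definition simple_lin (th : R) H K : @simple_process R d Om :=
  let r := nth 0 (merged_times H K) in
  SimpleProcess (size (merged_times H K)).-1 r
    (fun j w => simple_value H (r j.+1) w + th * simple_value K (r j.+1) w).

Section merge.
Variables (th : R) (H K : @simple_process R d Om).
Hypotheses (aH : simple_adapted T X H) (aK : simple_adapted T X K).
Let r := nth 0 (merged_times H K).
Let m := (size (merged_times H K)).-1.

Let size_merged : size (merged_times H K) = m.+1.
Proof. by rewrite /m size_sort size_cat !size_map !size_iota addSn. Qed.

Let gridr : grid r m.
Proof.
move=> i im; have /(sortedP 0) := sort_sorted le_total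
  ([seq sp_time H i | i <- iota 0 (sp_size H).+1] ++
   [seq sp_time K i | i <- iota 0 (sp_size K).+1]).
by apply; rewrite size_merged.
Qed.

Let gridH i : (i <= sp_size H)%N -> on_grid r m (sp_time H i).
Proof.
move=> iH; have : sp_time H i \in merged_times H K.
  by rewrite mem_sort mem_cat map_f// mem_iota.
by move=> /(nthP 0)[p]; rewrite size_merged ltnS => pm <-; exists p.
Qed.

Let gridK i : (i <= sp_size K)%N -> on_grid r m (sp_time K i).
Proof.
move=> iK; have : sp_time K i \in merged_times H K.
  by rewrite mem_sort mem_cat orbC map_f// mem_iota.
by move=> /(nthP 0)[p]; rewrite size_merged ltnS => pm <-; exists p.
Qed.

Let in_time p : (p <= m)%N -> 0 <= r p <= T.
Proof.
move=> pm; have : r p \in merged_times H K by rewrite mem_nth// size_merged.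
rewrite mem_sort mem_cat => /orP[] /mapP[i]; rewrite mem_iota ltnS => /andP[_ iH] ->.
  by have [/(_ _ iH)] := aH.
by have [/(_ _ iH)] := aK.
Qed.

Lemma refined_value (L : @simple_process R d Om) s w :
  (forall i, (i < sp_size L)%N -> sp_time L i <= sp_time L i.+1) ->
  (forall i, (i <= sp_size L)%N -> on_grid r m (sp_time L i)) ->
  simple_value L s w = \sum_(j < m) simple_value L (r j.+1) w * \1_(`]r j, r j.+1] : set R) s.
Proof.
move=> Lle gL; rewrite /simple_value.
under [RHS]eq_bigr do rewrite mulr_suml.
rewrite exchange_big/=; apply: eq_bigr => i _.
under eq_bigr do rewrite -mulrA; rewrite -mulr_sumr; congr (_ * _).
by apply: grid_indic gridr _ _ _; [apply: gL; exact: ltnW|exact: gL|exact: Lle].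
Qed.

Lemma refined_integral (L : @simple_process R d Om) w :
  (forall i, (i < sp_size L)%N -> sp_time L i <= sp_time L i.+1) ->
  (forall i, (i <= sp_size L)%N -> on_grid r m (sp_time L i)) ->
  simple_integral X L w = \sum_(j < m) simple_value L (r j.+1) w * (X (r j.+1) w - X (r j) w).
Proof.
move=> Lle gL; rewrite /simple_value /simple_integral.
under [RHS]eq_bigr do rewrite mulr_suml.
rewrite exchange_big/=; apply: eq_bigr => i _.
under eq_bigr do rewrite -mulrA; rewrite -mulr_sumr; congr (_ * _); apply/esym.
by apply: (grid_telescope (fun x => X x w)) gridr _ _ _;
  [apply: gL; exact: ltnW|exact: gL|exact: Lle].
Qed.

Lemma simple_lin_value s w :
  simple_value (simple_lin th H K) s w = simple_value H s w + th * simple_value K s w.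
Proof.
have [_ Hle _ _] := aH; have [_ Kle _ _] := aK.
rewrite (refined_value s w Hle gridH) (refined_value s w Kle gridK) mulr_sumr -big_split/=.
by apply: eq_bigr => j _; rewrite mulrDl mulrA.
Qed.

Lemma simple_lin_integral w :
  simple_integral X (simple_lin th H K) w = simple_integral X H w + th * simple_integral X K w.
Proof.
have [_ Hle _ _] := aH; have [_ Kle _ _] := aK.
rewrite (refined_integral w Hle gridH) (refined_integral w Kle gridK) mulr_sumr -big_split/=.
by apply: eq_bigr => j _; rewrite mulrDl mulrA.
Qed.

(** A cell of the refinement lies to the right of the times at which the coefficients
    that are active on it are known. *)
Lemma refined_measurable (L : @simple_process R d Om) j : simple_adapted T X L ->
  (forall i, (i <= sp_size L)%N -> on_grid r m (sp_time L i)) -> (j < m)%N ->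
  measurable_wrt (natural_filtration X (r j)) (simple_value L (r j.+1)).
Proof.
move=> [_ _ Lm _] gL jm; apply/measurable_wrtP.
rewrite /simple_value; apply: measurable_sum => i.
have [ti|it] := on_grid_cell gridr (gL i (ltnW (ltn_ord i))) jm.
  apply: measurable_funM => //; apply/measurable_wrtP.
  by apply: measurable_wrtS ti _; exact: Lm.
rewrite (_ : (fun w => _) = cst 0)//; apply/funext => w.
by rewrite indicE memNset ?mulr0//= in_itv/= ltNge it.
Qed.

Lemma simple_value_bounded (L : @simple_process R d Om) s : simple_adapted T X L ->
  exists M : R, forall w, `|simple_value L s w| <= M.
Proof.
move=> [_ _ _ Lb].
have [M MP] : exists M : nat -> R, forall i, (i < sp_size L)%N -> forall w, `|sp_coef L i w| <= M i.
  have : forall i, exists M : R, (i < sp_size L)%N -> forall w, `|sp_coef L i w| <= M.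
    move=> i; have [/Lb[M MP]|_] := ltnP i (sp_size L); first by exists M.
    by exists 0.
  by move=> /choice[M MP]; exists M.
exists (\sum_(i < sp_size L) M i) => w.
apply: le_trans (ler_norm_sum _ _ _) _; apply: ler_sum => i _.
rewrite normrM -[leRHS]mulr1 ler_pM//; first exact: MP.
by rewrite indicE; case: (_ \in _); rewrite ?normr1 ?normr0.
Qed.

Lemma simple_lin_adapted : simple_adapted T X (simple_lin th H K).
Proof.
split => [i im|i im|i im|i im].
- exact: in_time.
- exact: gridr.
- apply/measurable_wrtP; apply: measurable_funD.
    by apply/measurable_wrtP; exact: refined_measurable.
  apply: measurable_funM => //.
  by apply/measurable_wrtP; exact: refined_measurable.
- have [M1 h1] := simple_value_bounded (r i.+1) aH.
  have [M2 h2] := simple_value_bounded (r i.+1) aK.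
  exists (M1 + `|th| * M2) => w; rewrite (le_trans (ler_normD _ _))// lerD//.
  by rewrite normrM ler_wpM2l.
Qed.

End merge.

End merging_simple_processes.

(** * The exponential density of a simple process *)

Section weighted_time.
Context {R : realType}.
Variables (T : R) (sigma : R -> R).
Hypothesis sigma_meas : measurable_fun `[0, T] sigma.
Hypothesis sigma_L2 : (\int[lebesgue_measure]_(s in `[0%R, T])
   (sigma s ^+ 2)%:E < +oo)%E.
Local Notation leb := (@lebesgue_measure R).

(** The density of the clock, extended by 0 outside the time interval: integrals over
    [[0, T]] against $\sigma_s^2 ds$ become integrals over the line. *)
Definition clock_rate (s : R) : R := \1_(`[0, T] : set R) s * sigma s ^+ 2.

Lemma clock_rate_ge0 s : 0 <= clock_rate s.
Proof. by rewrite mulr_ge0 ?sqr_ge0. Qed.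

Lemma measurable_clock_rate : measurable_fun [set: measurableTypeR R] clock_rate.
Proof.
have mI : measurable (`[0, T] : set R) by exact: measurable_itv.
have : measurable_fun [set: measurableTypeR R] ((fun s => sigma s ^+ 2) \_ `[0, T]).
  by apply: (measurable_restrictT _ mI).1; exact: (measurable_funX 2 sigma_meas).
congr measurable_fun; apply/funext => s; rewrite patchE /clock_rate indicE.
by case: ifPn => _; rewrite ?mul1r ?mul0r.
Qed.

Lemma ereal_clock_rate (f : R -> R) :
  (\int[leb]_(s in `[0%R, T]) (f s * sigma s ^+ 2)%:E =
   \int[leb]_s (f s * clock_rate s)%:E)%E.
Proof.
rewrite integral_mkcond; apply: eq_integral => s _; rewrite patchE /clock_rate indicE.
by case: ifPn => _; rewrite ?mul1r ?mul0r ?mulr0.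
Qed.

Lemma Rintegral_clock_rate (f : R -> R) :
  \int[leb]_(s in `[0, T]) (f s * sigma s ^+ 2) = \int[leb]_s (f s * clock_rate s).
Proof. by rewrite /Rintegral ereal_clock_rate. Qed.

Lemma L1_clock_rate : leb.-integrable [set: R] (EFin \o clock_rate).
Proof.
apply: ge0_L1; [exact: measurable_clock_rate|exact: clock_rate_ge0|].
rewrite (_ : (\int[leb]_s _)%E =
    (\int[leb]_(s in `[0%R, T]) (sigma s ^+ 2)%:E)%E)//.
transitivity (\int[leb]_s (1 * clock_rate s)%:E)%E.
  by apply: eq_integral => s _; rewrite mul1r.
by rewrite -ereal_clock_rate; apply: eq_integral => s _; rewrite mul1r.
Qed.

Lemma L1_bounded_clock_rate (f : R -> R) M :
  measurable_fun [set: measurableTypeR R] f -> (forall s, `|f s| <= M) ->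
  leb.-integrable [set: R] (EFin \o (fun s => f s * clock_rate s)).
Proof.
move=> mf fM; apply: (@L1_le _ _ _ leb _ (fun s => M * clock_rate s)).
- by apply: measurable_funM => //; exact: measurable_clock_rate.
- move=> s; rewrite !normrM ler_wpM2r//.
  by rewrite (le_trans (fM s))// ler_norm.
- by apply: L1Z; exact: L1_clock_rate.
Qed.

Lemma clock_increment a b : 0 <= a -> a <= b -> b <= T ->
  \int[leb]_s (\1_(`]a, b] : set R) s * clock_rate s) = clock sigma b - clock sigma a.
Proof.
move=> a0 ab bT.
have Ib : leb.-integrable `[0, b] (EFin \o (fun s => sigma s ^+ 2)).
  apply: (@integrableS _ _ _ leb `[0, T] `[0, b]) => //.
    by apply: subset_itvl; rewrite bnd_simp.
  apply/integrableP; split.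
    by apply/measurable_EFinP; exact: measurable_funX.
  by under eq_integral do rewrite /= ger0_norm ?sqr_ge0//.
rewrite /clock (Rintegral_itvB Ib) ?bnd_simp//.
rewrite [RHS]Rintegral_mkcond; apply: eq_Rintegral => s _.
rewrite patchE /clock_rate !indicE; case: ifPn; last by rewrite mul0r.
rewrite inE/= in_itv/= => /andP[sa sb].
by rewrite mem_set ?mul1r//= in_itv/= (le_trans a0 (ltW sa)) (le_trans sb).
Qed.

End weighted_time.

Section simple_exponential.
Context {R : realType} {d : measure_display} {Om : measurableType d}.
Variables (P : probability Om R) (T : R) (sigma : R -> R) (X : R -> Om -> R).
Hypothesis hX : gaussian_with_clock P T sigma X.
Variable H : @simple_process R d Om.
Hypothesis aH : simple_adapted T X H.
Local Notation leb := (@lebesgue_measure R).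
Let n := sp_size H.
Let t := sp_time H.
Let c := sp_coef H.

Let t_le i j : (i <= j)%N -> (j <= n)%N -> t i <= t j.
Proof. by have [_ tS _ _] := aH; exact: (@grid_le _ t n). Qed.

Lemma simple_value_sqr s w : simple_value H s w ^+ 2 =
  \sum_(i < n) c i w ^+ 2 * \1_(`]t i, t i.+1] : set R) s.
Proof.
suff E k : (k <= n)%N -> (\sum_(i < k) c i w * \1_(`]t i, t i.+1] : set R) s) ^+ 2 =
    \sum_(i < k) c i w ^+ 2 * \1_(`]t i, t i.+1] : set R) s by exact: E.
elim: k => [|k IH] kn; first by rewrite !big_ord0 expr0n.
rewrite !big_ord_recr/= -IH; last exact: ltnW.
set S := \sum_(i < k) _; set I := \1_ _ _.
have II : I * I = I :> R by rewrite /I indicE; case: (_ \in _); rewrite ?mulr1 ?mulr0.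
have SI : S * I = 0.
  rewrite /S mulr_suml big1// => i _; rewrite /I !indicE.
  case: (boolP (s \in _)) => [|_]; last by rewrite mulr0 mul0r.
  rewrite inE/= in_itv/= => /andP[_ si]; rewrite memNset ?mulr0//= in_itv/=.
  by rewrite ltNge (le_trans si (t_le (ltn_ord i) (ltnW kn))).
rewrite sqrrD exprMn; congr (_ + _); last by rewrite [I ^+ 2]II.
by rewrite mulrCA SI mulr0 mul0rn addr0.
Qed.

Definition simple_energy w : R :=
  \int[leb]_s (simple_value H s w ^+ 2 * clock_rate T sigma s).

Lemma measurable_simple_value w : measurable_fun [set: measurableTypeR R]
  (fun s => simple_value H s w).
Proof.
by apply: measurable_sum => i; exact: measurable_funM.
Qed.

Let in_time i : (i <= n)%N -> 0 <= t i <= T.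
Proof. by have [h _ _ _] := aH; exact: h. Qed.

Let mS := gwc_sigma_meas hX.
Let S2 := gwc_sigma_L2 hX.

Lemma simple_energyE w : simple_energy w =
  \sum_(i < n) c i w ^+ 2 * (clock sigma (t i.+1) - clock sigma (t i)).
Proof.
have I1 i : leb.-integrable [set: R] (EFin \o (fun s =>
    \1_(`]t i, t i.+1] : set R) s * clock_rate T sigma s)).
  apply: (L1_bounded_clock_rate mS S2 (M := 1)).
    by apply: measurable_indic; exact: measurable_itv.
  by move=> s; rewrite indicE; case: (_ \in _); rewrite ?normr1 ?normr0.
rewrite /simple_energy; under eq_Rintegral do rewrite simple_value_sqr mulr_suml.
pose g k (s : R) := \sum_(i < k)
  c i w ^+ 2 * \1_(`]t i, t i.+1] : set R) s * clock_rate T sigma s.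
have g0 : g 0%N = cst 0 by apply/funext => s; rewrite /g big_ord0.
have gS k : g k.+1 = fun s => g k s +
    c k w ^+ 2 * (\1_(`]t k, t k.+1] : set R) s * clock_rate T sigma s).
  by apply/funext => s; rewrite /g big_ord_recr/=; congr (_ + _); rewrite [RHS]mulrA.
suff E k : (k <= n)%N -> leb.-integrable [set: R] (EFin \o g k) /\
    \int[leb]_s g k s =
    \sum_(i < k) c i w ^+ 2 * (clock sigma (t i.+1) - clock sigma (t i)).
  by have [_] := E n (leqnn n).
elim: k => [|k IH] kn.
  rewrite big_ord0 g0; split; first exact: integrable0.
  by rewrite /Rintegral integral0.
have [Ik Ek] := IH (ltnW kn).
have Ik1 : leb.-integrable [set: R] (EFin \o (fun s => c k w ^+ 2 *
    (\1_(`]t k, t k.+1] : set R) s * clock_rate T sigma s))) by exact: L1Z.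
rewrite gS; split; first exact: L1D.
rewrite RintD// Ek big_ord_recr/= RintZ//; congr (_ + _ * _).
have /andP[t0 _] := in_time (ltnW kn); have /andP[_ tT] := in_time kn.
by rewrite clock_increment// t_le.
Qed.

Lemma measurable_simple_energy : measurable_fun [set: Om] simple_energy.
Proof.
rewrite (_ : simple_energy = fun w => \sum_(i < n) c i w ^+ 2 *
    (clock sigma (t i.+1) - clock sigma (t i))); last first.
  by apply/funext => w; rewrite simple_energyE.
apply: measurable_sum => i; apply: measurable_funM => //; apply: measurable_funX.
have [_ _ cm _] := aH.
have /andP[_ tT] := in_time (ltnW (ltn_ord i)).
by apply: (measurable_wrt_measurable hX tT); exact: cm.
Qed.

Lemma measurable_simple_integral : measurable_fun [set: Om] (simple_integral X H).
Proof.
apply: measurable_sum => i; have [_ _ cm _] := aH.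
have t_ok := in_time (ltnW (ltn_ord i)); have tS_ok := in_time (ltn_ord i).
apply: measurable_funM.
  by have /andP[_ tT] := t_ok; apply: (measurable_wrt_measurable hX tT); exact: cm.
by apply: measurable_funB; exact: (gwc_measurable hX).
Qed.

(** Induction on the number of intervals: the last increment is integrated out given
    the past. *)
Lemma simple_exponential :
  (\int[P]_w (expR (simple_integral X H w - simple_energy w / 2))%:E = 1)%E.
Proof.
pose z k w := \sum_(i < k) (c i w * (X (t i.+1) w - X (t i) w) -
  c i w ^+ 2 * (clock sigma (t i.+1) - clock sigma (t i)) / 2).
have [_ _ cm _] := aH.
have zm k : (k <= n)%N -> measurable_wrt (natural_filtration X (t k)) (z k).
  move=> kn; apply/measurable_wrtP; apply: measurable_sum => i.
  have ci : measurable_fun [set: past_type X (t k)] (c i : past_type X (t k) -> R).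
    apply/measurable_wrtP; apply: (measurable_wrtS _ (cm i _)).
      by apply: t_le => //; exact: ltnW.
    exact: leq_trans (ltn_ord i) kn.
  have Xm j : (j <= k)%N -> measurable_fun [set: past_type X (t k)] (X (t j) : past_type X (t k) -> R).
    move=> jk; apply/measurable_wrtP; apply: measurable_wrt_process.
    by have /andP[-> _] := in_time (leq_trans jk kn); rewrite /= t_le.
  apply: measurable_funB.
    apply: measurable_funM => //; apply: measurable_funB; apply: Xm => //.
    exact: ltnW.
  by apply: measurable_funM => //; apply: measurable_funM => //; exact: measurable_funX.
suff E k : (k <= n)%N -> (\int[P]_w (expR (z k w))%:E = 1)%E.
  rewrite -[RHS](E n (leqnn n)); apply: eq_integral => w _; congr (expR _)%:E.
  by rewrite simple_energyE /z big_split/= sumrN -mulr_suml.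
elim: k => [|k IH] kn.
  transitivity (\int[P]_w (1%:E : \bar R))%E.
    by apply: eq_integral => w _; rewrite /z big_ord0 expR0.
  by rewrite L1_EFin ?Rint_cst//; exact: L1_cst.
have /andP[t0 _] := in_time (ltnW kn); have /andP[_ tT] := in_time kn.
rewrite -(IH (ltnW kn)) -(expR_increment_step hX t0 (t_le (leqnSn k) kn) tT
  (zm k (ltnW kn)) (cm k kn)).
by apply: eq_integral => w _; rewrite /z big_ord_recr/= addrA.
Qed.

End simple_exponential.

(** * Almost everywhere limits and weighted squares *)

Section almost_everywhere_limits.
Context d (T : measurableType d) (R : realType) (mu : {measure set T -> \bar R}).
Local Open Scope ereal_scope.

Lemma limn_einf_EFin (c_ : nat -> R) (c : R) : c_ n @[n --> \oo] --> c ->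
  limn_einf (fun n => (c_ n)%:E) = c%:E.
Proof.
move=> h; have h' : (c_ n)%:E @[n --> \oo] --> c%:E.
  by apply/fine_cvgP; split; [exact: nearW|exact: h].
rewrite is_cvg_limn_einfE; first exact: cvg_lim.
by apply/cvg_ex; exists c%:E.
Qed.

(** On the exceptional null set [f] is arbitrary, so the classical lemma is applied to
    the lower limit. *)
Lemma fatou_ae (f_ : nat -> T -> R) (f : T -> R) (C_ : nat -> R) (C : R) :
  (forall n, measurable_fun [set: T] (f_ n)) -> measurable_fun [set: T] f ->
  (forall n x, (0 <= f_ n x)%R) -> (forall x, (0 <= f x)%R) ->
  {ae mu, forall x, f_ n x @[n --> \oo] --> f x} ->
  (forall n, \int[mu]_x (f_ n x)%:E <= (C_ n)%:E) -> C_ n @[n --> \oo] --> C ->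
  \int[mu]_x (f x)%:E <= C%:E.
Proof.
move=> mf_ mf f_0 f0 cvgf leC cvgC.
have mEf_ n : measurable_fun [set: T] (EFin \o f_ n) by exact/measurable_EFinP.
have lim0 x : 0 <= limn_einf (fun n => (f_ n x)%:E).
  rewrite limn_einf_lim; apply: lime_ge; first exact: is_cvg_einfs.
  apply: nearW => n; apply: le_ereal_inf_tmp => _ [m /= nm <-].
  by rewrite lee_fin.
apply: (@le_trans _ _ (\int[mu]_x limn_einf (fun n => (f_ n x)%:E))).
  rewrite le_eqVlt; apply/orP; left; apply/eqP.
  apply: ge0_ae_eq_integral => //.
  - exact/measurable_EFinP.
  - rewrite (_ : (fun x => _) = fun x => - limn_esup (fun n => - (f_ n x)%:E)).
      apply: measurableT_comp => //; apply: measurable_fun_limn_esup => n.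
      by apply: measurableT_comp => //; exact: mEf_.
    by apply/funext => x; rewrite (limn_esupN (fun n => (f_ n x)%:E)) oppeK.
  - by move=> x _; rewrite lee_fin.
  - apply: filterS cvgf => x fx _; by rewrite (limn_einf_EFin fx).
apply: le_trans (fatou _ measurableT mEf_ _) _.
  by move=> n x _; rewrite lee_fin.
rewrite -(limn_einf_EFin cvgC) 2!limn_einf_lim.
apply: lee_lim; [exact: is_cvg_einfs|exact: is_cvg_einfs|].
apply: nearW => n; apply: le_ereal_inf_tmp => _ [m /= nm <-].
apply: le_trans (leC m); apply: ereal_inf_lbound.
by exists m.
Qed.

Lemma ae_nneseries_lty (phi : nat -> T -> \bar R) (c : R) :
  (forall n, measurable_fun [set: T] (phi n)) -> (forall n x, 0 <= phi n x) ->
  (forall n, \int[mu]_x phi n x <= (c / (2 ^ (n + 1))%:R)%:E) ->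
  {ae mu, forall x, \sum_(0 <= k <oo) phi k x < +oo}.
Proof.
move=> mphi phi0 le_c.
have mS : measurable_fun [set: T] (fun x => \sum_(k <oo) phi k x).
  exact: ge0_emeasurable_sum.
have IS : \int[mu]_x (\sum_(k <oo) phi k x) < +oo.
  rewrite integral_nneseries//.
  apply: (@le_lt_trans _ _ (\sum_(k <oo) ((c / (2 ^ (k + 1))%:R)%R : R)%:E)).
    apply: lee_nneseries => [n _ _|n _]; last exact: le_c.
    by rewrite integral_ge0.
  by rewrite (cvg_lim _ (@cvg_geometric_eseries_half R c 0))// ltry.
have iS : mu.-integrable [set: T] (fun x => \sum_(k <oo) phi k x).
  apply/integrableP; split => //.
  by under eq_integral do rewrite gee0_abs ?nneseries_ge0//.
apply: filterS (integrable_ae measurableT iS) => x /(_ I) finS.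
by rewrite -ge0_fin_numE// nneseries_ge0.
Qed.

(** A subsequence whose integrals are summable converges almost everywhere. *)
Lemma ae_cvg_subsequence (phi : nat -> T -> \bar R) :
  (forall n, measurable_fun [set: T] (phi n)) -> (forall n x, 0 <= phi n x) ->
  \int[mu]_x phi n x @[n --> \oo] --> 0 ->
  exists N : nat -> nat, {ae mu, forall x, phi (N k) x @[k --> \oo] --> 0}.
Proof.
move=> mphi phi0 cvg0.
have /choice[N NP] : forall k, exists n, \int[mu]_x phi n x <= ((1 / (2 ^ (k + 1))%:R)%R : R)%:E.
  move=> k; have /fine_cvgP[fin_i /cvgrPdist_le] := cvg0.
  have e0 : (0 < 1 / (2 ^ (k + 1))%:R :> R)%R by rewrite divr_gt0// ltr0n expn_gt0.
  move=> /(_ _ e0) near_i.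
  have [n [fin le]] := filter_ex (filterI fin_i near_i).
  exists n; rewrite -(fineK fin) lee_fin; move: le.
  by rewrite sub0r normrN /= ger0_norm// fine_ge0// integral_ge0.
exists N.
apply: filterS (ae_nneseries_lty (fun k => mphi (N k)) (fun k => phi0 (N k)) NP) => x lty.
have tail := nneseries_tail_cvg lty (fun k _ => phi0 (N k) x).
apply: (squeeze_cvge _ _ tail); last exact: cvg_cst.
apply: nearW => k; rewrite phi0/=.
rewrite (@nneseries_split _ _ k 1)// addn1 big_nat1 leeDl//.
by rewrite nneseries_ge0.
Qed.

(** For every $\eta > 0$, $|x^2 - y^2| \leq \eta y^2 + (1 + 1/\eta)(x - y)^2$. *)
Lemma cvg_weighted_square (rho f : T -> R) (f_ : nat -> T -> R) :
  measurable_fun [set: T] rho -> (forall x, 0 <= rho x)%R ->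
  (forall n, measurable_fun [set: T] (f_ n)) -> measurable_fun [set: T] f ->
  mu.-integrable [set: T] (EFin \o (fun x => (f x ^+ 2 * rho x)%R)) ->
  (forall n, mu.-integrable [set: T] (EFin \o (fun x => (f_ n x ^+ 2 * rho x)%R))) ->
  (\int[mu]_x ((f_ n x - f x) ^+ 2 * rho x)%R @[n --> \oo] --> (0 : R))%R ->
  (\int[mu]_x (f_ n x ^+ 2 * rho x)%R @[n --> \oo] --> \int[mu]_x (f x ^+ 2 * rho x)%R)%R.
Proof.
move=> mrho rho0 mf_ mf If If_ cvg0.
set A := (\int[mu]_x (f x ^+ 2 * rho x))%R.
have A0 : (0 <= A)%R.
  by apply: Rintegral_ge0 => x _; rewrite mulr_ge0 ?sqr_ge0.
pose e n := (\int[mu]_x ((f_ n x - f x) ^+ 2 * rho x))%R.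
have Ie n : mu.-integrable [set: T] (EFin \o (fun x => ((f_ n x - f x) ^+ 2 * rho x)%R)).
  apply: (@L1_le _ _ _ _ _ (fun x => 2 * (f_ n x ^+ 2 * rho x) + 2 * (f x ^+ 2 * rho x))%R).
  - by apply: measurable_funM => //; apply: measurable_funX; exact: measurable_funB.
  - move=> x; have sq0 y : (0 <= y ^+ 2 * rho x)%R by rewrite mulr_ge0 ?sqr_ge0.
    rewrite (ger0_norm (sq0 _)) ger0_norm ?addr_ge0 ?(mulr_ge0 _ (sq0 _))//.
    rewrite !mulrA -mulrDl ler_wpM2r//.
    by have := sqr_ge0 (f_ n x + f x); lra.
  - by apply: L1D; exact: L1Z.
have key n (eta : R) : (0 < eta)%R ->
    (`|\int[mu]_x (f_ n x ^+ 2 * rho x)%R - A| <= eta * A + (1 + eta^-1) * e n)%R.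
  move=> eta0.
  rewrite -RintB// -!RintZ// -RintD//; last 2 first.
    exact: L1Z.
    exact: L1Z.
  apply: le_trans (le_normr_Rintegral measurableT _) _; first exact: L1B.
  apply: le_Rint.
  - by have := integrable_abse (L1B (If_ n) If); apply: eq_integrable => // x _.
  - by apply: L1D; exact: L1Z.
  move=> x; rewrite -mulrBl normrM (ger0_norm (rho0 x)) !mulrA -mulrDl ler_wpM2r//.
  set a := f_ n x; set b := f x.
  have h : (0 <= eta^-1 * (eta * b - (a - b)) ^+ 2)%R.
    by rewrite mulr_ge0 ?invr_ge0 ?sqr_ge0// ltW.
  have h' : (0 <= eta^-1 * (eta * b + (a - b)) ^+ 2)%R.
    by rewrite mulr_ge0 ?invr_ge0 ?sqr_ge0// ltW.
  have e1 : (eta^-1 * (eta * b - (a - b)) ^+ 2 =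
    eta * b ^+ 2 - 2 * b * (a - b) + eta^-1 * (a - b) ^+ 2)%R.
    by field; rewrite gt_eqF.
  have e2 : (eta^-1 * (eta * b + (a - b)) ^+ 2 =
    eta * b ^+ 2 + 2 * b * (a - b) + eta^-1 * (a - b) ^+ 2)%R.
    by field; rewrite gt_eqF.
  rewrite e1 in h; rewrite e2 in h'.
  have sq := sqr_ge0 (a - b).
  by rewrite ler_norml; apply/andP; split; lra.
apply/cvgrPdist_le => eps eps0.
pose eta := (eps / (2 * (A + 1)))%R.
have A1 : (0 < A + 1)%R by rewrite ltr_wpDl.
have eta0 : (0 < eta)%R by rewrite divr_gt0// mulr_gt0.
have del0 : (0 < eps / 2 / (1 + eta^-1))%R.
  by rewrite !divr_gt0// addr_gt0// invr_gt0.
move/cvgrPdist_le: cvg0 => /(_ _ del0); apply: filterS => n.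
rewrite sub0r normrN distrC ger0_norm; last first.
  by apply: Rintegral_ge0 => x _; rewrite mulr_ge0 ?sqr_ge0.
rewrite -/(e n) ler_pdivlMr ?addr_gt0 ?invr_gt0// => en.
apply: le_trans (key n eta eta0) _.
have : (eta * A <= eps / 2)%R.
  rewrite /eta invfM mulrA -mulrA ler_piMr// ?divr_ge0 ?ltW//.
  by rewrite mulrC ltr_pdivrMr// mul1r ltrDl.
by move: en; rewrite mulrC; lra.
Qed.

End almost_everywhere_limits.

Section weighted_L2.
Context d (T : measurableType d) (R : realType) (mu : {measure set T -> \bar R}).
Variable rho : T -> R.
Hypotheses (mrho : measurable_fun [set: T] rho) (rho0 : forall x, 0 <= rho x).
Local Notation L1 f := (mu.-integrable [set: T] (EFin \o f)).
Variables (f g : T -> R) (th : R).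
Hypotheses (mf : measurable_fun [set: T] f) (mg : measurable_fun [set: T] g).
Hypotheses (If : L1 (fun x => f x ^+ 2 * rho x)) (Ig : L1 (fun x => g x ^+ 2 * rho x)).

Lemma weighted_mul_L1 : L1 (fun x => f x * g x * rho x).
Proof.
apply: L1_le (L1D If Ig); first by apply: measurable_funM => //; exact: measurable_funM.
move=> x; rewrite -mulrDl !normrM ler_wpM2r// -normrM.
rewrite [leRHS]ger0_norm ?addr_ge0 ?sqr_ge0// ler_norml.
by apply/andP; split; have := sqr_ge0 (f x + g x); have := sqr_ge0 (f x - g x); nra.
Qed.

Let expand : (fun x => (f x + th * g x) ^+ 2 * rho x) =
  fun x => f x ^+ 2 * rho x + (2 * th * (f x * g x * rho x) + th ^+ 2 * (g x ^+ 2 * rho x)).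
Proof. by apply/funext => x; ring. Qed.

Lemma weighted_lin_L2 : L1 (fun x => (f x + th * g x) ^+ 2 * rho x).
Proof.
rewrite expand; apply: L1D => //; apply: L1D; apply: L1Z => //.
exact: weighted_mul_L1.
Qed.

Lemma weighted_square_expand : \int[mu]_x ((f x + th * g x) ^+ 2 * rho x) =
  \int[mu]_x (f x ^+ 2 * rho x) + 2 * th * \int[mu]_x (f x * g x * rho x) +
  th ^+ 2 * \int[mu]_x (g x ^+ 2 * rho x).
Proof.
have I1 : L1 (fun x => 2 * th * (f x * g x * rho x)) by apply: L1Z; exact: weighted_mul_L1.
have I2 : L1 (fun x => th ^+ 2 * (g x ^+ 2 * rho x)) by exact: L1Z.
rewrite expand RintD//; last exact: L1D.
by rewrite RintD// !RintZ ?addrA//; exact: weighted_mul_L1.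
Qed.

Lemma weighted_square_le : \int[mu]_x ((f x + th * g x) ^+ 2 * rho x) <=
  2 * \int[mu]_x (f x ^+ 2 * rho x) + 2 * th ^+ 2 * \int[mu]_x (g x ^+ 2 * rho x).
Proof.
rewrite -!RintZ// -RintD//; [|exact: L1Z|exact: L1Z].
apply: le_Rint; [exact: weighted_lin_L2|by apply: L1D; exact: L1Z|move=> x].
rewrite !mulrA -mulrDl ler_wpM2r//.
by have := sqr_ge0 (f x - th * g x); nra.
Qed.

End weighted_L2.

Lemma cvg_sqr_dist (R : realType) (u : nat -> R) (l : R) :
  (u n - l) ^+ 2 @[n --> \oo] --> 0 -> u n @[n --> \oo] --> l.
Proof.
move=> /cvgrPdist_lt h; apply/cvgrPdist_lt => e e0.
have e20 : 0 < e ^+ 2 by rewrite exprn_gt0.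
apply: filterS (h _ e20) => n; rewrite sub0r normrN ger0_norm ?sqr_ge0// distrC.
by rewrite -(real_normK (num_real (u n - l))) ltr_pXn2r ?nnegrE// ltW.
Qed.

Lemma ae_exists d (T : measurableType d) (R : realType) (P : probability T R)
  (A : T -> Prop) : {ae P, forall x, A x} -> exists x, A x.
Proof.
move=> [B [mB B0 AB]]; apply: contrapT => noA.
have BT : B = setT.
  by apply/seteqP; split => // x _; apply: AB => /= Ax; apply: noA; exists x.
by move: B0; rewrite BT probability_setT => /eqP; rewrite onee_eq0.
Qed.

Section simple_value_L2.
Context {R : realType} {d : measure_display} {Om : measurableType d}.
Variable H : @simple_process R d Om.

Lemma simple_value_le s w :
  `|simple_value H s w| <= \sum_(i < sp_size H) `|sp_coef H i w|.
Proof.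
apply: le_trans (ler_norm_sum _ _ _) _; apply: ler_sum => i _.
rewrite normrM -[leRHS]mulr1 ler_pM// indicE.
by case: (_ \in _); rewrite ?normr1 ?normr0.
Qed.

Lemma simple_value_L2 (T : R) (sigma : R -> R) (w : Om) : measurable_fun `[0, T] sigma ->
  (\int[lebesgue_measure]_(s in `[0%R, T]) (sigma s ^+ 2)%:E < +oo)%E ->
  (@lebesgue_measure R).-integrable [set: R]
    (EFin \o (fun s => simple_value H s w ^+ 2 * clock_rate T sigma s)).
Proof.
move=> mS S2.
apply: (L1_bounded_clock_rate mS S2 (M := (\sum_(i < sp_size H) `|sp_coef H i w|) ^+ 2)).
  by apply: measurable_funX; exact: measurable_simple_value.
move=> s; rewrite normrX lerXn2r ?nnegrE ?simple_value_le//.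
exact: sumr_ge0.
Qed.

End simple_value_L2.

(** * Jointly measurable processes *)

Section process_measurability.
Context {R : realType} {d : measure_display} {Om : measurableType d}.
Variables (P : probability Om R) (T : R) (sigma : R -> R).
Hypothesis sigma_meas : measurable_fun `[0, T] sigma.
Local Notation leb := (@lebesgue_measure R).
Local Notation rho := (clock_rate T sigma).
Implicit Types (Y : R -> Om -> R) (H : @simple_process R d Om).

(** Measurability on the whole product, with the process cut off outside [[0, T]], so
    that Tonelli's theorem applies without restriction to a subset. *)
Definition jointly_measurable Y := measurable_fun [set: Om * measurableTypeR R]
  (fun z => Y z.2 z.1 * \1_(`[0, T] : set R) z.2).

Lemma measurable_processP Y : measurable_process T Y <-> jointly_measurable Y.
Proof.
have mD : measurable ([set: Om] `*` (`[0, T] : set (measurableTypeR R))).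
  by apply: measurableX => //; exact: measurable_itv.
have E : (fun z : Om * measurableTypeR R => Y z.2 z.1 * \1_(`[0, T] : set R) z.2) =
    (fun z : Om * measurableTypeR R => Y z.2 z.1) \_ ([set: Om] `*` `[0, T]).
  apply/funext => z; rewrite patchE indicE.
  rewrite (_ : (z \in _) = (z.2 \in `[0, T]%classic)).
    by case: ifPn; rewrite ?mulr1 ?mulr0.
  by apply/idP/idP; rewrite !inE/=; [case|].
rewrite /jointly_measurable E; split=> h.
  exact: (measurable_restrictT _ mD).1.
exact: (measurable_restrictT _ mD).2.
Qed.

Lemma clock_rate_indic s : \1_(`[0, T] : set R) s * rho s = rho s.
Proof.
rewrite /clock_rate mulrA; congr (_ * _).
by rewrite indicE; case: (_ \in _); rewrite ?mulr1 ?mulr0.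
Qed.

Lemma sqr_clock_rate (y : R) s : (y * \1_(`[0, T] : set R) s) ^+ 2 * rho s = y ^+ 2 * rho s.
Proof.
by rewrite exprMn -mulrA [X in _ * (X * _)]expr2 -[X in _ * X]mulrA !clock_rate_indic.
Qed.

Let mrho := measurable_clock_rate sigma_meas.

Let joint_sqr Y : jointly_measurable Y -> measurable_fun [set: Om * measurableTypeR R]
  (fun z => (Y z.2 z.1 ^+ 2 * rho z.2)%:E).
Proof.
move=> mY; apply/measurable_EFinP.
under eq_fun do rewrite -sqr_clock_rate.
by apply: measurable_funM; [exact: measurable_funX|exact: measurableT_comp].
Qed.

Lemma measurable_energy Y : jointly_measurable Y ->
  measurable_fun [set: Om] (fun w => \int[leb]_s (Y s w ^+ 2 * rho s)%:E)%E.
Proof.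
move=> mY; apply: (@measurable_fun_fubini_tonelli_F _ _ _ _ _ leb _ (joint_sqr mY)).
by move=> z; rewrite lee_fin mulr_ge0 ?sqr_ge0 ?clock_rate_ge0.
Qed.

Lemma measurable_Renergy Y : jointly_measurable Y ->
  measurable_fun [set: Om] (fun w => \int[leb]_s (Y s w ^+ 2 * rho s)).
Proof.
by move=> mY; apply: measurableT_comp (measurable_energy mY); exact: fine_measurable.
Qed.

Lemma measurable_section Y w : jointly_measurable Y ->
  measurable_fun [set: measurableTypeR R] (fun s => Y s w * \1_(`[0, T] : set R) s).
Proof. by move=> mY; exact: (measurableT_comp mY (measurable_pair1 w)). Qed.

Lemma jointly_measurable_lin th Y Z : jointly_measurable Y -> jointly_measurable Z ->
  jointly_measurable (fun s w => Y s w + th * Z s w).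
Proof.
move=> mY mZ; rewrite /jointly_measurable; under eq_fun do rewrite mulrDl -mulrA.
by apply: measurable_funD => //; exact: measurable_funM.
Qed.

Lemma jointly_measurable_cst (h : R -> R) :
  measurable_fun [set: measurableTypeR R] h -> jointly_measurable (fun s _ => h s).
Proof.
move=> mh; apply: measurable_funM; apply: measurableT_comp => //.
Qed.

Lemma jointly_measurable_simple X H : gaussian_with_clock P T sigma X ->
  simple_adapted T X H -> jointly_measurable (simple_value H).
Proof.
move=> hX [tT _ cm _]; apply: measurable_funM; last exact: measurableT_comp.
apply: measurable_sum => i; apply: measurable_funM; last exact: measurableT_comp.
apply: measurableT_comp => //.
have /andP[_ ti] := tT i (ltnW (ltn_ord i)).
by apply: (measurable_wrt_measurable hX ti); exact: cm.
Qed.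

End process_measurability.

(** * Shifting an integrand in a deterministic direction *)

Section tilting.
Context d (Om : measurableType d) (R : realType) (P : probability Om R).
Local Notation L1 f := (P.-integrable [set: Om] (EFin \o f)).

(** The densities $e^{U_i}$ with index [n] all have mass one and satisfy
    $e^{U_2 + \kappa} e^{U_0} = e^{2 U_1}$.  Hence
    $\delta e^\kappa e^{U_2} + e^{U_0} / (4 \delta) - e^{U_1} \geq 0$, and Fatou's
    lemma for this combination shows that the limit of the masses of $e^{U_1}$
    exceeds the mass of the limit by at most $\delta e^\kappa$, because the mass of
    $e^{U_0}$ is preserved by hypothesis.  Finally $\delta$ tends to 0. *)
Lemma exponential_tilt (U_ : nat -> nat -> Om -> R) (U : nat -> Om -> R)
    (kappa_ : nat -> R) (kappa : R) :
  (forall i n, measurable_fun [set: Om] (U_ i n)) ->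
  (forall i, measurable_fun [set: Om] (U i)) ->
  (forall i n, (\int[P]_w (expR (U_ i n w))%:E = 1)%E) ->
  (forall n w, U_ 2 n w = 2 * U_ 1 n w - U_ 0 n w - kappa_ n) ->
  kappa_ n @[n --> \oo] --> kappa ->
  {ae P, forall w, forall i, U_ i n w @[n --> \oo] --> U i w} ->
  (\int[P]_w (expR (U 0 w))%:E = 1)%E ->
  (\int[P]_w (expR (U 1 w))%:E = 1)%E.
Proof.
move=> mU_ mU EU_ UE cvgk cvgU E0.
have mexp (f : Om -> R) : measurable_fun [set: Om] f -> measurable_fun [set: Om] (fun w => expR (f w)).
  by move=> mf; exact: measurableT_comp.
have cvge (f : nat -> R) (l : R) : f n @[n --> \oo] --> l -> expR (f n) @[n --> \oo] --> expR l.
  by move=> fl; apply: (cvg_comp _ _ fl); exact: continuous_expR.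
have le1 i : (\int[P]_w (expR (U i w))%:E <= 1%:E)%E.
  apply: (@fatou_ae _ _ _ P (fun n w => expR (U_ i n w)) _ (fun=> 1) 1).
  - by move=> n; exact: mexp.
  - exact: mexp.
  - by move=> n w; exact: expR_ge0.
  - by move=> w; exact: expR_ge0.
  - by apply: filterS cvgU => w /(_ i); exact: cvge.
  - by move=> n; rewrite EU_.
  - exact: cvg_cst.
have IU i : L1 (fun w => expR (U i w)).
  by apply: ge0_L1 => //; [exact: mexp|rewrite (le_lt_trans (le1 i))// ltry].
have IU_ i n : L1 (fun w => expR (U_ i n w)).
  by apply: ge0_L1 => //; [exact: mexp|rewrite EU_ ltry].
have R0 : \int[P]_w expR (U 0 w) = 1 by exact: Rintegral_EFin.
have R_ i n : \int[P]_w expR (U_ i n w) = 1 by exact: Rintegral_EFin.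
pose m i := \int[P]_w expR (U i w).
have m0 i : 0 <= m i by apply: Rintegral_ge0 => w _; exact: expR_ge0.
have U2E : {ae P, forall w, U 2 w = 2 * U 1 w - U 0 w - kappa}.
  apply: filterS cvgU => w cw.
  have c2 : U_ 2 n w @[n --> \oo] --> 2 * U 1 w - U 0 w - kappa.
    under eq_fun do rewrite UE.
    by apply: cvgB => //; apply: cvgB => //; apply: cvgM => //; exact: cvg_cst.
  by apply: (cvg_unique _ (cw 2) c2).
pose V_ del n w := del * expR (kappa_ n) * expR (U_ 2 n w) + (4 * del)^-1 * expR (U_ 0 n w) - expR (U_ 1 n w).
pose V del w := del * expR kappa * expR (U 2 w) + (4 * del)^-1 * expR (U 0 w) - expR (U 1 w).
(* up to a positive factor, a perfect square *)
have sq (del : R) (k a b : R) : 0 < del ->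
    0 <= del * expR k * expR (2 * b - a - k) + (4 * del)^-1 * expR a - expR b.
  move=> d0.
  have -> : del * expR k * expR (2 * b - a - k) + (4 * del)^-1 * expR a - expR b =
      del * expR a * (expR (b - a) - (2 * del)^-1) ^+ 2.
    have -> : expR b = expR a * expR (b - a) by rewrite -expRD; congr expR; ring.
    rewrite -[X in X + _ - _]mulrA -expRD.
    have -> : k + (2 * b - a - k) = a + (b - a) + (b - a) by ring.
    by rewrite !expRD; field; rewrite gt_eqF.
  by rewrite mulr_ge0 ?sqr_ge0// mulr_ge0 ?expR_ge0// ltW.
have key (del : R) : 0 < del -> 1 <= m 1 + del * expR kappa.
  move=> d0.
  have IVt : L1 (V del).
    by apply: L1B => //; apply: L1D; exact: L1Z.
  have IV_ n : L1 (V_ del n).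
    by apply: L1B => //; apply: L1D; exact: L1Z.
  have : (\int[P]_w (Num.max 0 (V del w))%:E <=
      (del * expR kappa + (4 * del)^-1 - 1)%:E)%E.
    apply: (@fatou_ae _ _ _ P (V_ del) _
        (fun n => del * expR (kappa_ n) + (4 * del)^-1 - 1)).
    - by move=> n; have := IV_ n; exact: L1_measurable.
    - by apply: measurable_maxr => //; exact: L1_measurable IVt.
    - by move=> n w; rewrite /V_ UE; exact: sq.
    - by move=> w; rewrite le_max lexx.
    - have : {ae P, forall w, 0 <= V del w}.
        by apply: filterS U2E => w e; rewrite /V e; exact: sq.
      move=> V0; apply: filterS2 cvgU V0 => w cw V0.
      rewrite (max_r V0); apply: cvgB; last exact: cvge.
      apply: cvgD; apply: cvgM; [|exact: cvge|exact: cvg_cst|exact: cvge].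
      by apply: cvgM; [exact: cvg_cst|exact: cvge].
    - move=> n; rewrite (L1_EFin (IV_ n)) RintB//; last by apply: L1D; exact: L1Z.
      by rewrite RintD; [rewrite !RintZ// !R_ !mulr1|exact: L1Z|exact: L1Z].
    - apply: cvgB; last exact: cvg_cst.
      apply: cvgD; last exact: cvg_cst.
      by apply: cvgM; [exact: cvg_cst|exact: cvge].
  have le_max_int : ((\int[P]_w V del w)%:E <= \int[P]_w (Num.max 0 (V del w))%:E)%E.
    have Imax : L1 (fun w => Num.max 0 (V del w)).
      apply: (L1_le _ _ IVt); first by apply: measurable_maxr => //; exact: L1_measurable IVt.
      by move=> w; rewrite maxEle; case: ifP => // _; rewrite normr0.
    rewrite (L1_EFin Imax) lee_fin; apply: le_Rint => // w.
    by rewrite le_max lexx orbT.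
  move=> /(le_trans le_max_int); rewrite lee_fin.
  rewrite RintB//; last by apply: L1D; exact: L1Z.
  rewrite RintD; [|exact: L1Z|exact: L1Z].
  rewrite !RintZ// R0 mulr1 -/(m 1) -/(m 2) => h.
  have : 0 <= del * expR kappa * m 2 by rewrite !mulr_ge0 ?expR_ge0// ltW.
  by lra.
apply/eqP; rewrite eq_le le1/= L1_EFin// lee_fin -/(m 1).
rewrite leNgt; apply/negP => lt1.
have := key ((1 - m 1) / 2 / expR kappa).
rewrite divfK ?gt_eqF ?expR_gt0// divr_gt0 ?expR_gt0 ?divr_gt0 ?subr_gt0// => /(_ isT).
by lra.
Qed.

End tilting.

Section girsanov_shift.
Context {R : realType} {d : measure_display} {Om : measurableType d}.
Variables (P : probability Om R) (T : R) (sigma : R -> R) (X : R -> Om -> R).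
Hypothesis hX : gaussian_with_clock P T sigma X.
Local Notation leb := (@lebesgue_measure R).
Local Notation rho := (clock_rate T sigma).

(** The Ito integral of a deterministic integrand, approximated by deterministic simple
    processes: the distance to [h] then needs no expectation. *)
Definition is_wiener_integral (h : R -> R) (J : Om -> R) : Prop :=
  measurable_fun [set: Om] J /\
  exists2 K : nat -> @simple_process R d Om,
    (forall n, simple_adapted T X (K n)) /\
    (forall n s w w', simple_value (K n) s w = simple_value (K n) s w') &
    ((forall w, \int[leb]_s ((simple_value (K n) s w - h s) ^+ 2 * rho s)
        @[n --> \oo] --> 0) /\
     (fun n => \int[P]_w ((simple_integral X (K n) w - J w) ^+ 2)%:E)%E
        @ \oo --> 0%E).

Variables (a : R -> Om -> R) (I : Om -> R) (h : R -> R) (J : Om -> R) (M : R).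
Hypotheses (ma : measurable_process T a)
  (mh : measurable_fun [set: measurableTypeR R] h) (hM : forall s, `|h s| <= M).
Hypothesis energy_a : (\int[P]_w \int[leb]_s (a s w ^+ 2 * rho s)%:E < +oo)%E.
Hypotheses (itoI : is_ito_integral P T sigma X a I)
  (wienerJ : is_wiener_integral h J).

Let mS := gwc_sigma_meas hX.
Let S2 := gwc_sigma_L2 hX.
Let mrho := measurable_clock_rate mS.
Let rho0 s : 0 <= rho s. Proof. exact: clock_rate_ge0. Qed.

Let hL2 : leb.-integrable [set: R] (EFin \o (fun s => h s ^+ 2 * rho s)).
Proof.
apply: (L1_bounded_clock_rate mS S2 (M := M ^+ 2)); first exact: measurable_funX.
by move=> s; rewrite normrX lerXn2r ?nnegrE// (le_trans (normr_ge0 _) (hM 0)).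
Qed.

Let ja : jointly_measurable T a. Proof. exact/measurable_processP. Qed.
Let jh : @jointly_measurable R d Om T (fun s _ => h s).
Proof. exact: jointly_measurable_cst. Qed.

(** The logarithm of the Girsanov density of the integrand [a + th * h], when [I] and
    [J] are the integrals of [a] and [h]. *)
Definition shifted_log_density (th : R) (w : Om) : R :=
  I w + th * J w - (\int[leb]_s ((a s w + th * h s) ^+ 2 * rho s)) / 2.

Lemma measurable_shifted_log_density th :
  measurable_fun [set: Om] (shifted_log_density th).
Proof.
have [mI _] := itoI; have [mJ _] := wienerJ.
apply: measurable_funB; first by apply: measurable_funD => //; exact: measurable_funM.
apply: measurable_funM => //; apply: (measurable_Renergy mS).
exact: jointly_measurable_lin.
Qed.

Lemma energy_finite_ae : {ae P, forall w,
  leb.-integrable [set: R] (EFin \o (fun s => a s w ^+ 2 * rho s))}.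
Proof.
have me := measurable_energy mS ja.
have e0 w : (0 <= \int[leb]_s (a s w ^+ 2 * rho s)%:E)%E.
  by apply: integral_ge0 => s _; rewrite lee_fin mulr_ge0 ?sqr_ge0.
have Ie : P.-integrable [set: Om] (fun w => \int[leb]_s (a s w ^+ 2 * rho s)%:E)%E.
  by apply/integrableP; split => //; under eq_integral do rewrite gee0_abs//.
apply: filterS (integrable_ae measurableT Ie) => w /(_ Logic.I) fin.
apply: ge0_L1.
- under eq_fun do rewrite -sqr_clock_rate.
  by apply: measurable_funM => //; apply: measurable_funX; exact: measurable_section.
- by move=> s; rewrite mulr_ge0 ?sqr_ge0.
- by rewrite -ge0_fin_numE.
Qed.

(** The four convergences are realized along one subsequence, extracted for the sum of
    the four distances. *)
Lemma simple_approximation : exists Ka Kh : nat -> @simple_process R d Om,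
  [/\ forall n, simple_adapted T X (Ka n), forall n, simple_adapted T X (Kh n),
      forall n s w w', simple_value (Kh n) s w = simple_value (Kh n) s w' &
      {ae P, forall w, [/\
        simple_integral X (Ka n) w @[n --> \oo] --> I w,
        simple_integral X (Kh n) w @[n --> \oo] --> J w,
        \int[leb]_s ((simple_value (Ka n) s w - a s w) ^+ 2 * rho s) @[n --> \oo] --> 0 &
        \int[leb]_s ((simple_value (Kh n) s w - h s) ^+ 2 * rho s) @[n --> \oo] --> 0]}].
Proof.
have [mI [H [aH cvgH cvgI]]] := itoI.
have [mJ [K [aK dK] [cvgK cvgJ]]] := wienerJ.
pose eK n := \int[leb]_s ((simple_value (K n) s point - h s) ^+ 2 * rho s).
have eK0 n : 0 <= eK n.
  by apply: Rintegral_ge0 => s _; rewrite mulr_ge0 ?sqr_ge0.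
pose eH n w := (\int[leb]_s ((simple_value (H n) s w + -1 * a s w) ^+ 2 * rho s)%:E)%E.
have eHE n w : eH n w = (\int[leb]_(s in `[0%R, T])
    ((simple_value (H n) s w - a s w) ^+ 2 * sigma s ^+ 2)%:E)%E.
  rewrite ereal_clock_rate /eH; apply: eq_integral => s _.
  by congr (_%:E); rewrite mulN1r.
have meH n : measurable_fun [set: Om] (eH n).
  apply: (measurable_energy mS (Y := fun s w => simple_value (H n) s w + -1 * a s w)).
  by apply: jointly_measurable_lin => //; exact: jointly_measurable_simple hX (aH n).
have eH0 n w : (0 <= eH n w)%E.
  by apply: integral_ge0 => s _; rewrite lee_fin mulr_ge0 ?sqr_ge0.
have mSI H' : simple_adapted T X H' -> measurable_fun [set: Om] (simple_integral X H').
  exact: (measurable_simple_integral hX).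
pose dI n w := (((simple_integral X (H n) w - I w) ^+ 2)%:E : \bar R).
pose dJ n w := (((simple_integral X (K n) w - J w) ^+ 2)%:E : \bar R).
have mdI n : measurable_fun [set: Om] (dI n).
  apply/measurable_EFinP; apply: measurable_funX; apply: measurable_funB => //.
  exact: mSI.
have mdJ n : measurable_fun [set: Om] (dJ n).
  apply/measurable_EFinP; apply: measurable_funX; apply: measurable_funB => //.
  exact: mSI.
have dI0 n w : (0 <= dI n w)%E by rewrite lee_fin sqr_ge0.
have dJ0 n w : (0 <= dJ n w)%E by rewrite lee_fin sqr_ge0.
pose phi n w := (eH n w + (dI n w + (dJ n w + (eK n)%:E)))%E.
have mJK n : measurable_fun [set: Om] (fun w => dJ n w + (eK n)%:E)%E by exact: emeasurable_funD.
have mIJK n : measurable_fun [set: Om] (fun w => dI n w + (dJ n w + (eK n)%:E))%E.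
  exact: emeasurable_funD.
have mphi n : measurable_fun [set: Om] (phi n) by exact: emeasurable_funD.
have eKE n : (0 <= (eK n)%:E)%E by rewrite lee_fin.
have JK0 n w : (0 <= dJ n w + (eK n)%:E)%E by rewrite adde_ge0.
have IJK0 n w : (0 <= dI n w + (dJ n w + (eK n)%:E))%E by rewrite adde_ge0.
have phi0 n w : (0 <= phi n w)%E by rewrite adde_ge0.
have cvgphi : (\int[P]_w phi n w @[n --> \oo] --> 0)%E.
  have -> : (fun n => \int[P]_w phi n w)%E = (fun n => \int[P]_w eH n w +
      (\int[P]_w dI n w + (\int[P]_w dJ n w + (eK n)%:E)))%E.
    apply/funext => n; rewrite ge0_integralD// ge0_integralD// ge0_integralD//.
    rewrite [X in (_ + (_ + (_ + X)) = _)%E](_ : _ = (eK n)%:E)//.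
    by rewrite (L1_EFin (L1_cst P (eK n))) Rint_cst.
  have -> : (0 = 0%E + (0%E + (0%E + 0%E)) :> \bar R)%E by rewrite !adde0.
  apply: cvgeD; [by []| |apply: cvgeD; [by []|exact: cvgI|apply: cvgeD; [by []|exact: cvgJ|]]].
    rewrite [X in X @ _ --> _](_ : _ = (fun n => \int[P]_w \int[leb]_(s in `[0%R, T])
        ((simple_value (H n) s w - a s w) ^+ 2 * sigma s ^+ 2)%:E)%E).
      exact: cvgH.
    by apply/funext => n; apply: eq_integral => w _; exact: eHE.
  by apply/fine_cvgP; split; [exact: nearW|exact: cvgK].
have [N cvgN] := ae_cvg_subsequence mphi phi0 cvgphi.
exists (H \o N), (K \o N); split.
- by move=> n; exact: aH.
- by move=> n; exact: aK.
- by move=> n; exact: dK.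
apply: filterS cvgN => w cw.
have sq (v : nat -> \bar R) : (forall k, 0 <= v k <= phi (N k) w)%E ->
    v k @[k --> \oo] --> 0%E.
  move=> vle; apply: (squeeze_cvge _ _ cw); last exact: cvg_cst.
  exact: nearW.
have cI : dI (N k) w @[k --> \oo] --> 0%E.
  by apply: sq => k; rewrite dI0/= /phi addeCA leeDl// adde_ge0.
have cJ : dJ (N k) w @[k --> \oo] --> 0%E.
  apply: sq => k; rewrite dJ0/= /phi (addeCA (dI _ _)) (addeCA (eH _ _)) leeDl//.
  by rewrite adde_ge0// adde_ge0.
have cH : eH (N k) w @[k --> \oo] --> 0%E.
  by apply: sq => k; rewrite eH0/= /phi leeDl.
have cK : (eK (N k))%:E @[k --> \oo] --> 0%E.
  apply: sq => k; rewrite lee_fin eK0/= /phi !addeA leeDr//.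
  by rewrite adde_ge0// adde_ge0.
split.
- by apply: cvg_sqr_dist; exact: (fine_cvg cI).
- by apply: cvg_sqr_dist; exact: (fine_cvg cJ).
- rewrite [X in X @ _ --> _](_ : _ = fine \o (fun k => eH (N k) w)).
    exact: fine_cvg.
  apply/funext => n; congr fine; apply: eq_integral => s _; congr (_%:E).
  by rewrite mulN1r.
- rewrite [X in X @ _ --> _](_ : _ = fine \o (fun k => (eK (N k))%:E)).
    exact: fine_cvg.
  by apply/funext => n; apply: eq_Rintegral => s _; rewrite (dK _ _ point w).
Qed.

(** The approximations are the exponential densities of the simple processes
    $K^a_n + i \lambda K^h_n$, which have mass one; since $K^h_n$ is deterministic,
    the three exponents differ from an arithmetic progression by the constants
    $\kappa_n = \lambda^2 \int (K^h_n)^2 d\langle X \rangle$. *)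
Lemma girsanov_shift lam :
  (\int[P]_w (expR (shifted_log_density 0 w))%:E = 1)%E ->
  (\int[P]_w (expR (shifted_log_density lam w))%:E = 1)%E.
Proof.
move=> E0.
have [Ka [Kh [aKa aKh dKh cvgK]]] := simple_approximation.
pose L th n := simple_lin th (Ka n) (Kh n).
have aL th n : simple_adapted T X (L th n) by exact: simple_lin_adapted.
pose U_ (i : nat) n w := simple_integral X (L (i%:R * lam) n) w -
  simple_energy T sigma (L (i%:R * lam) n) w / 2.
pose kappa_ n := lam ^+ 2 * \int[leb]_s (simple_value (Kh n) s point ^+ 2 * rho s).
pose kappa := lam ^+ 2 * \int[leb]_s (h s ^+ 2 * rho s).
pose V (i : nat) := shifted_log_density (i%:R * lam).
have V0 : V 0%N = shifted_log_density 0 by rewrite /V; congr shifted_log_density; exact: mul0r.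
have V1 : V 1%N = shifted_log_density lam by rewrite /V; congr shifted_log_density; exact: mul1r.
rewrite -V1; apply: (@exponential_tilt _ _ _ P U_ V kappa_ kappa); last by rewrite V0.
- move=> i n; apply: measurable_funB.
    exact: (measurable_simple_integral hX).
  by apply: measurable_funM => //; exact: (measurable_simple_energy hX).
- by move=> i; exact: measurable_shifted_log_density.
- by move=> i n; exact: (simple_exponential hX).
- move=> n w; rewrite /U_ !(simple_lin_integral _ (aKa n) (aKh n)) /simple_energy.
  have E th : \int[leb]_s (simple_value (L th n) s w ^+ 2 * rho s) =
      \int[leb]_s ((simple_value (Ka n) s w + th * simple_value (Kh n) s w) ^+ 2 * rho s).
    by apply: eq_Rintegral => s _; rewrite (simple_lin_value _ (aKa n) (aKh n)).
  rewrite !E !weighted_square_expand//; do ?[exact: measurable_simple_value|exact: simple_value_L2].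
  have -> : kappa_ n = lam ^+ 2 * \int[leb]_s (simple_value (Kh n) s w ^+ 2 * rho s).
    by congr (_ * _); apply: eq_Rintegral => s _; rewrite (dKh _ _ point w).
  by field.
- apply: cvgM; first exact: cvg_cst.
  have [w [_ _ _ cw]] := ae_exists cvgK.
  apply: (@cvg_weighted_square _ _ _ leb rho h (fun n s => simple_value (Kh n) s point)) => //.
  + by move=> n; exact: measurable_simple_value.
  + by move=> n; exact: simple_value_L2.
  + rewrite [X in X @ _ --> _](_ : _ = fun n =>
        \int[leb]_s ((simple_value (Kh n) s w - h s) ^+ 2 * rho s))//.
    by apply/funext => n; apply: eq_Rintegral => s _; rewrite (dKh _ _ point w).
- apply: filterS2 cvgK energy_finite_ae => w [cI cJ ca ch] ea i.
  pose th := i%:R * lam.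
  apply: cvgB.
    under eq_fun => n do rewrite (simple_lin_integral _ (aKa n) (aKh n)).
    by apply: cvgD => //; apply: cvgM => //; exact: cvg_cst.
  apply: cvgM; last exact: cvg_cst.
  pose one := \1_(`[0, T] : set R) : R -> R.
  have oneP s : one s = 1 \/ rho s = 0.
    rewrite /one /clock_rate indicE; case: (_ \in _); first by left.
    by right; rewrite mul0r.
  pose b s := a s w * one s.
  have mb : measurable_fun [set: measurableTypeR R] b by exact: measurable_section ja.
  have mKa n : measurable_fun [set: measurableTypeR R] (fun s => simple_value (Ka n) s w).
    exact: measurable_simple_value.
  have mKh n : measurable_fun [set: measurableTypeR R] (fun s => simple_value (Kh n) s w).
    exact: measurable_simple_value.
  have IKa n := simple_value_L2 (Ka n) w mS S2.
  have IKh n := simple_value_L2 (Kh n) w mS S2.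
  have Ib : leb.-integrable [set: R] (EFin \o (fun s => b s ^+ 2 * rho s)).
    by under eq_fun do rewrite /b sqr_clock_rate.
  have mba n : measurable_fun [set: measurableTypeR R] (fun s => simple_value (Ka n) s w - b s).
    exact: measurable_funB.
  have mbh n : measurable_fun [set: measurableTypeR R] (fun s => simple_value (Kh n) s w - h s).
    exact: measurable_funB.
  have Iba n : leb.-integrable [set: R]
      (EFin \o (fun s => (simple_value (Ka n) s w - b s) ^+ 2 * rho s)).
    have := weighted_lin_L2 mrho (- 1) (mKa n) mb (IKa n) Ib.
    by under eq_fun do rewrite mulN1r.
  have Ibh n : leb.-integrable [set: R]
      (EFin \o (fun s => (simple_value (Kh n) s w - h s) ^+ 2 * rho s)).
    have := weighted_lin_L2 mrho (- 1) (mKh n) mh (IKh n) hL2.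
    by under eq_fun do rewrite mulN1r.
  pose f s := b s + th * h s.
  pose f_ n s := simple_value (Ka n) s w + th * simple_value (Kh n) s w.
  have -> : \int[leb]_s ((a s w + th * h s) ^+ 2 * rho s) = \int[leb]_s (f s ^+ 2 * rho s).
    apply: eq_Rintegral => s _; rewrite /f /b; case: (oneP s) => ->.
      by rewrite mulr1.
    by rewrite !mulr0.
  rewrite [X in X @ _ --> _](_ : _ = fun n => \int[leb]_s (f_ n s ^+ 2 * rho s)); last first.
    apply/funext => n; apply: eq_Rintegral => s _.
    by rewrite (simple_lin_value _ (aKa n) (aKh n)).
  apply: cvg_weighted_square => //.
  + move=> n; apply: measurable_funD => //; exact: measurable_funM.
  + by apply: measurable_funD => //; exact: measurable_funM.
  + exact: weighted_lin_L2.
  + by move=> n; apply: weighted_lin_L2.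
  apply: (@squeeze_cvgr _ _ _ _ (fun=> 0) (fun n =>
      2 * \int[leb]_s ((simple_value (Ka n) s w - a s w) ^+ 2 * rho s) +
      2 * th ^+ 2 * \int[leb]_s ((simple_value (Kh n) s w - h s) ^+ 2 * rho s))).
  + apply: nearW => n; apply/andP; split.
      by apply: Rintegral_ge0 => s _; rewrite mulr_ge0 ?sqr_ge0.
    have := weighted_square_le mrho rho0 th (mba n) (mbh n) (Iba n) (Ibh n).
    congr (_ <= 2 * _ + _); apply: eq_Rintegral => s _.
      by congr (_ ^+ 2 * _); rewrite /f_ /f; ring.
    by rewrite /b; case: (oneP s) => ->; rewrite ?mulr1 ?mulr0.
  + exact: cvg_cst.
  + have -> : (0 : R) = 2 * 0 + 2 * th ^+ 2 * 0 by rewrite !mulr0 addr0.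
    by apply: cvgD; apply: cvgM => //; exact: cvg_cst.
Qed.

End girsanov_shift.

(** * Wiener integrals *)

Section deterministic_integrands.
Context {R : realType} {d : measure_display} {Om : measurableType d}.
Variables (P : probability Om R) (T : R) (sigma : R -> R) (X : R -> Om -> R).
Hypotheses (hX : gaussian_with_clock P T sigma X) (T_ge0 : 0 <= T).
Local Notation leb := (@lebesgue_measure R).
Local Notation rho := (clock_rate T sigma).
Local Notation L1 f := (P.-integrable [set: Om] (EFin \o f)).
Local Notation simple := (@simple_process R d Om).
Local Notation W2 f := (leb.-integrable [set: R] (EFin \o (fun s => f s ^+ 2 * rho s))).

Let mS := gwc_sigma_meas hX.
Let S2 := gwc_sigma_L2 hX.
Let mrho := measurable_clock_rate mS.
Let rho0 s : 0 <= rho s. Proof. exact: clock_rate_ge0. Qed.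

Definition deterministic (K : simple) :=
  simple_adapted T X K /\ (forall s w w', simple_value K s w = simple_value K s w').

Lemma deterministic_lin th K L : deterministic K -> deterministic L ->
  deterministic (simple_lin th K L).
Proof.
move=> [aK dK] [aL dL]; split; first exact: simple_lin_adapted.
by move=> s w w'; rewrite !(simple_lin_value th aK aL) (dK s w w') (dL s w w').
Qed.

Definition step_process (a b : R) : simple :=
  SimpleProcess 1 (fun i => if i == 0%N then a else b) (fun _ _ => 1).

Lemma step_value a b s w : simple_value (step_process a b) s w = \1_(`]a, b] : set R) s.
Proof. by rewrite /simple_value big_ord1 mul1r. Qed.

Lemma step_integral a b w : simple_integral X (step_process a b) w = X b w - X a w.
Proof. by rewrite /simple_integral big_ord1 mul1r. Qed.

Lemma deterministic_step a b : 0 <= a -> a <= b -> b <= T -> deterministic (step_process a b).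
Proof.
move=> a0 ab bT; split; last by move=> s w w'; rewrite !step_value.
split => [[|i] _|[|i] _|i _|i _] //=.
- by rewrite a0 (le_trans ab).
- by rewrite (le_trans a0).
- by apply/measurable_wrtP.
- by exists 1 => w; rewrite normr1.
Qed.

(** [lam L] is realized as $L + (\lambda - 1) L$, whose energy is the constant
    $\lambda^2 \int L^2 d\langle X \rangle$. *)
Lemma deterministic_mgf L lam : deterministic L ->
  (\int[P]_w (expR (lam * simple_integral X L w))%:E =
   (expR (lam ^+ 2 * \int[leb]_s (simple_value L s point ^+ 2 * rho s) / 2))%:E)%E.
Proof.
move=> [aL dL].
have aM : simple_adapted T X (simple_lin (lam - 1) L L) by exact: simple_lin_adapted.
set g := \int[leb]_s _.
have IL := simple_value_L2 L point mS S2.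
have E w : simple_energy T sigma (simple_lin (lam - 1) L L) w = lam ^+ 2 * g.
  rewrite /simple_energy -RintZ//; apply: eq_Rintegral => s _.
  by rewrite (simple_lin_value _ aL aL) (dL s w point); ring.
have := simple_exponential hX aM.
move=> /(congr1 (fun x => (expR (lam ^+ 2 * g / 2))%:E * x)%E); rewrite mule1 => <-.
rewrite -ge0_integralZl//.
- apply: eq_integral => w _; rewrite -EFinM -expRD E (simple_lin_integral _ aL aL).
  by congr (expR _)%:E; ring.
- apply/measurable_EFinP; apply: measurableT_comp => //; apply: measurable_funB.
    exact: (measurable_simple_integral hX).
  by apply: measurable_funM => //; exact: (measurable_simple_energy hX).
Qed.

Lemma deterministic_isometry L : deterministic L ->
  L1 (fun w => simple_integral X L w ^+ 2) /\
  \int[P]_w simple_integral X L w ^+ 2 = \int[leb]_s (simple_value L s point ^+ 2 * rho s).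
Proof.
move=> dL; apply: mgf_second_moment; last by move=> lam; exact: deterministic_mgf.
by case: dL => aL _; exact: (measurable_simple_integral hX).
Qed.

Definition approximable (f : R -> R) := forall eps : R, 0 < eps -> exists2 K,
  deterministic K & \int[leb]_s ((simple_value K s point - f s) ^+ 2 * rho s) <= eps.

Let diffW2 K (f : R -> R) : measurable_fun [set: measurableTypeR R] f -> W2 f ->
  W2 (fun s => simple_value K s (point : Om) - f s).
Proof.
move=> mf If.
have := weighted_lin_L2 mrho (- 1) (measurable_simple_value K point) mf
  (simple_value_L2 K point mS S2) If.
by under eq_fun do rewrite mulN1r.
Qed.

Lemma approximable_lin th (f g : R -> R) :
  measurable_fun [set: measurableTypeR R] f -> measurable_fun [set: measurableTypeR R] g ->
  W2 f -> W2 g -> approximable f -> approximable g -> approximable (fun s => f s + th * g s).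
Proof.
move=> mf mg If Ig af ag e e0.
pose c := 2 * th ^+ 2 + 1; have c0 : 0 < c by rewrite ltr_wpDl// mulr_ge0 ?sqr_ge0.
have [K dK hK] := af (e / 4) (divr_gt0 e0 (ltr0n _ 4)).
have [L dL hL] := ag (e / 2 / c) (divr_gt0 (divr_gt0 e0 (ltr0n _ 2)) c0).
exists (simple_lin th K L); first exact: deterministic_lin.
have mK := measurable_simple_value K point; have mL := measurable_simple_value L point.
have := weighted_square_le mrho rho0 th (measurable_funB mK mf) (measurable_funB mL mg)
  (diffW2 K mf If) (diffW2 L mg Ig).
set A := \int[leb]_s ((simple_value K s point - f s) ^+ 2 * rho s) in hK *.
set B := \int[leb]_s ((simple_value L s point - g s) ^+ 2 * rho s) in hL *.
have B0 : 0 <= B by apply: Rintegral_ge0 => s _; rewrite mulr_ge0 ?sqr_ge0.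
have -> : \int[leb]_x ((simple_value K x point - f x + th * (simple_value L x point - g x)) ^+ 2 * rho x) =
  \int[leb]_s ((simple_value (simple_lin th K L) s point - (f s + th * g s)) ^+ 2 * rho s).
  apply: eq_Rintegral => s _; rewrite (simple_lin_value _ (proj1 dK) (proj1 dL)).
  by congr (_ ^+ 2 * _); ring.
move=> h; apply: le_trans h _.
have h1 : 2 * th ^+ 2 * B <= e / 2.
  apply: (@le_trans _ _ (c * B)); first by rewrite ler_wpM2r// lerDl.
  by rewrite mulrC -ler_pdivlMr.
by move: hK; lra.
Qed.

Lemma approximable_limit (f : R -> R) (f_ : nat -> R -> R) :
  measurable_fun [set: measurableTypeR R] f -> W2 f ->
  (forall n, measurable_fun [set: measurableTypeR R] (f_ n)) -> (forall n, W2 (f_ n)) ->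
  (forall n, approximable (f_ n)) ->
  \int[leb]_s ((f_ n s - f s) ^+ 2 * rho s) @[n --> \oo] --> 0 -> approximable f.
Proof.
move=> mf If mf_ If_ af cvg0 e e0.
have e4 : 0 < e / 4 by rewrite divr_gt0.
move/cvgrPdist_le: cvg0 => /(_ _ e4) near_n.
have [n] := filter_ex near_n; rewrite sub0r normrN ger0_norm => [hn|]; last first.
  by apply: Rintegral_ge0 => s _; rewrite mulr_ge0 ?sqr_ge0.
have [K dK hK] := af n _ e4; exists K => //.
have Inf : W2 (fun s => f_ n s - f s).
  have := weighted_lin_L2 mrho (- 1) (mf_ n) mf (If_ n) If.
  by under eq_fun do rewrite mulN1r.
have := weighted_square_le mrho rho0 1 (measurable_funB (measurable_simple_value K point) (mf_ n))
  (measurable_funB (mf_ n) mf) (diffW2 K (mf_ n) (If_ n)) Inf.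
have -> : \int[leb]_x ((simple_value K x point - f_ n x + 1 * (f_ n x - f x)) ^+ 2 * rho x) =
  \int[leb]_s ((simple_value K s point - f s) ^+ 2 * rho s).
  by apply: eq_Rintegral => s _; congr (_ ^+ 2 * _); ring.
by move=> h; apply: le_trans h _; lra.
Qed.

Let indm (E : set (measurableTypeR R)) : measurable E ->
  measurable_fun [set: measurableTypeR R] (\1_E : R -> R).
Proof. by move=> mE; exact: measurable_indic. Qed.

Let indW2 (E : set (measurableTypeR R)) : measurable E -> W2 (\1_E : R -> R).
Proof.
move=> mE; apply: (L1_bounded_clock_rate mS S2 (M := 1)).
  by apply: measurable_funX; exact: measurable_indic.
by move=> s; rewrite indicE; case: (_ \in _); rewrite ?expr1n ?expr0n ?normr1 ?normr0.
Qed.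

(** A step process differs from the ray only at its two endpoints, which are Lebesgue
    null. *)
Let approx_ray c : approximable (\1_(`]-oo, c[) : R -> R).
Proof.
move=> e e0; pose b := Num.max 0 (Num.min c T).
have b0 : 0 <= b by rewrite le_max lexx.
have bT : b <= T by rewrite ge_max T_ge0 ge_min lexx orbT.
exists (step_process 0 b); first exact: deterministic_step.
rewrite (_ : \int[leb]_s _ = 0) ?ltW//.
apply: Rintegral_EFin.
pose N : set R := [set 0] `|` [set c].
have N0 : leb.-negligible N.
  apply: negligibleU; apply/negligibleP => //; exact: lebesgue_measure_set1.
have -> : 0%:E = (\int[leb]_s cst 0%E s)%E by rewrite integral0.
apply: ge0_ae_eq_integral => //.
- apply/measurable_EFinP; apply: measurable_funM => //; apply: measurable_funX.
  apply: measurable_funB; last exact: measurable_indic.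
  exact: measurable_simple_value.
- by move=> s _; rewrite lee_fin mulr_ge0 ?sqr_ge0.
apply: negligibleS N0 => s /= /not_implyP[_ ne].
apply: contrapT => /not_orP[/= sn0 snc]; apply: ne.
congr (_%:E); rewrite /clock_rate step_value !indicE.
have [/= |nsT] := boolP (s \in (`[0, T]%classic : set R)); last by rewrite mul0r mulr0.
rewrite inE/= in_itv/= => /andP[s0 sT].
suff -> : (s \in (`]0, b]%classic : set R)) = (s \in (`]-oo, c[%classic : set R)).
  by rewrite subrr expr0n mul0r.
have s_gt0 : 0 < s by rewrite lt_neqAle s0 andbT eq_sym; apply/eqP.
have sc : s != c by apply/eqP.
apply/idP/idP; rewrite !inE/= !in_itv/= s_gt0/= /b le_max [s <= 0]leNgt s_gt0/= le_min sT andbT.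
  by rewrite lt_neqAle sc.
exact: ltW.
Qed.

(** The sets with an approximable indicator form a Dynkin system that contains the
    rays. *)
Lemma approximable_indic (E : set (measurableTypeR R)) : measurable E ->
  approximable (\1_E : R -> R).
Proof.
move=> mE.
have : <<s @RGenInftyO.G R >> E.
  exact: (eq_ind _ (fun S : set (set R) => S E) mE _ (RGenInftyO.measurableE R)).
rewrite -setI_closed_g_dynkin_g_sigma_algebra; last first.
  move=> _ _ [a ->] [b ->]; exists (Num.min a b).
  apply/seteqP; split => x; rewrite /= !in_itv/= lt_min; first by case=> -> ->.
  by move=> /andP[].
suff h : <<d @RGenInftyO.G R >> `<=`
    [set B : set (measurableTypeR R) | measurable B /\ approximable (\1_B : R -> R)].
  by move=> /h[].
apply: smallest_sub; last by move=> _ [c ->]; split; [exact: measurable_itv|exact: approx_ray].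
have onesT : approximable (\1_[set: R] : R -> R).
  move=> e e0; have [K dK hK] := approx_ray (T + 1) e0; exists K => //.
  apply: le_trans hK; rewrite le_eqVlt; apply/orP; left; apply/eqP.
  apply: eq_Rintegral => s _; rewrite /clock_rate.
  have [sT|nsT] := boolP (s \in (`[0, T]%classic : set R)); last first.
    have -> : \1_(`[0, T] : set R) s = 0 :> R by rewrite indicE (negbTE nsT).
    by rewrite mul0r !mulr0.
  congr ((_ - _) ^+ 2 * _); rewrite !indicE in_setT mem_set//.
  move: sT; rewrite inE/= !in_itv/= => /andP[_ sT].
  by rewrite (le_lt_trans sT)// ltrDl.
split => [|B [mB aB]|F tF FH] /=.
- by split.
- split; first exact: measurableC.
  rewrite (_ : \1_(~` B) = fun s => \1_[set: R] s + -1 * \1_B s).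
    by apply: approximable_lin => //; do ?[exact: measurable_indic]; exact: indW2.
  apply/funext => s; rewrite !indicE in_setT in_setC; case: (s \in B) => /=; ring.
- have mF n : measurable (F n) by case: (FH n).
  have mU : measurable (\bigcup_n F n) by exact: bigcup_measurable.
  split => //.
  pose Un n := \big[setU/set0]_(i < n) F i.
  have mUn n : measurable (Un n) by exact: bigsetU_measurable.
  have aUn n : approximable (\1_(Un n) : R -> R).
    elim: n => [|n IH].
      rewrite (_ : \1_(Un 0%N) = fun s => \1_[set: R] s + -1 * \1_[set: R] s).
        by apply: approximable_lin => //; do ?[exact: measurable_indic]; exact: indW2.
      by apply/funext => s; rewrite /Un big_ord0 indic0 mulN1r subrr.
    rewrite (_ : \1_(Un n.+1) = fun s => \1_(Un n) s + 1 * \1_(F n) s).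
      apply: approximable_lin; [exact: (indm (mUn n))|exact: (indm (mF n))|exact: (indW2 (mUn n))|exact: (indW2 (mF n))|exact: IH|].
      by case: (FH n).
    apply/funext => s; rewrite /Un big_ord_recr/= mul1r !indicE in_setU.
    have [sU|] := boolP (s \in _); last by rewrite add0r.
    rewrite memNset ?addr0// => sFn; move: sU; rewrite inE => sU.
    have [i /= iltn Fis] : exists2 i, (i < n)%N & F i s.
      by move: sU; rewrite -bigcup_mkord => -[i /= iltn Fis]; exists i.
    have := tF i n Logic.I Logic.I (ex_intro _ s (conj Fis sFn)) => ein.
    by rewrite ein ltnn in iltn.
  apply: (@approximable_limit _ (fun n => \1_(Un n))); [exact: indm|exact: indW2|
    by move=> n; exact: (indm (mUn n))|by move=> n; exact: (indW2 (mUn n))|exact: aUn|].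
  have [|||||_] := @dominated_Rintegral _ _ _ leb
    (fun n s => (\1_(Un n) s - \1_(\bigcup_n F n) s) ^+ 2 * rho s) (cst 0) rho.
  + move=> n; apply: measurable_funM => //; apply: measurable_funX.
    by apply: measurable_funB; [exact: (indm (mUn n))|exact: (indm mU)].
  + by [].
  + exact: L1_clock_rate.
  + move=> n s; rewrite normrM (ger0_norm (rho0 s)) ler_piMl// !indicE.
    by case: (_ \in _); case: (_ \in _); rewrite ?subrr ?subr0 ?sub0r ?sqrrN ?expr1n ?expr0n ?normr0 ?normr1.
  + move=> s; apply: cvg_near_cst.
    have [[i _ Fis]|nU] := pselect ((\bigcup_n F n) s); last first.
      apply: nearW => n; rewrite !indicE !memNset ?subrr ?expr0n ?mul0r//.
      by rewrite /Un -bigcup_mkord => -[i _ Fis]; apply: nU; exists i.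
    near=> n; rewrite !indicE !mem_set ?subrr ?expr0n ?mul0r//; first by exists i.
    rewrite /Un -bigcup_mkord; exists i => //=.
    by near: n; exact: nbhs_infty_gt.
  by rewrite [X in _ --> X -> _](_ : _ = 0) // /Rintegral integral0.
Unshelve. all: by end_near. Qed.

End deterministic_integrands.

Section wiener_integrals.
Context {R : realType} {d : measure_display} {Om : measurableType d}.
Variables (P : probability Om R) (T : R) (sigma : R -> R) (X : R -> Om -> R).
Hypotheses (hX : gaussian_with_clock P T sigma X) (T_ge0 : 0 <= T).
Local Notation leb := (@lebesgue_measure R).
Local Notation rho := (clock_rate T sigma).
Local Notation L1 f := (P.-integrable [set: Om] (EFin \o f)).
Local Notation simple := (@simple_process R d Om).
Local Notation W2 f := (leb.-integrable [set: R] (EFin \o (fun s => f s ^+ 2 * rho s))).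

Let mS := gwc_sigma_meas hX.
Let S2 := gwc_sigma_L2 hX.
Let mrho := measurable_clock_rate mS.
Let rho0 s : 0 <= rho s. Proof. exact: clock_rate_ge0. Qed.

Lemma wiener_integral_step t : 0 <= t <= T ->
  is_wiener_integral P T sigma X (\1_(`]0, t] : set R)) (fun w => X t w - X 0 w).
Proof.
move=> /andP[t0 tT].
have zero_ok : 0 <= (0 : R) <= T by rewrite lexx.
have t_ok : 0 <= t <= T by rewrite t0.
split; first by apply: measurable_funB; exact: (gwc_measurable hX).
have [aK dK] := @deterministic_step R d Om T X 0 t (lexx 0) t0 tT.
exists (fun=> step_process 0 t); first by split.
split=> [w|].
  rewrite [X in X @ _ --> _](_ : _ = fun=> 0); first exact: cvg_cst.
  apply/funext => n; rewrite (_ : \int[leb]_s _ = \int[leb]_s cst 0 s).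
    by rewrite /Rintegral integral0.
  by apply: eq_Rintegral => s _; rewrite step_value subrr expr0n mul0r.
rewrite [X in X @ _ --> _](_ : _ = fun=> 0%E); first exact: cvg_cst.
apply/funext => n; apply: integral0_eq => w _.
by rewrite step_integral subrr expr0n.
Qed.

Section existence.
Variable h : R -> R.
Hypotheses (mh : measurable_fun [set: measurableTypeR R] h) (hW2 : W2 h)
  (ah : approximable T sigma X h).

Let quarter (n : nat) : R := 4 ^- n.
Let quarter_gt0 n : 0 < quarter n. Proof. by rewrite invr_gt0 exprn_gt0. Qed.

Let diffW2 (K : simple) : W2 (fun s => simple_value K s (point : Om) - h s).
Proof.
have := weighted_lin_L2 mrho (- 1) (measurable_simple_value K point) mh
  (simple_value_L2 K point mS S2) hW2.
by under eq_fun do rewrite mulN1r.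
Qed.

Let quarter_cvg : quarter n @[n --> \oo] --> 0.
Proof.
rewrite (_ : quarter = fun n => 4^-1 ^+ n); last first.
  by apply/funext => n; rewrite exprVn.
by apply: cvg_expr; rewrite ger0_norm ?invr_ge0// invf_lt1// ltr1n.
Qed.

(** Approximations at distance $4^{-n}$ have almost surely summable increments, so their
    integrals converge almost surely; the isometry and Fatou's lemma give the
    convergence in mean square to the limit. *)
Lemma wiener_integral_exists : exists J, is_wiener_integral P T sigma X h J.
Proof.
have /choice[K KP] : forall n, exists K, deterministic T X K /\
    \int[leb]_s ((simple_value K s point - h s) ^+ 2 * rho s) <= quarter n.
  by move=> n; have [K dK hK] := ah (quarter_gt0 n); exists K.
have dK n : deterministic T X (K n) by case: (KP n).
have hK n := (KP n).2.
pose Y n := simple_integral X (K n).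
have mY n : measurable_fun [set: Om] (Y n).
  by apply: (measurable_simple_integral hX); case: (dK n).
have distY m n : L1 (fun w => (Y m w - Y n w) ^+ 2) /\
    \int[P]_w (Y m w - Y n w) ^+ 2 <= 2 * quarter m + 2 * quarter n.
  have [Id Ed] := deterministic_isometry hX (deterministic_lin (- 1) (dK m) (dK n)).
  have E : (fun w => simple_integral X (simple_lin (-1) (K m) (K n)) w ^+ 2) =
      fun w => (Y m w - Y n w) ^+ 2.
    apply/funext => w; rewrite (simple_lin_integral _ (proj1 (dK m)) (proj1 (dK n))).
    by rewrite mulN1r.
  move: Id Ed; rewrite E => Id ->; split => //.
  have := weighted_square_le mrho rho0 (- 1)
    (measurable_funB (measurable_simple_value (K m) point) mh)
    (measurable_funB (measurable_simple_value (K n) point) mh) (diffW2 _) (diffW2 _).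
  rewrite sqrrN expr1n mulr1.
  set lhs := (X in X <= _ -> _).
  have -> : lhs = \int[leb]_s (simple_value (simple_lin (-1) (K m) (K n)) s point ^+ 2 * rho s).
    apply: eq_Rintegral => s _; congr (_ ^+ 2 * _).
    by rewrite (simple_lin_value _ (proj1 (dK m)) (proj1 (dK n))) /=; ring.
  move=> le1; apply: (le_trans le1); rewrite lerD// ler_wpM2l//; exact: hK.
pose D n w := `|Y n.+1 w - Y n w|.
have mD n : measurable_fun [set: Om] (D n).
  by apply: measurableT_comp => //; exact: measurable_funB.
have IDle n : (\int[P]_w (D n w)%:E <= (8 / (2 ^ (n + 1))%:R)%:E)%E.
  have [I2 E2] := distY n.+1 n.
  have Ib : L1 (fun w => 2 ^+ n * (Y n.+1 w - Y n w) ^+ 2 + 2 ^- n).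
    by apply: L1D; [exact: L1Z|exact: L1_cst].
  (* trades the mean square of an increment for a summable bound on its mean *)
  have leD w : D n w <= 2 ^+ n * (Y n.+1 w - Y n w) ^+ 2 + 2 ^- n.
    rewrite /D; set x := Y n.+1 w - Y n w; have p0 : 0 < (2 : R) ^+ n by rewrite exprn_gt0.
    rewrite -(real_normK (num_real x)) -(ler_pM2l p0) mulrDr mulfV ?gt_eqF//.
    by have := sqr_ge0 (2 ^+ n * `|x| - 1); have := normr_ge0 x; nra.
  have ID : L1 (D n).
    apply: L1_le Ib => // w; rewrite [`|D n w|]normr_id.
    by rewrite (le_trans (leD w))// ler_norm.
  rewrite L1_EFin// lee_fin; apply: le_trans (le_Rint ID Ib leD) _.
  rewrite RintD; [|exact: L1Z|exact: L1_cst].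
  rewrite RintZ// Rint_cst.
  have p0 : 0 < (2 : R) ^+ n by rewrite exprn_gt0.
  have q4 : (4 : R) ^+ n = 2 ^+ n * 2 ^+ n.
    by rewrite -exprD addnn -mul2n exprM; congr (_ ^+ n); rewrite -natrX.
  apply: (@le_trans _ _ (2 ^+ n * (2 * quarter n.+1 + 2 * quarter n) + 2 ^- n)).
    by rewrite lerD2r ler_pM2l.
  rewrite /quarter natrX exprD expr1 exprS q4.
  have -> : 2 ^+ n * (2 * (4 * (2 ^+ n * 2 ^+ n))^-1 + 2 * (2 ^+ n * 2 ^+ n)^-1) + 2 ^- n =
      (7 / 2) * 2 ^- n :> R by field; rewrite gt_eqF.
  have -> : 8 / (2 ^+ n * 2) = 4 * 2 ^- n :> R by field; rewrite gt_eqF.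
  by rewrite ler_pM2r ?invr_gt0//; lra.
have sumD : {ae P, forall w, (\sum_(0 <= n <oo) (D n w)%:E < +oo)%E}.
  apply: (@ae_nneseries_lty _ _ _ P (fun n w => (D n w)%:E) 8) => //.
  - by move=> n; exact/measurable_EFinP.
  - by move=> n w; rewrite lee_fin /D.
have cvgY : {ae P, forall w, cvgn (Y ^~ w)}.
  apply: filterS sumD => w lty.
  have D0 k : (0 <= (D k w)%:E)%E by rewrite lee_fin /D.
  have cS : cvgn [series Y n.+1 w - Y n w]_n.
    apply: normed_cvg.
    rewrite (_ : [normed _] = series (D ^~ w)); last by [].
    apply: nondecreasing_is_cvgn.
      by apply/nondecreasing_seqP => n; rewrite seriesSr lerDl normr_ge0.
    exists (fine (\sum_(0 <= n <oo) (D n w)%:E)%E) => _ [n _ <-].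
    rewrite -lee_fin fineK ?ge0_fin_numE ?nneseries_ge0//.
    rewrite /series /= -sumEFin; exact: nneseries_lim_ge.
  have -> : (Y ^~ w) = (fun n => Y 0%N w + [series Y n.+1 w - Y n w]_n n).
    apply/funext => n; rewrite /series /= telescope_sumr//; ring.
  by apply: is_cvgD => //; exact: is_cvg_cst.
pose J w := fine (limn_esup (fun n => (Y n w)%:E)).
have mJ : measurable_fun [set: Om] J.
  apply: measurableT_comp; first exact: fine_measurable.
  by apply: measurable_fun_limn_esup => n; exact/measurable_EFinP.
have YJ : {ae P, forall w, Y n w @[n --> \oo] --> J w}.
  apply: filterS cvgY => w /cvg_ex[l Yl].
  suff -> : J w = l by [].
  have Yl' : (Y n w)%:E @[n --> \oo] --> l%:E.
    by apply/fine_cvgP; split; [exact: nearW|exact: Yl].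
  rewrite /J is_cvg_limn_esupE; first by rewrite (cvg_lim _ Yl').
  by apply/cvg_ex; exists l%:E.
have distJ n : (\int[P]_w ((Y n w - J w) ^+ 2)%:E <= (2 * quarter n)%:E)%E.
  have -> : 2 * quarter n = 2 * quarter n + 2 * 0 by rewrite mulr0 addr0.
  apply: (@fatou_ae _ _ _ P (fun m w => (Y n w - Y m w) ^+ 2) _
    (fun m => 2 * quarter n + 2 * quarter m)).
  - by move=> m; apply: measurable_funX; exact: measurable_funB.
  - by apply: measurable_funX; exact: measurable_funB.
  - by move=> m w; exact: sqr_ge0.
  - by move=> w; exact: sqr_ge0.
  - apply: filterS YJ => w Yw; under eq_fun do rewrite expr2; rewrite expr2.
    by apply: cvgM; apply: cvgB => //; exact: cvg_cst.
  - by move=> m; have [I E] := distY n m; rewrite L1_EFin// lee_fin.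
  - apply: cvgD; first exact: cvg_cst.
    by apply: cvgM; [exact: cvg_cst|exact: quarter_cvg].
exists J; split => //; exists K.
  by split => n; case: (dK n).
split=> [w|].
  apply: (@squeeze_cvgr _ _ _ _ (fun=> 0) quarter) => //; last exact: cvg_cst.
  apply: nearW => n; apply/andP; split.
    by apply: Rintegral_ge0 => s _; rewrite mulr_ge0 ?sqr_ge0.
  apply: le_trans (hK n); rewrite le_eqVlt; apply/orP; left; apply/eqP.
  by apply: eq_Rintegral => s _; rewrite ((dK n).2 _ _ point).
apply: (@squeeze_cvge _ _ _ _ (fun=> 0%E) _ (fun n => (2 * quarter n)%:E)).
- by apply: nearW => n; rewrite distJ integral_ge0// => w _; rewrite lee_fin sqr_ge0.
- exact: cvg_cst.
- apply/fine_cvgP; split; first exact: nearW.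
  rewrite (_ : 0 = 2 * 0 :> R); last by rewrite mulr0.
  by apply: cvgM; [exact: cvg_cst|exact: quarter_cvg].
Qed.

End existence.

End wiener_integrals.

(** * Shifting an Ito integral *)

Lemma ereal_square_le d (T : measurableType d) (R : realType) (mu : measure T R)
    (rho f g : T -> R) (th : R) :
  measurable_fun [set: T] rho -> (forall x, 0 <= rho x) ->
  measurable_fun [set: T] f -> measurable_fun [set: T] g ->
  (\int[mu]_x ((f x + th * g x) ^+ 2 * rho x)%:E <=
   2%:E * \int[mu]_x (f x ^+ 2 * rho x)%:E +
   (2 * th ^+ 2)%:E * \int[mu]_x (g x ^+ 2 * rho x)%:E)%E.
Proof.
move=> mrho rho0 mf mg.
have mq (k : T -> R) : measurable_fun [set: T] k ->
    measurable_fun [set: T] (fun x => (k x ^+ 2 * rho x)%:E).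
  by move=> mk; apply/measurable_EFinP; apply: measurable_funM => //; exact: measurable_funX.
have q0 (k : T -> R) x : (0 <= (k x ^+ 2 * rho x)%:E)%E.
  by rewrite lee_fin mulr_ge0 ?sqr_ge0.
have t0 : (0 <= (2 * th ^+ 2)%:E)%E by rewrite lee_fin mulr_ge0 ?sqr_ge0.
have mZ (c : R) (k : T -> R) : measurable_fun [set: T] k ->
    measurable_fun [set: T] (fun x => c%:E * (k x ^+ 2 * rho x)%:E)%E.
  by move=> mk; apply: measurable_funeM; exact: mq.
rewrite -(ge0_integralZl_EFin mu measurableT (fun x _ => q0 f x) (mq f mf)) ?ler0n//.
rewrite -(ge0_integralZl_EFin mu measurableT (fun x _ => q0 g x) (mq g mg)) -?lee_fin//.
rewrite -ge0_integralD//; [|by move=> x _; rewrite mule_ge0|exact: mZ|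
  by move=> x _; rewrite mule_ge0|exact: mZ].
apply: ge0_le_integral => //.
- by move=> x _; exact: (q0 (fun x => f x + th * g x)).
- by apply: (mq (fun x => f x + th * g x)); apply: measurable_funD => //; exact: measurable_funM.
- by apply: emeasurable_funD; exact: mZ.
- move=> x _; rewrite -!EFinM -EFinD lee_fin !mulrA -mulrDl ler_wpM2r//.
  by have := sqr_ge0 (f x - th * g x); nra.
Qed.

Section drift_shift.
Context {R : realType} {d : measure_display} {Om : measurableType d}.
Variables (P : probability Om R) (T : R) (sigma : R -> R) (X : R -> Om -> R).
Hypothesis hX : gaussian_with_clock P T sigma X.
Local Notation leb := (@lebesgue_measure R).
Local Notation rho := (clock_rate T sigma).

Let mS := gwc_sigma_meas hX.
Let S2 := gwc_sigma_L2 hX.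
Let mrho := measurable_clock_rate mS.
Let rho0 s : 0 <= rho s. Proof. exact: clock_rate_ge0. Qed.

Lemma ratio_clock_rate (x : R) s : (x / sigma s ^+ 2) ^+ 2 * sigma s ^+ 2 = x ^+ 2 / sigma s ^+ 2.
Proof.
have [->|s0] := eqVneq (sigma s) 0; first by rewrite expr0n invr0 !mulr0.
by field.
Qed.

Lemma measurable_process_ratio udot : @measurable_process R d Om T udot ->
  @measurable_process R d Om T (fun s w => udot s w / sigma s ^+ 2).
Proof.
move=> mu; apply: measurable_funM => //.
rewrite [X in measurable_fun _ X](_ : _ = (fun z : Om * R => (sigma z.2 ^+ 2) `^ (-1))).
  apply: (measurableT_comp (measurable_powR (-1))); apply: measurable_funX.
  apply: (measurable_comp (F := (`[0, T] : set (measurableTypeR R))) (f := sigma) (g := snd)) => //.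
    by move=> _ [z [_ /= zT] <-].
  exact: measurable_funTS.
by apply/funext => z; rewrite powR_inv1// sqr_ge0.
Qed.

Lemma ratio_energy udot : finite_energy P T sigma udot ->
  (\int[P]_w \int[leb]_s ((udot s w / sigma s ^+ 2) ^+ 2 * rho s)%:E < +oo)%E.
Proof.
apply: le_lt_trans; rewrite le_eqVlt; apply/orP; left; apply/eqP.
apply: eq_integral => w _; rewrite -ereal_clock_rate; apply: eq_integral => s _.
by rewrite ratio_clock_rate.
Qed.

Lemma girsanov_densityE (udot : R -> Om -> R) (I : Om -> R) h J w :
  girsanov_density T sigma udot I w =
  expR (shifted_log_density T sigma (fun s w => udot s w / sigma s ^+ 2) I h J 0 w).
Proof.
have E : \int[leb]_(s in `[0%R, T]) (udot s w ^+ 2 / sigma s ^+ 2) =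
    \int[leb]_s ((udot s w / sigma s ^+ 2 + 0 * h s) ^+ 2 * rho s).
  rewrite -Rintegral_clock_rate; apply: eq_Rintegral => s _.
  by rewrite mul0r addr0 ratio_clock_rate.
by rewrite /girsanov_density /shifted_log_density -E mul0r addr0 [2^-1 * _]mulrC.
Qed.

Section ito_linearity.
Variables (a : R -> Om -> R) (I : Om -> R) (h : R -> R) (J : Om -> R).
Hypotheses (ma : measurable_process T a)
  (mh : measurable_fun [set: measurableTypeR R] h)
  (hL2 : leb.-integrable [set: R] (EFin \o (fun s => h s ^+ 2 * rho s)))
  (itoI : is_ito_integral P T sigma X a I)
  (wienerJ : is_wiener_integral P T sigma X h J).

(** The simple processes $H_n + \theta K_n$ do, by
    $(x + \theta y)^2 \leq 2 x^2 + 2 \theta^2 y^2$. *)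
Lemma ito_integral_shift th : is_ito_integral P T sigma X
  (fun s w => a s w + th * h s) (fun w => I w + th * J w).
Proof.
have ja : jointly_measurable T a by exact/measurable_processP.
have [mI [H [aH cvgH cvgI]]] := itoI.
have [mJ [K [aK dK] [cvgK cvgJ]]] := wienerJ.
split; first by apply: measurable_funD => //; exact: measurable_funM.
exists (fun n => simple_lin th (H n) (K n)).
have t0 : (0 <= (2 * th ^+ 2)%:E)%E by rewrite lee_fin mulr_ge0 ?sqr_ge0.
have lim0 : (0 = 2%:E * 0 + (2 * th ^+ 2)%:E * 0 :> \bar R)%E by rewrite !mule0 adde0.
split=> [n||]; first exact: simple_lin_adapted.
- pose eH n w := (\int[leb]_s ((simple_value (H n) s w + -1 * a s w) ^+ 2 * rho s)%:E)%E.
  pose eK n := \int[leb]_s ((simple_value (K n) s point - h s) ^+ 2 * rho s).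
  have eH0 n w : (0 <= eH n w)%E.
    by apply: integral_ge0 => s _; rewrite lee_fin mulr_ge0 ?sqr_ge0.
  have meH n : measurable_fun [set: Om] (eH n).
    apply: (measurable_energy mS (Y := fun s w => simple_value (H n) s w + -1 * a s w)).
    by apply: jointly_measurable_lin => //; exact: jointly_measurable_simple hX (aH n).
  have eKE n w : (\int[leb]_s ((simple_value (K n) s w - h s) ^+ 2 * rho s)%:E = (eK n)%:E)%E.
    have := weighted_lin_L2 mrho (- 1) (measurable_simple_value (K n) w) mh
      (simple_value_L2 (K n) w mS S2) hL2.
    under eq_fun do rewrite mulN1r; move=> Iw; rewrite (L1_EFin Iw); congr (_%:E).
    by apply: eq_Rintegral => s _; rewrite (dK _ _ point w).
  apply: (@squeeze_cvge _ _ _ _ (fun=> 0%E) _ (fun n =>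
      2%:E * \int[P]_w eH n w + (2 * th ^+ 2)%:E * (eK n)%:E)%E).
  + apply: nearW => n; apply/andP; split.
      by apply: integral_ge0 => w _; apply: integral_ge0 => s _; rewrite lee_fin mulr_ge0 ?sqr_ge0.
    rewrite -(ge0_integralZl_EFin P measurableT (fun w _ => eH0 n w) (meH n)) ?ler0n//.
    rewrite -[X in (_ <= _ + X)%E](_ : (\int[P]_w ((2 * th ^+ 2) * eK n)%:E)%E = _); last first.
      by rewrite (L1_EFin (L1_cst P _)) Rint_cst EFinM.
    have k0 : 0 <= 2 * th ^+ 2 * eK n.
      apply: mulr_ge0; first by rewrite mulr_ge0 ?sqr_ge0.
      by rewrite /eK; apply: Rintegral_ge0 => s _; rewrite mulr_ge0 ?sqr_ge0.
    rewrite -ge0_integralD//; [|by move=> w _; rewrite mule_ge0|exact: measurable_funeM].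
    have mlin : measurable_fun [set: Om] (fun w => \int[leb]_s
        ((simple_value (simple_lin th (H n) (K n)) s w + -1 * (a s w + th * h s)) ^+ 2 * rho s)%:E)%E.
      apply: (measurable_energy mS (Y := fun s w =>
        simple_value (simple_lin th (H n) (K n)) s w + -1 * (a s w + th * h s))).
      apply: jointly_measurable_lin.
        by apply: (jointly_measurable_simple hX); exact: simple_lin_adapted.
      by apply: jointly_measurable_lin => //; exact: jointly_measurable_cst.
    have E w : (\int[leb]_(s in `[0%R, T]) ((simple_value (simple_lin th (H n) (K n)) s w -
        (a s w + th * h s)) ^+ 2 * sigma s ^+ 2)%:E = \int[leb]_s
        ((simple_value (simple_lin th (H n) (K n)) s w + -1 * (a s w + th * h s)) ^+ 2 * rho s)%:E)%E.
      by rewrite ereal_clock_rate; apply: eq_integral => s _; rewrite mulN1r.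
    apply: le_trans; first by rewrite le_eqVlt; apply/orP; left; apply/eqP;
      apply: eq_integral => w _; exact: E.
    apply: ge0_le_integral => //.
    * by move=> w _; apply: integral_ge0 => s _; rewrite lee_fin mulr_ge0 ?sqr_ge0.
    * by apply: emeasurable_funD => //; exact: measurable_funeM.
    move=> w _; rewrite EFinM -(eKE n w).
    pose one := \1_(`[0, T] : set R) : R -> R.
    have mone : measurable_fun [set: measurableTypeR R] one.
      by apply: measurable_indic; exact: measurable_itv.
    have mfw : measurable_fun [set: measurableTypeR R]
        (fun s => (simple_value (H n) s w + -1 * a s w) * one s).
      apply: (@measurable_section _ _ _ _ (fun s w => simple_value (H n) s w + -1 * a s w)).
      by apply: jointly_measurable_lin => //; exact: jointly_measurable_simple hX (aH n).
    have mgw : measurable_fun [set: measurableTypeR R]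
        (fun s => (simple_value (K n) s w - h s) * one s).
      by apply: measurable_funM => //; apply: measurable_funB => //; exact: measurable_simple_value.
    apply: le_trans (le_trans (@ereal_square_le _ _ _ leb rho _ _ th mrho rho0 mfw mgw) _).
      rewrite le_eqVlt; apply/orP; left; apply/eqP; apply: eq_integral => s _.
      rewrite (simple_lin_value _ (aH n) (aK n)) mulrA -mulrDl sqr_clock_rate.
      by congr (_ ^+ 2 * _)%:E; ring.
    rewrite le_eqVlt; apply/orP; left; apply/eqP; congr (_ * _ + _ * _)%E;
      by apply: eq_integral => s _; rewrite sqr_clock_rate.
  + exact: cvg_cst.
  + rewrite lim0; apply: cvgeD; [by []|apply: cvgeZl; [by []|]|apply: cvgeZl; [by []|]].
      rewrite [X in X @ _ --> _](_ : _ = (fun n => \int[P]_w \int[leb]_(s in `[0%R, T])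
        ((simple_value (H n) s w - a s w) ^+ 2 * sigma s ^+ 2)%:E)%E).
        exact: cvgH.
      apply/funext => n; apply: eq_integral => w _; rewrite ereal_clock_rate.
      by apply: eq_integral => s _; rewrite mulN1r.
    by apply/fine_cvgP; split; [exact: nearW|exact: cvgK].
- pose dI n := (\int[P]_w ((simple_integral X (H n) w - I w) ^+ 2)%:E)%E.
  pose dJ n := (\int[P]_w ((simple_integral X (K n) w - J w) ^+ 2)%:E)%E.
  apply: (@squeeze_cvge _ _ _ _ (fun=> 0%E) _ (fun n =>
      2%:E * dI n + (2 * th ^+ 2)%:E * dJ n)%E).
  + apply: nearW => n; rewrite integral_ge0//=; last by move=> w _; rewrite lee_fin sqr_ge0.
    have mSI H' : simple_adapted T X H' -> measurable_fun [set: Om] (simple_integral X H').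
      exact: (measurable_simple_integral hX).
    have m1 := measurable_funB (mSI _ (aH n)) mI.
    have m2 := measurable_funB (mSI _ (aK n)) mJ.
    have := @ereal_square_le _ _ _ P (fun=> 1) _ _ th (measurable_cst _) (fun=> ler01) m1 m2.
    congr (_ <= _)%E.
      apply: eq_integral => w _; rewrite (simple_lin_integral _ (aH n) (aK n)) mulr1.
      by congr (_ ^+ 2)%:E; rewrite /=; ring.
    by congr (_ * _ + _ * _)%E; apply: eq_integral => w _; rewrite mulr1.
  + exact: cvg_cst.
  + by rewrite lim0; apply: cvgeD; [by []| |]; apply: cvgeZl.
Qed.

End ito_linearity.

End drift_shift.

(** * The noise under a translated law *)

Section translated_law.
Context {R : realType} {d : measure_display} {Om : measurableType d}.
Variables (P : probability Om R) (T : R) (sigma : R -> R) (X : R -> Om -> R).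
Hypotheses (hX : gaussian_with_clock P T sigma X) (T_ge0 : 0 <= T).
Hypothesis sigma_neq0 : {ae (@lebesgue_measure R), forall s : R,
  0 <= s <= T -> sigma s != 0}.
Local Notation leb := (@lebesgue_measure R).
Local Notation rho := (clock_rate T sigma).
Local Notation one := (\1_(`[0, T] : set R) : R -> R).
Variables (v vdot : R -> Om -> R) (Pv : probability Om R) (I : Om -> R).
Hypotheses (v_drift : is_drift P T X v vdot)
  (v_energy : finite_energy P T sigma vdot).
Local Notation a := (fun s w => vdot s w / sigma s ^+ 2).
Hypotheses (itoI : is_ito_integral P T sigma X a I)
  (PvE : forall A : set Om, measurable A ->
      Pv A = (\int[P]_(w in A) (girsanov_density T sigma vdot I w)%:E)%E).

Let mS := gwc_sigma_meas hX.
Let S2 := gwc_sigma_L2 hX.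
Let mrho := measurable_clock_rate mS.

Let mvdot : measurable_process T vdot. Proof. by have [_ _ []] := v_drift. Qed.
Let jvdot : jointly_measurable T vdot. Proof. exact/measurable_processP. Qed.
Let ma : measurable_process T a. Proof. exact: measurable_process_ratio hX _ mvdot. Qed.
Let ja : jointly_measurable T a. Proof. exact/measurable_processP. Qed.

Section direction.
Variables (h : R -> R) (J : Om -> R) (M : R).
Hypotheses (mh : measurable_fun [set: measurableTypeR R] h) (hM : forall s, `|h s| <= M)
  (wienerJ : is_wiener_integral P T sigma X h J).
Local Notation S := (shifted_log_density T sigma a I h J).

Let hL2 : leb.-integrable [set: R] (EFin \o (fun s => h s ^+ 2 * rho s)).
Proof.
apply: (L1_bounded_clock_rate mS S2 (M := M ^+ 2)); first exact: measurable_funX.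
by move=> s; rewrite normrX lerXn2r ?nnegrE// (le_trans (normr_ge0 _) (hM 0)).
Qed.

(** The cross term of the square is the integral of $\dot v h$, since $\sigma$ vanishes
    almost nowhere. *)
Lemma log_density_expand : {ae P, forall w, forall th, S th w = S 0 w +
  th * (J w - \int[leb]_s (vdot s w * one s * h s)) -
  th ^+ 2 * (\int[leb]_s (h s ^+ 2 * rho s)) / 2}.
Proof.
apply: filterS (energy_finite_ae hX ma (ratio_energy v_energy)) => w Ia th.
have mb : measurable_fun [set: measurableTypeR R] (fun s => a s w * one s).
  exact: measurable_section ja.
have mv : measurable_fun [set: measurableTypeR R] (fun s => vdot s w * one s).
  exact: measurable_section jvdot.
have Ib : leb.-integrable [set: R] (EFin \o (fun s => (a s w * one s) ^+ 2 * rho s)).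
  by under eq_fun do rewrite sqr_clock_rate.
have E0 : \int[leb]_s ((a s w * one s) ^+ 2 * rho s) = \int[leb]_s ((a s w + 0 * h s) ^+ 2 * rho s).
  by apply: eq_Rintegral => s _; rewrite sqr_clock_rate mul0r addr0.
have E1 : \int[leb]_s ((a s w + th * h s) ^+ 2 * rho s) =
    \int[leb]_s ((a s w * one s + th * h s) ^+ 2 * rho s).
  apply: eq_Rintegral => s _; rewrite /clock_rate indicE.
  by case: (s \in _); rewrite /= ?mulr1// !(mul0r, mulr0).
have E2 : \int[leb]_s (a s w * one s * h s * rho s) = \int[leb]_s (vdot s w * one s * h s).
  rewrite /Rintegral; congr fine; apply: ae_eq_integral => //.
  - by apply/measurable_EFinP; apply: measurable_funM => //; exact: measurable_funM.
  - by apply/measurable_EFinP; exact: measurable_funM.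
  case: sigma_neq0 => N [mN N0 sN]; exists N; split => // s /= /not_implyP[_ ne].
  apply: sN => /= sn0; apply: ne; congr (_%:E); rewrite /clock_rate.
  rewrite indicE; case: (boolP (s \in _)); last by rewrite !(mulr0, mul0r).
  rewrite inE/= in_itv/= => /sn0 sne; rewrite /=; field; exact: sne.
rewrite /shifted_log_density E1 -E0 weighted_square_expand// E2; by field.
Qed.

Lemma total_shifted_density th : (\int[P]_w (expR (S th w))%:E = 1)%E.
Proof.
apply: (girsanov_shift hX ma mh hM (ratio_energy v_energy) itoI wienerJ).
have := PvE measurableT; rewrite (_ : Pv _ = 1%E); last exact: probability_setT.
by move=> ->; apply: eq_integral => w _; rewrite (@girsanov_densityE _ _ Om T sigma vdot I h J).
Qed.

Lemma measurable_shift th : measurable_fun [set: Om] (S th).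
Proof. exact: (measurable_shifted_log_density hX). Qed.

Lemma translated_densityE A : measurable A ->
  Pv A = (\int[P]_(w in A) (expR (S 0 w))%:E)%E.
Proof. by move=> /PvE ->; apply: eq_integral => w _; rewrite (@girsanov_densityE _ _ Om T sigma vdot I h J). Qed.

Lemma ge0_integral_translated (f : Om -> R) : measurable_fun [set: Om] f ->
  (forall w, 0 <= f w) ->
  (\int[Pv]_w (f w)%:E = \int[P]_w (f w * expR (S 0 w))%:E)%E.
Proof.
move=> mf f0.
have mL : measurable_fun [set: Om] (fun w => expR (S 0 w)).
  by apply: measurableT_comp => //; exact: measurable_shift.
rewrite (@ge0_integral_density _ _ _ P Pv _ mL (fun w => expR_ge0 _) translated_densityE
  (fun w => (f w)%:E))//; exact/measurable_EFinP.
Qed.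

End direction.

(** The variance of $X_0$ is the clock at 0. *)
Lemma initial_value_ae : {ae P, forall w, X 0 w = 0}.
Proof.
have T0 : 0 <= (0 : R) <= T by rewrite lexx.
have c0 : clock sigma 0 = 0.
  by rewrite /clock set_itv1 Rintegral_set1.
have m0 : measurable_fun [set: Om] (X 0) by exact: gwc_measurable hX _ T0.
have I0 := gwc_L2 hX T0.
have E0 : (\int[P]_w (X 0 w ^+ 2)%:E = 0)%E.
  rewrite (L1_EFin I0); congr (_%:E); rewrite -[RHS]c0 -(gwc_covE hX T0 T0 (lexx 0)).
  by apply: eq_Rintegral => w _; rewrite expr2.
have m2 : measurable_fun [set: Om] (fun w => (X 0 w ^+ 2)%:E).
  by apply/measurable_EFinP; exact: measurable_funX.
have := (ae_eq_integral_abs P measurableT m2).1.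
rewrite (_ : (\int[P]_(x in _) _)%E = 0%E); last first.
  by rewrite -E0; apply: eq_integral => w _; rewrite gee0_abs// lee_fin sqr_ge0.
move=> /(_ erefl); apply: filterS => w /(_ Logic.I)/= /eqP.
by rewrite eqe sqrf_eq0 => /eqP.
Qed.

(** The shift by $h = 1_{(0,t]}$ turns the log-density into its value for [vdot] plus
    $\lambda (X_t - v_t) - \lambda^2 g / 2$, where $g$ is the clock at $t$. *)
Lemma translated_noise_mgf t lam : 0 <= t <= T ->
  (\int[Pv]_w (expR (lam * (X t w - v t w)))%:E = (expR (lam ^+ 2 * clock sigma t / 2))%:E)%E.
Proof.
move=> tT; have /andP[t0 tT'] := tT.
pose h := \1_(`]0, t] : set R) : R -> R.
have mh : measurable_fun [set: measurableTypeR R] h by exact: measurable_indic.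
have hM s : `|h s| <= 1 by rewrite /h indicE; case: (_ \in _); rewrite ?normr1 ?normr0.
have wJ := wiener_integral_step hX T_ge0 tT.
have [mv adv _ vE] := v_drift.
have mvt : measurable_fun [set: Om] (v t).
  exact: (measurable_wrt_measurable hX tT' (adv _ tT)).
have mXt : measurable_fun [set: Om] (X t) by exact: gwc_measurable hX _ tT.
have mexp : measurable_fun [set: Om] (fun w => expR (lam * (X t w - v t w))).
  by apply: measurableT_comp => //; apply: measurable_funM => //; exact: measurable_funB.
rewrite (ge0_integral_translated mh wJ)//.
have total := total_shifted_density mh hM wJ lam.
have h2 : \int[leb]_s (h s ^+ 2 * rho s) = clock sigma t.
  have -> : clock sigma t = clock sigma t - clock sigma 0.
    by rewrite [X in _ - X]/clock set_itv1 Rintegral_set1 subr0.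
  rewrite -(clock_increment mS S2 (lexx 0) t0 tT'); apply: eq_Rintegral => s _.
  by rewrite /h indicE; case: (_ \in _); rewrite ?expr1n ?expr0n.
set S := shifted_log_density T sigma a I h (fun w => X t w - X 0 w) in total *.
have mST th : measurable_fun [set: Om] (S th) by exact: measurable_shift mh wJ th.
have mE th : measurable_fun [set: Om] (fun w => expR (S th w)).
  by apply: measurableT_comp => //; exact: mST.
pose c := expR (lam ^+ 2 * clock sigma t / 2).
have -> : ((expR (lam ^+ 2 * clock sigma t / 2))%:E =
    \int[P]_w (c%:E * (expR (S lam w))%:E))%E.
  rewrite (ge0_integralZl_EFin P measurableT) ?expR_ge0//.
  - by rewrite total mule1.
  - by apply/measurable_EFinP; exact: mE.
apply: ae_eq_integral => //.
- by apply/measurable_EFinP; exact: measurable_funM.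
- by apply: measurable_funeM; apply/measurable_EFinP; exact: mE.
have expand := log_density_expand (fun w => X t w - X 0 w) mh hM.
have X0 := initial_value_ae.
rewrite /ae_eq; apply: filterS3 expand X0 vE => w Sw X0 vw _.
rewrite -EFinM -!expRD; congr (expR _)%:E.
have := Sw lam; rewrite -/S h2 X0 (vw _ tT) => ->.
rewrite (_ : \int[leb]_s _ = \int[leb]_(s in `[0, t]) vdot s w); first by field.
have vdotw : measurable_fun (`]0, t] : set R) (fun s => (vdot s w)%:E).
  apply: (@eq_measurable_fun _ _ _ _ _ (fun s => (vdot s w * one s)%:E)).
    move=> s; rewrite inE/= in_itv/= => /andP[s0 st].
    by rewrite indicE mem_set ?mulr1//= in_itv/= (ltW s0) (le_trans st).
  by apply: measurable_funTS; apply/measurable_EFinP; exact: measurable_section jvdot.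
rewrite /Rintegral -integral_itv_obnd_cbnd// [in RHS]integral_mkcond; congr fine.
apply: eq_integral => s _; rewrite patchE /h !indicE.
case: (boolP (s \in (`]0, t]%classic : set R))) => [|_]; last by rewrite mulr0.
rewrite inE/= in_itv/= => /andP[s0 st].
by rewrite mem_set ?mulr1//= in_itv/= (ltW s0) (le_trans st).
Qed.

Lemma translated_noise t : 0 <= t <= T ->
  [/\ Pv.-integrable [set: Om] (EFin \o (fun w => X t w - v t w)),
      \int[Pv]_w (X t w - v t w) = 0,
      Pv.-integrable [set: Om] (EFin \o (fun w => (X t w - v t w) ^+ 2)) &
      \int[Pv]_w (X t w - v t w) ^+ 2 = clock sigma t].
Proof.
move=> tT; have /andP[_ tT'] := tT; have [mv adv _ vE] := v_drift.
have mY : measurable_fun [set: Om] (fun w => X t w - v t w).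
  apply: measurable_funB; first exact: gwc_measurable hX _ tT.
  exact: (measurable_wrt_measurable hX tT' (adv _ tT)).
have mgf lam := translated_noise_mgf lam tT.
by have [I1 E1] := mgf_mean mY mgf; have [I2 E2] := mgf_second_moment mY mgf.
Qed.

End translated_law.

Lemma observation_unbiased {R : realType} {d : measure_display} {Om : measurableType d}
    (P : probability Om R) (T : R) (sigma : R -> R) (X : R -> Om -> R) :
  gaussian_with_clock P T sigma X -> 0 <= T ->
  {ae (@lebesgue_measure R), forall s : R, 0 <= s <= T -> sigma s != 0} ->
  unbiased P T sigma X X.
Proof.
move=> hX T0 sn0 v vdot Pv vd ve [I itoI PvE] t tT Iv.
have [I1 E1 _ _] := translated_noise hX T0 sn0 vd ve itoI PvE tT.
have XE : (fun w => X t w - v t w + v t w) = X t.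
  by apply/funext => w; rewrite subrK.
have IX : Pv.-integrable [set: Om] (EFin \o X t) by rewrite -XE; exact: L1D.
split => //; rewrite unlock (L1_EFin IX) (L1_EFin Iv); congr (_%:E).
by rewrite -XE RintD// E1 add0r.
Qed.

(** * The Chapman-Robbins inequality *)

Section density_probability.
Context d (T : measurableType d) (R : realType) (P : probability T R).
Variable L : T -> R.
Hypotheses (mL : measurable_fun [set: T] L) (L0 : forall x, 0 <= L x)
  (L1 : (\int[P]_x (L x)%:E = 1)%E).

(** The hypotheses are arguments of the definition so that its instance of probability
    measure can depend on them. *)
Definition density_prob
    of measurable_fun [set: T] L & (forall x, 0 <= L x) & (\int[P]_x (L x)%:E = 1)%E
  : set T -> \bar R := fun A => (\int[P]_(x in A) (L x)%:E)%E.
Local Notation q := (density_prob mL L0 L1).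

Let q0 : q set0 = 0%E. Proof. by rewrite /density_prob integral_set0. Qed.

Let q_ge0 A : (0 <= q A)%E.
Proof. by apply: integral_ge0 => x _; rewrite lee_fin. Qed.

Let q_additive : semi_sigma_additive q.
Proof.
move=> F mF tF mUF; rewrite /density_prob; apply: cvg_toP.
  apply: ereal_nondecreasing_is_cvgn => m n mn.
  by apply: lee_sum_nneg_natr => // k _ _; exact: q_ge0.
rewrite ge0_integral_bigcup//=.
- by apply: measurable_funTS; exact/measurable_EFinP.
- by move=> x _; rewrite lee_fin.
Qed.

HB.instance Definition _ := isMeasure.Build _ _ _ q q0 q_ge0 q_additive.

Let q1 : q [set: T] = 1%:E. Proof. exact: L1. Qed.

HB.instance Definition _ := @Measure_isProbability.Build _ _ R q q1.

Lemma density_probability : exists Q : probability T R,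
  forall A, measurable A -> Q A = (\int[P]_(x in A) (L x)%:E)%E.
Proof. by exists q. Qed.

End density_probability.

(** The quadratic is evaluated at its minimizer $- m / B$; if $B = 0$ it is affine and
    bounded below, so that $m = 0$. *)
Lemma discriminant_le (R : realType) (A B m : R) : 0 <= A -> 0 <= B ->
  (forall th, 0 <= A + 2 * th * m + th ^+ 2 * B) -> m ^+ 2 <= A * B.
Proof.
move=> A0; rewrite le_eqVlt => /predU1P[<- h|B0 h].
  have [->|m0] := eqVneq m 0; first by rewrite expr0n mulr0.
  have := h (- (A + 1) / (2 * m)).
  have -> : 2 * (- (A + 1) / (2 * m)) * m = - (A + 1) by field.
  by rewrite mulr0; lra.
have := h (- m / B).
have -> : (A + 2 * (- m / B) * m + (- m / B) ^+ 2 * B) = A - m ^+ 2 / B.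
  by field; rewrite gt_eqF.
by rewrite subr_ge0 ler_pdivrMr.
Qed.

Section chapman_robbins.
Context d (T : measurableType d) (R : realType) (P Q : probability T R).
Variables (L Z : T -> R).
Local Notation L1 f := (P.-integrable [set: T] (EFin \o f)).
Hypotheses (mL : measurable_fun [set: T] L) (L0 : forall x, 0 <= L x)
  (QE : forall A, measurable A -> Q A = (\int[P]_(x in A) (L x)%:E)%E)
  (mZ : measurable_fun [set: T] Z)
  (Z2 : L1 (fun x => Z x ^+ 2)) (L2 : L1 (fun x => L x ^+ 2)).

(** Cauchy-Schwarz for [Z] and $L - 1$ under [P]: the difference of the means is their
    inner product. *)
Lemma chapman_robbins_inequality :
  (\int[Q]_x Z x - \int[P]_x Z x) ^+ 2 <=
  \int[P]_x Z x ^+ 2 * (\int[P]_x L x ^+ 2 - 1).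
Proof.
have IL : L1 L by exact: L1_sqr.
have IZ : L1 Z by exact: L1_sqr.
have IZL : L1 (fun x => Z x * L x) by exact: L1_mul.
have EL : \int[P]_x L x = 1.
  apply: Rintegral_EFin; rewrite -(QE measurableT); exact: probability_setT.
have EQ : \int[Q]_x Z x = \int[P]_x (Z x * L x).
  by rewrite /Rintegral (@integral_density _ _ _ P Q L mL L0 QE Z mZ).
have E2 : \int[P]_x (L x - 1) ^+ 2 = \int[P]_x L x ^+ 2 - 1.
  transitivity (\int[P]_x (L x ^+ 2 - 2 * L x + 1)).
    by apply: eq_Rintegral => x _; ring.
  rewrite RintD; [|by apply: L1B => //; exact: L1Z|exact: L1_cst].
  by rewrite RintB//; [rewrite RintZ// EL Rint_cst; ring|exact: L1Z].
have I2 : L1 (fun x => (L x - 1) ^+ 2).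
  rewrite (_ : (fun x => _) = (fun x => L x ^+ 2 - 2 * L x + 1)).
    by apply: L1D; [apply: L1B => //; exact: L1Z|exact: L1_cst].
  by apply/funext => x; ring.
have IZB : L1 (fun x => Z x * L x - Z x) by exact: L1B.
rewrite EQ -RintB// -E2; apply: discriminant_le.
- by apply: Rintegral_ge0 => x _; exact: sqr_ge0.
- by apply: Rintegral_ge0 => x _; exact: sqr_ge0.
move=> th; rewrite -!RintZ// -!RintD//; [|by apply: L1D => //; exact: L1Z|exact: L1Z|exact: L1Z].
apply: Rintegral_ge0 => x _.
have -> : Z x ^+ 2 + 2 * th * (Z x * L x - Z x) + th ^+ 2 * (L x - 1) ^+ 2 =
  (Z x + th * (L x - 1)) ^+ 2 by ring.
exact: sqr_ge0.
Qed.

End chapman_robbins.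

(** * Perturbing a drift *)

Section square_integrable_processes.
Context {R : realType} {d : measure_display} {Om : measurableType d}.
Variables (P : probability Om R).
Variable m : {sigma_finite_measure set (measurableTypeR R) -> \bar R}.
Variable T : R.
Local Notation one := (\1_(`[0, T] : set R) : R -> R).
Local Open Scope ereal_scope.

Lemma square_integral_indic (Y : R -> Om -> R) :
  \int[P \x m]_(z in [set: Om] `*` `[0%R, T]) ((Y z.2 z.1 ^+ 2)%R)%:E =
  \int[P \x m]_z (((Y z.2 z.1 * one z.2) ^+ 2)%R)%:E.
Proof.
rewrite integral_mkcond; apply: eq_integral => z _; rewrite patchE indicE.
rewrite (_ : (z \in _) = (z.2 \in `[0%R, T]%classic)).
  by case: ifPn; rewrite ?mulr1 ?mulr0 ?expr0n.
by apply/idP/idP; rewrite !inE/=; [case|].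
Qed.

Lemma square_integrable_sections (Y : R -> Om -> R) : square_integrable P m T Y ->
  {ae P, forall w, m.-integrable [set: measurableTypeR R]
    (EFin \o (fun s => ((Y s w * one s) ^+ 2)%R))}.
Proof.
move=> [/measurable_processP jY]; rewrite square_integral_indic => finY.
have mY2 : measurable_fun [set: Om * measurableTypeR R]
    (fun z => (((Y z.2 z.1 * one z.2) ^+ 2)%R)%:E).
  by apply/measurable_EFinP; exact: measurable_funX.
have Y20 z : 0 <= (((Y z.2 z.1 * one z.2) ^+ 2)%R)%:E by rewrite lee_fin sqr_ge0.
move: finY; rewrite fubini_tonelli1//= => finY.
have mF := @measurable_fun_fubini_tonelli_F _ _ _ _ _ m _ mY2 Y20.
have IF : P.-integrable [set: Om] (fubini_F m (fun z => (((Y z.2 z.1 * one z.2) ^+ 2)%R)%:E)).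
  apply/integrableP; split => //.
  by under eq_integral do rewrite gee0_abs ?integral_ge0//.
apply: filterS (integrable_ae measurableT IF) => w /(_ Logic.I) fin.
apply: ge0_L1.
- by apply: measurable_funX; exact: measurable_section.
- by move=> s; exact: sqr_ge0.
- by rewrite -ge0_fin_numE// integral_ge0// => s _; rewrite lee_fin sqr_ge0.
Qed.

End square_integrable_processes.

Section perturbed_drift.
Context {R : realType} {d : measure_display} {Om : measurableType d}.
Variables (P : probability Om R) (T : R) (sigma : R -> R) (X : R -> Om -> R).
Hypothesis hX : gaussian_with_clock P T sigma X.
Local Notation leb := (@lebesgue_measure R).
Local Notation rho := (clock_rate T sigma).
Local Notation one := (\1_(`[0, T] : set R) : R -> R).
Variables (h : R -> R) (M M2 : R).
Hypotheses (mh : measurable_fun [set: measurableTypeR R] h) (h0 : forall s, 0 <= h s)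
  (hM : forall s, `|h s| <= M) (hrho : forall s, rho s = 0 -> h s = 0)
  (hM2 : forall s, `|h s * rho s| <= M2).
Variables (u udot : R -> Om -> R).
Hypotheses (u_drift : is_drift P T X u udot) (u_energy : finite_energy P T sigma udot).

Let mS := gwc_sigma_meas hX.
Let S2 := gwc_sigma_L2 hX.
Let mrho := measurable_clock_rate mS.
Let rho0 s : 0 <= rho s. Proof. exact: clock_rate_ge0. Qed.

(** The path perturbing the drift, with derivative $h \sigma^2$ on [[0, T]].  It is
    nondecreasing as $h \geq 0$, which makes it measurable. *)
Definition direction_path (t : R) : R :=
  \int[leb]_s (\1_(`[0, t] : set R) s * (h s * rho s)).

Definition perturbed_rate (eps s : R) (w : Om) : R := udot s w + eps * (h s * rho s).

Definition perturbed_drift (eps t : R) (w : Om) : R := u t w + eps * direction_path t.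

Let mk : measurable_fun [set: measurableTypeR R] (fun s => h s * rho s).
Proof. exact: measurable_funM. Qed.

Let k0 s : 0 <= h s * rho s. Proof. by rewrite mulr_ge0. Qed.

Let Ik : leb.-integrable [set: R] (EFin \o (fun s => h s * rho s)).
Proof. exact: (L1_bounded_clock_rate mS S2 mh hM). Qed.

Let Ik2 : leb.-integrable [set: R] (EFin \o (fun s => (h s * rho s) ^+ 2)).
Proof.
rewrite (_ : (fun s => _ ^+ 2) = fun s => (h s * rho s * h s) * rho s); last first.
  by apply/funext => s; ring.
apply: (L1_bounded_clock_rate mS S2 (M := M2 * M)); first exact: measurable_funM.
by move=> s; rewrite normrM ler_pM.
Qed.

Let Ikt t : leb.-integrable [set: R] (EFin \o (fun s => \1_(`[0, t] : set R) s * (h s * rho s))).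
Proof.
apply: (@L1_le _ _ _ leb _ (fun s => h s * rho s)) => //.
  by apply: measurable_funM => //; apply: measurable_indic; exact: measurable_itv.
move=> s; rewrite normrM -[leRHS]mul1r ler_wpM2r//.
by rewrite indicE; case: (_ \in _); rewrite ?normr1 ?normr0.
Qed.

Lemma measurable_direction_path : measurable_fun [set: measurableTypeR R] direction_path.
Proof.
apply: nondecreasing_measurable => // x y xy.
apply: le_Rint => // s; rewrite ler_wpM2r// !indicE ler_nat.
case: (boolP (s \in (`[0, x]%classic : set R))) => //.
rewrite inE/= in_itv/= => /andP[s0 sx].
by rewrite mem_set//= in_itv/= s0 (le_trans sx).
Qed.

(** Dividing $h \sigma^2$ by $\sigma^2$ fails to give back [h] only where the clock rate
    vanishes, and there [h] is 0. *)
Lemma perturbed_ratio eps s w :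
  perturbed_rate eps s w / sigma s ^+ 2 = udot s w / sigma s ^+ 2 + eps * h s.
Proof.
rewrite /perturbed_rate; have [r0|] := eqVneq (rho s) 0.
  by rewrite hrho// r0 !(mulr0, addr0).
rewrite /clock_rate indicE; case: (boolP (s \in _)) => _; last by rewrite mul0r eqxx.
rewrite mul1r => s2; field; by move: s2; rewrite expf_eq0.
Qed.

(** The bound on $h \sigma^2$ keeps the derivative of the drift square integrable, which
    is why $\sigma$ has to be bounded on the support of [h]. *)
Lemma perturbed_is_drift eps :
  is_drift P T X (perturbed_drift eps) (perturbed_rate eps).
Proof.
have [mu au u2 uE] := u_drift.
have [mudot lty] := u2; have /measurable_processP judot := mudot.
have mD : measurable ([set: Om] `*` (`[0, T] : set (measurableTypeR R))).
  by apply: measurableX => //; exact: measurable_itv.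
split.
- apply: measurable_funD => //; apply: measurable_funM => //.
  apply: measurable_funTS; apply: (measurableT_comp measurable_direction_path).
  exact: measurable_snd.
- move=> t tT; apply/measurable_wrtP; apply: measurable_funD => //.
  by apply/measurable_wrtP; exact: au.
- split.
    apply: measurable_funD => //; apply: measurable_funM => //.
    by apply: measurable_funTS; apply: (measurableT_comp mk); exact: measurable_snd.
  rewrite square_integral_indic.
  pose f (z : Om * measurableTypeR R) := udot z.2 z.1 * one z.2.
  pose g (z : Om * measurableTypeR R) := h z.2 * rho z.2.
  have mg : measurable_fun [set: Om * measurableTypeR R] g.
    by apply: (measurableT_comp mk); exact: measurable_snd.
  have := @ereal_square_le _ _ R (P \x leb)%E (fun=> 1) f g eps (measurable_cst _)
    (fun=> ler01) judot mg.
  move=> le; apply: (@le_lt_trans _ _ _ _ _ (le_trans _ le)).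
    rewrite le_eqVlt; apply/orP; left; apply/eqP; apply: eq_integral => z _.
    congr (_%:E); rewrite mulr1 /perturbed_rate mulrDl /f /g; congr ((_ + _) ^+ 2).
    rewrite -!mulrA; congr (_ * (_ * _)); rewrite /clock_rate indicE.
    by case: (z.2 \in _); rewrite ?mulr1// !(mul0r, mulr0).
  apply: lte_add_pinfty; apply: lte_mul_pinfty => //.
  + move: lty; rewrite square_integral_indic; apply: le_lt_trans.
    by rewrite le_eqVlt; apply/orP; left; apply/eqP; apply: eq_integral => z _; rewrite mulr1.
  + by rewrite lee_fin mulr_ge0 ?sqr_ge0.
  + have mg2 : measurable_fun [set: Om * measurableTypeR R] (fun z => (g z ^+ 2 * 1)%:E).
      by apply/measurable_EFinP; apply: measurable_funM => //; exact: measurable_funX.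
    rewrite fubini_tonelli1//=; last by move=> z; rewrite lee_fin mulr1 sqr_ge0.
    rewrite /fubini_F/= /g/=.
    under eq_integral => w _ do under eq_integral do rewrite mulr1.
    by rewrite (L1_EFin Ik2) (L1_EFin (L1_cst P _)) ltry.
- apply: filterS2 uE (square_integrable_sections u2) => w uw I2 t tT.
  have /andP[t0 tT'] := tT.
  have mw : measurable_fun [set: measurableTypeR R] (fun s => udot s w * one s).
    exact: measurable_section judot.
  have Ione : leb.-integrable [set: R] (EFin \o one).
    apply: ge0_L1 => [|//|].
      by apply: measurable_indic; exact: measurable_itv.
    by rewrite integral_indic ?setIT//= lebesgue_measure_itv/=; case: ifP => _; rewrite ltry.
  pose onet := \1_(`[0, t] : set R) : R -> R.
  have monet : measurable_fun [set: measurableTypeR R] onet.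
    by apply: measurable_indic; exact: measurable_itv.
  have Iw : leb.-integrable [set: R] (EFin \o (fun s => onet s * (udot s w * one s))).
    apply: (@L1_le _ _ _ leb _ (fun s => one s + (udot s w * one s) ^+ 2)).
    + exact: measurable_funM.
    + move=> s; rewrite [leRHS]ger0_norm; last by rewrite addr_ge0 ?sqr_ge0.
      rewrite /onet /one !indicE.
      case: (s \in _); last by rewrite mul0r normr0 addr_ge0 ?sqr_ge0.
      case: (s \in _); last by rewrite !mulr0 normr0 expr0n addr0.
      rewrite /= !mulr1n mul1r mulr1 -[in leRHS](real_normK (num_real (udot s w))).
      by have := sqr_ge0 (`|udot s w| - 1); have := normr_ge0 (udot s w); nra.
    + exact: L1D.
  rewrite /perturbed_drift (uw _ tT) /perturbed_rate /direction_path.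
  rewrite ![\int[leb]_(s in `[0, t]) _]Rintegral_mkcond -RintZ//.
  have E (f : R -> R) s : (f \_ `[0, t]) s = onet s * f s.
    by rewrite patchE /onet indicE; case: ifPn => _; rewrite ?mul1r ?mul0r.
  have E1 s : onet s * udot s w = onet s * (udot s w * one s).
    rewrite /onet /one !indicE; case: (boolP (s \in (`[0, t]%classic : set R))) => [|_]; last by rewrite !mul0r.
    rewrite inE/= in_itv/= => /andP[s0 st].
    by rewrite (mem_set (_ : `[0, T]%classic s)) ?mulr1//= in_itv/= s0 (le_trans st).
  have -> : \int[leb]_s ((fun s => udot s w) \_ `[0, t]) s =
      \int[leb]_s (onet s * (udot s w * one s)).
    by apply: eq_Rintegral => s _; rewrite E E1.
  rewrite -RintD//; last exact: L1Z.
  by apply: eq_Rintegral => s _; rewrite E -E1; ring.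
Qed.

Lemma perturbed_energy eps : finite_energy P T sigma (perturbed_rate eps).
Proof.
have [_ _ [mudot _] _] := u_drift.
pose a s w := udot s w / sigma s ^+ 2.
have ja : jointly_measurable T a.
  by apply/measurable_processP; exact: (measurable_process_ratio hX mudot).
have jh : @jointly_measurable R d Om T (fun s _ => h s) by exact: jointly_measurable_cst.
have Ih : leb.-integrable [set: R] (EFin \o (fun s => h s ^+ 2 * rho s)).
  apply: (L1_bounded_clock_rate mS S2 (M := M ^+ 2)); first exact: measurable_funX.
  by move=> s; rewrite normrX lerXn2r ?nnegrE// (le_trans (normr_ge0 _) (hM 0)).
pose e w := (\int[leb]_s (a s w ^+ 2 * rho s)%:E)%E.
have me : measurable_fun [set: Om] e by exact: measurable_energy mS _ ja.
have e0 w : (0 <= e w)%E.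
  by apply: integral_ge0 => s _; rewrite lee_fin mulr_ge0 ?sqr_ge0.
pose C := 2 * eps ^+ 2 * \int[leb]_s (h s ^+ 2 * rho s).
have C0 : 0 <= C.
  apply: mulr_ge0; first by rewrite mulr_ge0 ?sqr_ge0.
  by apply: Rintegral_ge0 => s _; rewrite mulr_ge0 ?sqr_ge0.
have E w : (\int[leb]_(s in `[0%R, T]) (perturbed_rate eps s w ^+ 2 / sigma s ^+ 2)%:E =
    \int[leb]_s ((a s w + eps * h s) ^+ 2 * rho s)%:E)%E.
  rewrite -ereal_clock_rate; apply: eq_integral => s _.
  by rewrite -perturbed_ratio ratio_clock_rate.
have le w : (\int[leb]_s ((a s w + eps * h s) ^+ 2 * rho s)%:E <= 2%:E * e w + C%:E)%E.
  have mw : measurable_fun [set: measurableTypeR R] (fun s => a s w * one s).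
    exact: measurable_section ja.
  have := @ereal_square_le _ _ _ leb rho _ _ eps mrho rho0 mw mh.
  rewrite (L1_EFin Ih) -EFinM -/C => le0; apply: le_trans (le_trans le0 _).
    rewrite le_eqVlt; apply/orP; left; apply/eqP; apply: eq_integral => s _.
    congr (_%:E); rewrite /clock_rate indicE.
    by case: (s \in _); rewrite /= ?mulr1// !(mul0r, mulr0).
  rewrite leeD2r// /e le_eqVlt; apply/orP; left; apply/eqP; congr (_ * _)%E.
  by apply: eq_integral => s _; rewrite sqr_clock_rate.
rewrite /finite_energy (eq_integral _ _ (fun w _ => E w)).
have m2e : measurable_fun [set: Om] (fun w => 2%:E * e w)%E by exact: measurable_funeM.
apply: (@le_lt_trans _ _ (\int[P]_w (2%:E * e w + C%:E))%E).
  apply: ge0_le_integral => //.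
  - by move=> w _; apply: integral_ge0 => s _; rewrite lee_fin mulr_ge0 ?sqr_ge0.
  - apply: (measurable_energy mS (Y := fun s w => a s w + eps * h s)).
    exact: jointly_measurable_lin.
  - exact: emeasurable_funD.
rewrite ge0_integralD//; last first.
  by move=> w _; rewrite mule_ge0.
rewrite (L1_EFin (L1_cst P _)) Rint_cst lte_add_pinfty ?ltry//.
rewrite (ge0_integralZl_EFin P measurableT (fun w _ => e0 w) me) ?ler0n//.
by apply: lte_mul_pinfty; [by []|by []|exact: ratio_energy].
Qed.

End perturbed_drift.

(** * The information bound at a fixed time *)

Section information_bound.
Context {R : realType} {d : measure_display} {Om : measurableType d}.
Variables (P : probability Om R) (T : R) (sigma : R -> R) (X : R -> Om -> R).
Hypothesis hX : gaussian_with_clock P T sigma X.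
Hypothesis sigma_neq0 : {ae (@lebesgue_measure R), forall s : R,
  0 <= s <= T -> sigma s != 0}.
Local Notation leb := (@lebesgue_measure R).
Local Notation rho := (clock_rate T sigma).
Variables (u udot : R -> Om -> R) (Pu : probability Om R) (I : Om -> R).
Hypotheses (u_drift : is_drift P T X u udot) (u_energy : finite_energy P T sigma udot).
Local Notation a := (fun s w => udot s w / sigma s ^+ 2).
Hypotheses (itoI : is_ito_integral P T sigma X a I)
  (PuE : forall A : set Om, measurable A ->
      Pu A = (\int[P]_(w in A) (girsanov_density T sigma udot I w)%:E)%E).
Local Notation L1 f := (Pu.-integrable [set: Om] (EFin \o f)).

Let mS := gwc_sigma_meas hX.
Let S2 := gwc_sigma_L2 hX.

Section direction.
Variables (h : R -> R) (M M2 : R) (J : Om -> R).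
Hypotheses (mh : measurable_fun [set: measurableTypeR R] h) (h0 : forall s, 0 <= h s)
  (hM : forall s, `|h s| <= M) (hrho : forall s, rho s = 0 -> h s = 0)
  (hM2 : forall s, `|h s * rho s| <= M2).
Hypothesis wJ : is_wiener_integral P T sigma X h J.
Local Notation S := (shifted_log_density T sigma a I h J).
Local Notation g := (\int[leb]_s (h s ^+ 2 * rho s)).

Let ma : measurable_process T a.
Proof. by have [_ _ [mudot _] _] := u_drift; exact: measurable_process_ratio hX _ mudot. Qed.

Let mST th : measurable_fun [set: Om] (S th).
Proof. exact: (measurable_shifted_log_density hX ma mh itoI wJ). Qed.

Let mE th : measurable_fun [set: Om] (fun w => expR (S th w)).
Proof. by apply: measurableT_comp => //; exact: mST. Qed.

Definition likelihood_ratio eps w := expR (S eps w - S 0 w).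
Local Notation L := likelihood_ratio.

Let mL eps : measurable_fun [set: Om] (L eps).
Proof. by apply: measurableT_comp => //; apply: measurable_funB; exact: mST. Qed.

Let L0 eps w : 0 <= L eps w. Proof. exact: expR_ge0. Qed.

(** The shifted density has mass one, and it is the Girsanov density of the perturbed
    drift because its integrand is $\dot u / \sigma^2 + \epsilon h$. *)
Lemma perturbed_law eps : exists Q : probability Om R,
  translated P T sigma X (perturbed_rate T sigma h udot eps) Q /\
  forall A, measurable A -> Q A = (\int[Pu]_(w in A) (L eps w)%:E)%E.
Proof.
have total := total_shifted_density hX u_drift u_energy itoI PuE mh hM wJ eps.
have [Q QE] := density_probability (mE eps) (fun w => expR_ge0 _) total.
have hL2 : leb.-integrable [set: R] (EFin \o (fun s => h s ^+ 2 * rho s)).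
  apply: (L1_bounded_clock_rate mS S2 (M := M ^+ 2)); first exact: measurable_funX.
  by move=> s; rewrite normrX lerXn2r ?nnegrE// (le_trans (normr_ge0 _) (hM 0)).
have ratioE : (fun s w => perturbed_rate T sigma h udot eps s w / sigma s ^+ 2) =
    (fun s w => a s w + eps * h s).
  by apply/funext => s; apply/funext => w; exact: perturbed_ratio.
exists Q; split.
  exists (fun w => I w + eps * J w).
    by rewrite ratioE; exact: ito_integral_shift hX _ _ _ _ ma mh hL2 itoI wJ eps.
  move=> A mA; rewrite (QE A mA); apply: eq_integral => w _; congr (_%:E).
  rewrite (@girsanov_densityE _ _ Om T sigma _ _ (fun=> 0) J) ratioE.
  have E : \int[leb]_s ((a s w + eps * h s + 0 * 0) ^+ 2 * rho s) =
      \int[leb]_s ((a s w + eps * h s) ^+ 2 * rho s).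
    by apply: eq_Rintegral => s _; rewrite [0 * 0]mul0r addr0.
  by rewrite /shifted_log_density E [0 * J w]mul0r [_ + 0]addr0.
move=> A mA; rewrite (QE A mA) [RHS]integral_mkcond.
transitivity (\int[Pu]_w (\1_A w * L eps w)%:E)%E; last first.
  apply: eq_integral => w _; rewrite patchE indicE.
  by case: ifPn => _; rewrite ?mul1r ?mul0r.
rewrite (ge0_integral_translated hX u_drift itoI PuE mh wJ); last first.
- by move=> w; rewrite mulr_ge0.
- by apply: measurable_funM => //; exact: measurable_indic.
rewrite integral_mkcond; apply: eq_integral => w _; rewrite patchE indicE.
case: ifPn => _; last by rewrite !mul0r.
by rewrite mul1r /likelihood_ratio -expRD subrK.
Qed.

(** The exponent of $L_\epsilon^2$ times the density of [Pu] is that of the density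
    shifted by $2 \epsilon$, up to the constant $\epsilon^2 g$. *)
Lemma likelihood_ratio_second_moment eps :
  L1 (fun w => L eps w ^+ 2) /\ \int[Pu]_w L eps w ^+ 2 = expR (eps ^+ 2 * g).
Proof.
have E : (\int[Pu]_w (L eps w ^+ 2)%:E = (expR (eps ^+ 2 * g))%:E)%E.
  rewrite (ge0_integral_translated hX u_drift itoI PuE mh wJ); last first.
  - by move=> w; exact: sqr_ge0.
  - exact: measurable_funX.
  have total := total_shifted_density hX u_drift u_energy itoI PuE mh hM wJ (2 * eps).
  pose c := expR (eps ^+ 2 * g).
  have -> : ((expR (eps ^+ 2 * g))%:E = \int[P]_w (c%:E * (expR (S (2 * eps) w))%:E))%E.
    rewrite (ge0_integralZl_EFin P measurableT) ?expR_ge0//.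
    - by rewrite total mule1.
    - by apply/measurable_EFinP; exact: mE.
  apply: ae_eq_integral => //.
  - by apply/measurable_EFinP; apply: measurable_funM => //; exact: measurable_funX.
  - by apply: measurable_funeM; apply/measurable_EFinP; exact: mE.
  have expand := log_density_expand hX sigma_neq0 I u_drift u_energy J mh hM.
  rewrite /ae_eq; apply: filterS expand => w Sw _.
  rewrite -EFinM /c /likelihood_ratio expr2 -!expRD; congr (expR _)%:E.
  by rewrite (Sw eps) (Sw (2 * eps)); field.
split; last exact: Rintegral_EFin.
apply: ge0_L1; [exact: measurable_funX|by move=> w; exact: sqr_ge0|].
by rewrite E ltry.
Qed.

Variables (xi : R -> Om -> R) (t : R).
Hypotheses (xi_unbiased : unbiased P T sigma X xi) (tT : 0 <= t <= T).
Hypotheses (mxi : measurable_fun [set: Om] (xi t)) (u2 : L1 (fun w => u t w ^+ 2))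
  (xi2 : L1 (fun w => (xi t w - u t w) ^+ 2)).

(** Chapman-Robbins with $\epsilon^2 = 1/n$, and $n$ tending to infinity. *)
Lemma directional_information_bound :
  direction_path T sigma h t ^+ 2 <= \int[Pu]_w (xi t w - u t w) ^+ 2 * g.
Proof.
set c := direction_path T sigma h t; set A := \int[Pu]_w _.
have mu : measurable_fun [set: Om] (u t).
  have [_ au _ _] := u_drift; have /andP[_ tT'] := tT.
  exact: (measurable_wrt_measurable hX tT' (au _ tT)).
have mZ : measurable_fun [set: Om] (fun w => xi t w - u t w) by exact: measurable_funB.
have A0 : 0 <= A by apply: Rintegral_ge0 => w _; exact: sqr_ge0.
have Iu : L1 (u t) by exact: L1_sqr.
have tru : translated P T sigma X udot Pu by exists I.
have [Ixi] := xi_unbiased u_drift u_energy tru tT Iu.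
rewrite unlock (L1_EFin Ixi) (L1_EFin Iu) => -[Exi].
have key eps : (eps * c) ^+ 2 <= A * (expR (eps ^+ 2 * g) - 1).
  have [Q [trQ QE]] := perturbed_law eps.
  have [L2 EL2] := likelihood_ratio_second_moment eps.
  have dr := perturbed_is_drift hX mh h0 hM hM2 u_drift eps.
  have en := perturbed_energy hX mh hM hrho u_drift u_energy eps.
  have IuQ : Q.-integrable [set: Om] (EFin \o u t).
    apply/(@integrable_density _ _ _ Pu Q _ (mL eps) (L0 eps) QE _ mu).
    exact: L1_mul.
  have IvQ : Q.-integrable [set: Om] (EFin \o perturbed_drift T sigma h u eps t).
    by apply: L1D => //; exact: L1_cst.
  have [IxiQ] := xi_unbiased dr en trQ tT IvQ.
  rewrite unlock (L1_EFin IxiQ) (L1_EFin IvQ) => -[ExiQ].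
  have := chapman_robbins_inequality (mL eps) (L0 eps) QE mZ xi2 L2.
  rewrite -/A EL2 !RintB// Exi ExiQ subrr subr0.
  rewrite RintD//; last exact: L1_cst.
  by rewrite Rint_cst addrAC subrr add0r.
pose N (n : nat) : R := n.+1%:R.
have N0 n : 0 < N n by rewrite ltr0n.
have lim : A * (N n * (expR (g / N n) - 1)) @[n --> \oo] --> A * g.
  apply: cvgM; first exact: cvg_cst.
  apply: cvg_mul_expRB1 => //; apply/cvgryPge => B.
  near=> n; rewrite (le_trans (ler_norm B))// (le_trans (ltW (truncnS_gt _)))//.
  by rewrite ler_nat ltnS; near: n; exact: nbhs_infty_ge.
apply: (cvgr_to_ge lim); apply: nearW => n.
have := key (Num.sqrt (N n)^-1).
rewrite exprMn sqr_sqrtr; last by rewrite invr_ge0 ltW.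
rewrite mulrC ler_pdivrMr// => /le_trans; apply.
by rewrite [_^-1 * g]mulrC -mulrA [_ * N n]mulrC lexx.
Unshelve. all: by end_near. Qed.

End direction.
End information_bound.

Section pointwise_bound.
Context {R : realType} {d : measure_display} {Om : measurableType d}.
Variables (P : probability Om R) (T : R) (sigma : R -> R) (X : R -> Om -> R).
Hypotheses (hX : gaussian_with_clock P T sigma X) (T_ge0 : 0 <= T).
Hypothesis sigma_neq0 : {ae (@lebesgue_measure R), forall s : R,
  0 <= s <= T -> sigma s != 0}.
Local Notation leb := (@lebesgue_measure R).
Local Notation rho := (clock_rate T sigma).
Variables (u udot : R -> Om -> R) (Pu : probability Om R).
Hypotheses (u_drift : is_drift P T X u udot) (u_energy : finite_energy P T sigma udot)
  (Pu_def : translated P T sigma X udot Pu).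
Variables (xi : R -> Om -> R) (t : R).
Hypotheses (xi_unbiased : unbiased P T sigma X xi) (tT : 0 <= t <= T)
  (mxi : measurable_fun [set: Om] (xi t))
  (u2 : Pu.-integrable [set: Om] (EFin \o (fun w => u t w ^+ 2))).

Let mS := gwc_sigma_meas hX.
Let S2 := gwc_sigma_L2 hX.
Let mrho := measurable_clock_rate mS.
Let rho0 s : 0 <= rho s. Proof. exact: clock_rate_ge0. Qed.

(** On this set the direction $h = 1$ has a bounded rate $h \sigma^2$. *)
Definition bounded_part (n : nat) : set (measurableTypeR R) :=
  [set s | [/\ 0 <= s <= t, sigma s != 0 & `|sigma s| <= n%:R] ].

Lemma measurable_bounded_part n : measurable (bounded_part n).
Proof.
have /andP[t0 tT'] := tT.
have mB : measurable (`[- n%:R, n%:R]%classic `\` [set 0] : set R).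
  by apply: measurableD; [exact: measurable_itv|exact: measurable_set1].
have mI (b : R) : measurable (`[0, b] : set (measurableTypeR R)) by exact: measurable_itv.
have := measurableI _ _ (mI t) (mS (mI T) mB).
congr measurable; apply/seteqP; split => s /=; rewrite !in_itv/= /bounded_part/= ler_norml.
  by move=> [-> [_ [/andP[-> ->] /eqP ->]]].
move=> [/andP[s0 st] sn0 sn]; split; first by rewrite s0.
by split; [rewrite s0 (le_trans st)|split => //; exact/eqP].
Qed.

(** For the indicator of [bounded_part n] both $\int h \sigma^2$ and
    $\int h^2 \sigma^2$ equal some $g_n$, so that $g_n \leq E_u[(\xi_t - u_t)^2]$; and
    $g_n$ converges to the clock at [t]. *)
Lemma information_bound :
  ((clock sigma t)%:E <= \int[Pu]_w ((xi t w - u t w) ^+ 2)%:E)%E.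
Proof.
have /andP[t0 tT'] := tT.
have mu : measurable_fun [set: Om] (u t).
  have [_ au _ _] := u_drift.
  exact: (measurable_wrt_measurable hX tT' (au _ tT)).
have [->|finA] := eqVneq (\int[Pu]_w ((xi t w - u t w) ^+ 2)%:E)%E +oo%E.
  by rewrite leey.
have xi2 : Pu.-integrable [set: Om] (EFin \o (fun w => (xi t w - u t w) ^+ 2)).
  apply: ge0_L1; first by apply: measurable_funX; exact: measurable_funB.
    by move=> w; exact: sqr_ge0.
  by rewrite ltey.
rewrite (L1_EFin xi2) lee_fin; set A := \int[Pu]_w _.
have A0 : 0 <= A by apply: Rintegral_ge0 => w _; exact: sqr_ge0.
have [I itoI PuE] := Pu_def.
pose h n := \1_(bounded_part n) : R -> R.
have h2 n s : h n s ^+ 2 = h n s.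
  by rewrite /h indicE; case: (_ \in _); rewrite ?expr1n ?expr0n.
have mh n : measurable_fun [set: measurableTypeR R] (h n).
  by apply: measurable_indic; exact: measurable_bounded_part.
have rate s : 0 <= s <= T -> rho s = sigma s ^+ 2.
  by move=> sT; rewrite /clock_rate indicE mem_set ?mul1r//= in_itv.
pose g n := \int[leb]_s (h n s * rho s).
have gA n : g n <= A.
  have hM s : `|h n s| <= 1 by rewrite /h indicE; case: (_ \in _); rewrite ?normr1 ?normr0.
  have h0 s : 0 <= h n s by rewrite /h indicE ler0n.
  have hrho s : rho s = 0 -> h n s = 0.
    rewrite /h indicE; case: (boolP (s \in _)) => //; rewrite inE => -[/andP[s0 st] sn0 _].
    rewrite rate ?s0 ?(le_trans st)// => /eqP.
    by rewrite sqrf_eq0 (negbTE sn0).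
  have hM2 s : `|h n s * rho s| <= n%:R ^+ 2.
    rewrite /h indicE; case: (boolP (s \in _)); last by rewrite mul0r normr0 sqr_ge0.
    rewrite inE => -[/andP[s0 st] _ sn]; rewrite mul1r rate ?s0 ?(le_trans st)//.
    by rewrite normrX lerXn2r ?nnegrE.
  have hW2 : leb.-integrable [set: R] (EFin \o (fun s => h n s ^+ 2 * rho s)).
    by under eq_fun do rewrite h2; exact: (L1_bounded_clock_rate mS S2 (mh n) hM).
  have [J wJ] := wiener_integral_exists hX (mh n) hW2
    (approximable_indic hX T_ge0 (measurable_bounded_part n)).
  have := directional_information_bound hX sigma_neq0 u_drift u_energy itoI PuE
    (mh n) h0 hM hrho hM2 wJ xi_unbiased tT mxi u2 xi2.
  have -> : direction_path T sigma (h n) t = g n.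
    apply: eq_Rintegral => s _; rewrite mulrA; congr (_ * _).
    rewrite /h !indicE; case: (boolP (s \in bounded_part n)) => [|_]; last by rewrite mulr0.
    by rewrite inE => -[st _ _]; rewrite mem_set ?mul1r//= in_itv.
  have -> : \int[leb]_s (h n s ^+ 2 * rho s) = g n.
    by apply: eq_Rintegral => s _; rewrite h2.
  have g0 : 0 <= g n by apply: Rintegral_ge0 => s _; rewrite mulr_ge0.
  rewrite -/A expr2; move: g0; rewrite le_eqVlt => /predU1P[<-//|g0].
  by rewrite ler_pM2r.
have cvg_g : g n @[n --> \oo] --> clock sigma t.
  have -> : clock sigma t = \int[leb]_s (\1_(`[0, t] : set R) s * rho s).
    rewrite /clock Rintegral_mkcond; apply: eq_Rintegral => s _; rewrite patchE indicE.
    case: ifPn => [|_]; last by rewrite mul0r.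
    rewrite inE/= in_itv/= => /andP[s0 st].
    by rewrite mul1r rate// s0 (le_trans st).
  apply: (proj2 (@dominated_Rintegral _ _ _ leb (fun n s => h n s * rho s) _ rho _ _ _ _ _)).
  - by move=> n; exact: measurable_funM.
  - by apply: measurable_funM => //; apply: measurable_indic; exact: measurable_itv.
  - exact: L1_clock_rate.
  - move=> n s; rewrite normrM (ger0_norm (rho0 s)) -[leRHS]mul1r ler_wpM2r//.
    by rewrite /h indicE; case: (_ \in _); rewrite ?normr1 ?normr0.
  - move=> s; apply: cvg_near_cst; near=> n.
    rewrite /h !indicE.
    have [st|nst] := boolP (s \in (`[0, t]%classic : set R)); last first.
      by rewrite memNset// => -[st _ _]; move: nst; rewrite notin_setE/= in_itv.
    move: st; rewrite inE/= in_itv/= => st; have /andP[s0 st'] := st.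
    have [s0'|sn0] := eqVneq (sigma s) 0.
      by rewrite rate ?s0 ?(le_trans st')// s0' expr0n !mulr0.
    rewrite mem_set//; split => //.
    rewrite (le_trans (ltW (truncnS_gt _)))// ler_nat.
    by near: n; exact: nbhs_infty_ge.
by apply: (cvgr_to_le cvg_g); exact: nearW.
Unshelve. all: by end_near. Qed.

End pointwise_bound.

(** * Integration over time *)

Section integrated_risk.
Context {R : realType} {d : measure_display} {Om : measurableType d}.
Variables (Q : probability Om R) (T : R).
Variable mu : {finite_measure set (measurableTypeR R) -> \bar R}.
Local Notation one := (\1_(`[0, T] : set R) : R -> R).
Local Open Scope ereal_scope.

Let measurable_sqr (Z : R -> Om -> R) : measurable_process T Z ->
  measurable_fun [set: Om * measurableTypeR R] (fun z => (((Z z.2 z.1 * one z.2) ^+ 2)%R)%:E).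
Proof.
by move=> /measurable_processP jZ; apply/measurable_EFinP; exact: measurable_funX.
Qed.

Let sqr_nonneg (Z : R -> Om -> R) (z : Om * measurableTypeR R) :
  0 <= (((Z z.2 z.1 * one z.2) ^+ 2)%R)%:E.
Proof. by rewrite lee_fin sqr_ge0. Qed.

Let second_moment_indic (Z : R -> Om -> R) t :
  \int[Q]_w (((Z t w * one t) ^+ 2)%R)%:E =
  ((fun t => \int[Q]_w ((Z t w ^+ 2)%R)%:E) \_ `[0%R, T]) t.
Proof.
rewrite patchE indicE; case: ifPn => _.
  by apply: eq_integral => w _; rewrite mulr1.
by apply: integral0_eq => w _; rewrite mulr0 expr0n.
Qed.

Lemma second_moment_integral (Z : R -> Om -> R) : measurable_process T Z ->
  \int[Q]_w \int[mu]_(t in `[0%R, T]) ((Z t w ^+ 2)%R)%:E =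
  \int[mu]_(t in `[0%R, T]) \int[Q]_w ((Z t w ^+ 2)%R)%:E.
Proof.
move=> mZ; have := @fubini_tonelli _ _ _ _ _ Q mu _ (measurable_sqr mZ) (sqr_nonneg Z).
rewrite /= => E; rewrite [RHS]integral_mkcond.
transitivity (\int[mu]_t \int[Q]_w (((Z t w * one t) ^+ 2)%R)%:E); last first.
  by apply: eq_integral => t _; exact: second_moment_indic.
rewrite -E; apply: eq_integral => w _; rewrite integral_mkcond; apply: eq_integral => t _.
by rewrite patchE indicE; case: ifPn => _; rewrite ?mulr1// mulr0 expr0n.
Qed.

Lemma measurable_second_moment (Z : R -> Om -> R) : measurable_process T Z ->
  measurable_fun (`[0%R, T] : set (measurableTypeR R)) (fun t => \int[Q]_w ((Z t w ^+ 2)%R)%:E).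
Proof.
move=> mZ; have mI : measurable (`[0%R, T] : set (measurableTypeR R)) by exact: measurable_itv.
apply: (measurable_restrictT _ mI).2.
have := @measurable_fun_fubini_tonelli_G _ _ _ _ _ Q _ (measurable_sqr mZ) (sqr_nonneg Z).
congr measurable_fun; apply/funext => t; exact: second_moment_indic.
Qed.

(** Fubini in the direction of time: it provides the bound at a fixed time with its
    hypothesis for almost every time. *)
Lemma square_integrable_times (Y : R -> Om -> R) :
  (forall t, (0 <= t <= T)%R -> measurable_fun [set: Om] (Y t)) ->
  square_integrable Q mu T Y ->
  {ae mu, forall t, (0 <= t <= T)%R ->
    Q.-integrable [set: Om] (EFin \o (fun w => (Y t w ^+ 2)%R))}.
Proof.
move=> mYt [mY]; rewrite square_integral_indic.
rewrite (@fubini_tonelli2 _ _ _ _ _ Q mu _ (measurable_sqr mY) (sqr_nonneg Y)) => fin.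
have mG := @measurable_fun_fubini_tonelli_G _ _ _ _ _ Q _ (measurable_sqr mY) (sqr_nonneg Y).
have IG : mu.-integrable [set: measurableTypeR R]
    (fubini_G Q (fun z => (((Y z.2 z.1 * one z.2) ^+ 2)%R)%:E)).
  apply/integrableP; split => //.
  by under eq_integral do rewrite gee0_abs ?integral_ge0//.
apply: filterS (integrable_ae measurableT IG) => t /(_ Logic.I) finG tT.
apply: ge0_L1; [by apply: measurable_funX; exact: mYt|by move=> w; exact: sqr_ge0|].
rewrite -ge0_fin_numE; last by apply: integral_ge0 => w _; rewrite lee_fin sqr_ge0.
move: finG; rewrite /fubini_G/= second_moment_indic patchE mem_set//.
Qed.

End integrated_risk.

Theorem proposition3p3 (R : realType) (d : measure_display)
    (Om : measurableType d) (P : probability Om R) (T : R)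
    (mu : {finite_measure set (measurableTypeR R) -> \bar R})
    (sigma : R -> R) (X : R -> Om -> R) (u udot : R -> Om -> R)
    (Pu : probability Om R)
    (T_gt0 : 0 < T)
    (sigma_meas : measurable_fun `[0, T] sigma)
    (sigma_L2 : (\int[lebesgue_measure]_(s in `[0%R, T])
                   (sigma s ^+ 2)%:E < +oo)%E)
    (sigma_neq0 : {ae lebesgue_measure, forall s : R,
                     0 <= s <= T -> sigma s != 0})
    (X_meas : measurable_process T X)
    (X_generates : @measurable d Om = natural_filtration X T)
    (X_gaussian : gaussian_process P T X)
    (X_centered : forall t, 0 <= t <= T -> ('E_P[X t] = 0)%E)
    (X_cov : forall s t, 0 <= s <= T -> 0 <= t <= T ->
       ('E_P[(fun w => X s w * X t w)%R] =
        \int[lebesgue_measure]_(r in `[0%R, Num.min s t])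
          (sigma r ^+ 2)%:E)%E)
    (u_drift : is_drift P T X u udot)
    (u_energy : finite_energy P T sigma udot)
    (Pu_def : translated P T sigma X udot Pu)
    (u_L2 : square_integrable Pu mu T u) :
  (forall xi : R -> Om -> R, measurable_process T xi ->
     unbiased P T sigma X xi -> adapted_estimator T X u xi ->
     (cramer_rao_bound T mu sigma <= quadratic_risk T mu Pu xi u)%E) /\
  [/\ unbiased P T sigma X X,
      adapted T (fun t w => X t w - u t w) u -> adapted_estimator T X u X &
      quadratic_risk T mu Pu X u = cramer_rao_bound T mu sigma].
Proof.
have hX : gaussian_with_clock P T sigma X by split.
have T_ge0 : 0 <= T by exact: ltW.
have mI : measurable (`[0, T] : set (measurableTypeR R)) by exact: measurable_itv.
have [mu_proc adu _ _] := u_drift.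
have clockE t : 0 <= t <= T ->
    (\int[lebesgue_measure]_(s in `[0%R, t]) (sigma s ^+ 2)%:E = (clock sigma t)%:E)%E.
  move=> /andP[t0 tT]; rewrite /clock /Rintegral fineK//.
  rewrite ge0_fin_numE; last by apply: integral_ge0 => s _; rewrite lee_fin sqr_ge0.
  apply: le_lt_trans sigma_L2; apply: ge0_subset_integral => //.
  - by apply/measurable_EFinP; exact: measurable_funX.
  - by move=> s _; rewrite lee_fin sqr_ge0.
  - by apply: subset_itvl; rewrite bnd_simp.
have boundE : cramer_rao_bound T mu sigma =
    (\int[mu]_(t in `[0%R, T]) (clock sigma t)%:E)%E.
  by apply: eq_integral => t; rewrite inE/= in_itv/=; exact: clockE.
have riskE xi : measurable_process T xi -> quadratic_risk T mu Pu xi u =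
    (\int[mu]_(t in `[0%R, T]) \int[Pu]_w ((xi t w - u t w) ^+ 2)%:E)%E.
  move=> mxi; rewrite -(@second_moment_integral _ _ _ Pu T mu (fun t w => xi t w - u t w)).
    rewrite /quadratic_risk; apply: eq_integral => w _; apply: eq_integral => t _.
    by rewrite real_normK ?num_real.
  exact: measurable_funB.
have mut t : 0 <= t <= T -> measurable_fun [set: Om] (u t).
  move=> tT; have /andP[_ tT'] := tT.
  exact: (measurable_wrt_measurable hX tT' (adu _ tT)).
have noiseE t : 0 <= t <= T ->
    (\int[Pu]_w ((X t w - u t w) ^+ 2)%:E = (clock sigma t)%:E)%E.
  move=> tT; have [I itoI PuE] := Pu_def.
  have [_ _ I2 E2] := translated_noise hX T_ge0 sigma_neq0 u_drift u_energy itoI PuE tT.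
  by rewrite (L1_EFin I2) E2.
have efficient : quadratic_risk T mu Pu X u = cramer_rao_bound T mu sigma.
  rewrite riskE// boundE; apply: eq_integral => t; rewrite inE/= in_itv/=; exact: noiseE.
split; last first.
  split => //; first exact: (observation_unbiased hX T_ge0 sigma_neq0).
  move=> adu' t tT; have /andP[t0 _] := tT.
  have mN : measurable_wrt (natural_filtration (fun t w => X t w - u t w) t)
      (fun w => X t w - u t w).
    by apply: (@measurable_wrt_process _ _ _ (fun t w => X t w - u t w)); rewrite t0 lexx.
  have mU := adu' _ tT.
  rewrite (_ : X t = fun w => (X t w - u t w) + u t w); last first.
    by apply/funext => w; rewrite subrK.
  by apply/measurable_wrtP; apply: measurable_funD; exact/measurable_wrtP.
move=> xi mxi xi_unbiased _.
have mxit t : 0 <= t <= T -> measurable_fun [set: Om] (xi t).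
  move=> tT; have /measurable_processP jxi := mxi.
  have := measurableT_comp jxi (measurable_pair2 t).
  congr measurable_fun; apply/funext => w /=.
  by rewrite indicE mem_set ?mulr1//= in_itv.
rewrite boundE riskE//; apply: ae_ge0_le_integral => //.
- move=> t _; rewrite lee_fin; apply: Rintegral_ge0 => s _; exact: sqr_ge0.
- apply: eq_measurable_fun (measurable_second_moment Pu
    (measurable_funB X_meas mu_proc : measurable_process T (fun t w => X t w - u t w))).
  by move=> t; rewrite inE/= in_itv/=; exact: noiseE.
- by move=> t _; apply: integral_ge0 => w _; rewrite lee_fin sqr_ge0.
- by apply: (@measurable_second_moment _ _ _ Pu T (fun t w => xi t w - u t w)); exact: measurable_funB.
have [N [mN N0 sN]] := square_integrable_times mut u_L2.
exists N; split => // t /= /not_implyP[]; rewrite in_itv/= => tT not_le.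
apply: sN => /= u2; apply: not_le.
exact: (information_bound hX T_ge0 sigma_neq0 u_drift u_energy Pu_def xi_unbiased tT
  (mxit _ tT) (u2 tT)).
Qed.
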